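(* For every $q\in(2,\infty)$ there exist constants $c_q>0$ and $C_q>0$ such that for all $\theta\in[1,\infty]$ and all integers $n\ge 2$: $$c_q\,n^{-1/2}\log^{1/2}n\;\le\; d_n\big(B^1_{1,\theta}[0,1],L_q[0,1]\big)\;\le\; C_q\,n^{-1/2}\log^{1/2}n\qquad\text{if }1\le\theta\le 2,$$ $$c_q\,n^{-1/2}\log^{1-1/\theta}n\;\le\; d_n\big(B^1_{1,\theta}[0,1],L_q[0,1]\big)\;\le\; C_q\,n^{-1/2}\log^{1-1/\theta}n\qquad\text{if }2\le\theta\le \infty$$ (with $1/\infty=0$).
   Context: For a normed space $X$ and $K\subset X$, the Kolmogorov $n$-width is $d_n(K,X)=\inf_{Q_n}\sup_{x\in K}\inf_{y\in Q_n}\|x-y\|_X$, the infimum over all linear subspaces $Q_n\subset X$ of dimension at most $n$. For a segment $I\subset\mathbb R$, $r>0$, $p,\theta\in[1,\infty]$ and $s=1+\lfloor r\rfloor$, let $\omega_s(f,t)_p=\sup_{0<h\le t}\|\Delta_h^s(f,\cdot)\|_{L_p(I\cap(I-sh))}$ be the modulus of smoothness of order $s$ ($\Delta_h^s$ the $s$-th forward difference with step $h$). The Besov seminorm is $|f|_{B^r_{p,\theta}(I)}=\left(\int_0^\infty (t^{-r}\omega_s(f,t)_p)^\theta\,\frac{dt}{t}\right)^{1/\theta}$ for $1\le\theta<\infty$ and $\sup_{t>0}t^{-r}\omega_s(f,t)_p$ for $\theta=\infty$. The Besov space $\mathcal B^r_{p,\theta}(I)$ consists of $f\in L_p(I)$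 with finite norm $\|f\|_{L_p(I)}+|f|_{B^r_{p,\theta}(I)}$, and the Besov class $B^r_{p,\theta}(I)$ is its unit ball. Here $r=1$, $p=1$, $I=[0,1]$, and $B^1_{1,\theta}[0,1]$ is regarded as a subset of $L_q[0,1]$. *)

(* Defs.v *)
From mathcomp Require Import all_boot all_order all_algebra.
From mathcomp Require Import all_classical all_reals all_analysis.
Set Implicit Arguments. Unset Strict Implicit. Unset Printing Implicit Defensive.
Import Order.TTheory GRing.Theory Num.Theory.
Local Open Scope classical_set_scope.
Local Open Scope ring_scope.

Section Defs.
Variable R : realType.
Local Notation mu := (@lebesgue_measure R).

Definition LpNorm (D : set R) (p : R) (f : R -> R) : \bar R :=
  ((\int[mu]_(x in D) (`|f x| `^ p)%:E) `^ p^-1)%E.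

Definition fdiff (s : nat) (h : R) (f : R -> R) (x : R) : R :=
  \sum_(k < s.+1) (-1) ^+ (s - k) * ('C(s, k))%:R * f (x + k%:R * h).

Definition diff_dom (I : set R) (s : nat) (h : R) : set R :=
  [set x | I x /\ I (x + s%:R * h)].

Definition modsmooth (I : set R) (s : nat) (p : R) (f : R -> R) (t : R) : \bar R :=
  ereal_sup [set LpNorm (diff_dom I s h) p (fdiff s h f) | h in `]0%R, t]].

Definition besov_s (r : R) : nat := (absz (Num.floor r)).+1.  (* r > 0 so floor r >= 0 *)

Definition besov_semi (I : set R) (r p : R) (theta : \bar R) (f : R -> R) : \bar R :=
  match theta with
  | th%:E =>
      ((\int[mu]_(t in `]0%R, +oo[)
          (((t `^ (- r))%:E * modsmooth I (besov_s r) p f t) `^ th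
            * (t^-1)%:E)) `^ th^-1)%E
  | _ => ereal_sup [set ((t `^ (- r))%:E * modsmooth I (besov_s r) p f t)%E
                    | t in `]0%R, +oo[]
  end.

Definition besov_class (I : set R) (r p : R) (theta : \bar R) : set (R -> R) :=
  [set f | measurable_fun I f /\ (LpNorm I p f < +oo)%E /\
           (LpNorm I p f + besov_semi I r p theta f <= 1)%E].

Definition inLp (I : set R) (q : R) (f : R -> R) : Prop :=
  measurable_fun I f /\ (LpNorm I q f < +oo)%E.

(* Kolmogorov n-width of K in L_q(I): infimum over subspaces Q of L_q(I) of
   dimension at most n, each given as the span of n elements g_0..g_{n-1}
   of L_q(I), of sup_{f in K} inf_{y in Q} ||f - y||_{L_q(I)}. *)
Definition kolmogorov_width (I : set R) (q : R) (K : set (R -> R)) (n : nat) : \bar R :=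
  ereal_inf [set ereal_sup [set ereal_inf
      [set LpNorm I q (fun x => f x - \sum_(i < n) c i * g i x) | c in @setT ('I_n -> R)]
      | f in K]
    | g in [set g : 'I_n -> R -> R | forall i, inLp I q (g i)]].

Definition inv_theta (theta : \bar R) : R :=
  match theta with th%:E => th^-1 | _ => 0 end.

End Defs.

(* Main.v *)
Require Import Defs.
From mathcomp Require Import all_boot all_order all_algebra.
From mathcomp Require Import all_classical all_reals all_analysis measurable_realfun.
From mathcomp Require Import ring lra zify.
Import Order.TTheory GRing.Theory Num.Theory.
Import numFieldNormedType.Exports.
Local Open Scope classical_set_scope.
Local Open Scope ring_scope.

(* Upper bound. On the dyadic cells of level k let del_k be the difference between the Haar
   coefficients of f and half of those of the parent cells, which vanishes on affine functions.
   It is controlled by second differences, so on the Besov class the l_1-norm of del_k is at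
   most C nu_k, where (nu_k) is bounded in l_theta. By derandomising random characters, the
   identity of R^N is approximated by operators of rank n' sending the unit ball of l_1 to
   within (p / n')^(1/2) N^(1/2p) of it in l_{2p}. Spending rank n' = n / K on each of the first
   K ~ p log n levels, and adding the levels up by a square-function estimate for dyadic
   martingales in L_{2p}, gives the error (K / n)^(1/2) (sum_{k < K} nu_k^2)^(1/2), and
   sum_{k < K} nu_k^2 is at most 1 for theta <= 2 and 2 K^(1 - 2/theta) for theta >= 2.

   Lower bound. Let y_x be approximants, from a space of dimension n, to test functions F_x,
   and T_x linear functionals. The matrix T_z(y_x) has rank at most n, so its squared trace is
   at most n times its squared Hilbert-Schmidt norm, which the L_2-boundedness of the dyadic
   averages controls. Take L ~ log n levels above log_2 n. For theta >= 2 the F_x are sums of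
   L concentric hats, one per level, scaled by L^(-1/theta), and T_x is the average over the
   innermost cell; for theta <= 2 the F_x are single hats and the T_x their Haar coefficients. *)

Set Implicit Arguments. Unset Strict Implicit. Unset Printing Implicit Defensive.

(** A hat of height one has a Besov seminorm bounded independently of its scale, so no level
    dominates and the logarithm counts levels. The modulus of order 2 does not see slopes, hence
    does not control Haar coefficients level by level; they are recovered from [del] through a
    recursion that contracts by 1/2. The exponent q is raised to an even one, called 2p in the
    overview and 2 * p.+1 in the code, because even powers are polynomials. The number K of levels
    is forced by the tail: at levels k >= K no rank is spent, and a unit vector of R^(2^k) has
    squared normalised l_{2p}-norm 2^(-k/p), which falls below 1/n once k >= p log_2 n. In the lower
    bound the test functions need a squared L_2-norm well below 1/n, so that n times it is
    negligible against the trace; this is why the levels start above log_2 n. An error e in L_q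
    moves an average over a cell of level k by about 2^(k/q) e, and q > 2 leaves room to go up to k
    = (1 + 1/m) log_2 n while this remains below n^(1/2) e. *)

Ltac ge0 := repeat first [done | assumption | exact: ler0n | apply: sqr_ge0 | apply: exprn_ge0
  | apply: addr_ge0 | apply: divr_ge0 | apply: mulr_ge0 | by apply: ltW].

(** * Convexity of powers and growth of dyadic martingales *)

Section Powers.
Variable R : realFieldType.
Implicit Types (x m u v : R) (p : nat).

(** Convexity of the power on the half-line. In the induction, multiplying the tangent line by x
    exceeds the next tangent line by (p + 1) m^p (x - m)^2. *)
Lemma exprn_tangent p x m : 0 <= x -> 0 <= m ->
  m ^+ p.+1 + p.+1%:R * m ^+ p * (x - m) <= x ^+ p.+1.
Proof.
move=> x0 m0; elim: p => [|p IH]; first by rewrite !expr1 expr0; lra.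
rewrite [x ^+ p.+2]exprS.
apply: le_trans (ler_wpM2l x0 IH).
rewrite -subr_ge0.
have -> : x * (m ^+ p.+1 + p.+1%:R * m ^+ p * (x - m)) -
  (m ^+ p.+2 + p.+2%:R * m ^+ p.+1 * (x - m)) =
  p.+1%:R * m ^+ p * (x - m) ^+ 2.
  by rewrite !exprS -[p.+2]addn1 natrD; ring.
by ge0.
Qed.

(** Average the tangent inequality at the mean m; the linear terms cancel. *)
Lemma exprn_jensen (I : Type) (r : seq I) (P : pred I) (w x : I -> R) p :
  (forall i, P i -> 0 <= w i) -> (forall i, P i -> 0 <= x i) ->
  \sum_(i <- r | P i) w i = 1 ->
  (\sum_(i <- r | P i) w i * x i) ^+ p.+1 <= \sum_(i <- r | P i) w i * x i ^+ p.+1.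
Proof.
move=> w0 x0 w1; set m := \sum_(i <- r | P i) w i * x i.
have m0 : 0 <= m by apply: sumr_ge0 => i Pi; rewrite mulr_ge0 ?w0 ?x0.
have -> : m ^+ p.+1 =
    \sum_(i <- r | P i) w i * (m ^+ p.+1 + p.+1%:R * m ^+ p * (x i - m)).
  transitivity (\sum_(i <- r | P i) (w i * (m ^+ p.+1 - p.+1%:R * m ^+ p * m)
      + (w i * x i) * (p.+1%:R * m ^+ p))).
    rewrite big_split /= -!mulr_suml w1 -/m; ring.
  by apply: eq_bigr => i _; ring.
by apply: ler_sum => i Pi; rewrite ler_wpM2l ?w0 // exprn_tangent ?x0.
Qed.

(* The weights need not be normalised: divide by their sum in [exprn_jensen]. *)
Lemma exprn_sum_le (I : Type) (r : seq I) (P : pred I) (c x : I -> R) p (s : R) :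
  (forall i, P i -> 0 <= c i) -> (forall i, P i -> 0 <= x i) ->
  \sum_(i <- r | P i) c i <= s ->
  (\sum_(i <- r | P i) c i * x i) ^+ p.+1 <=
  s ^+ p * \sum_(i <- r | P i) c i * x i ^+ p.+1.
Proof.
move=> c0 x0 cs; set t := \sum_(i <- r | P i) c i in cs.
have t0 : 0 <= t by apply: sumr_ge0.
have S0 : 0 <= \sum_(i <- r | P i) c i * x i ^+ p.+1.
  by apply: sumr_ge0 => i Pi; rewrite mulr_ge0 ?c0 ?exprn_ge0 ?x0.
apply: (@le_trans _ _ (t ^+ p * \sum_(i <- r | P i) c i * x i ^+ p.+1)); last first.
  by rewrite ler_wpM2r // lerXn2r ?nnegrE // (le_trans t0).
have [t_eq0|t_neq0] := eqVneq t 0.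
  suff -> : \sum_(i <- r | P i) c i * x i = 0 by rewrite exprS mul0r mulr_ge0 ?exprn_ge0.
  move: t_eq0; rewrite /t; elim: (r) => [|i s' IH]; first by rewrite !big_nil.
  rewrite !big_cons; case: ifP => // Pi /eqP.
  rewrite paddr_eq0 ?c0 ?sumr_ge0 // => /andP[/eqP -> /eqP /IH ->].
  by rewrite mul0r addr0.
have tp : 0 < t by rewrite lt_neqAle eq_sym t_neq0.
have := @exprn_jensen I r P (fun i => c i / t) x p.
have -> : \sum_(i <- r | P i) c i / t = 1 by rewrite -mulr_suml divff.
have -> : \sum_(i <- r | P i) c i / t * x i = (\sum_(i <- r | P i) c i * x i) / t.
  by rewrite mulr_suml; apply: eq_bigr => i _; rewrite mulrAC.
have -> : \sum_(i <- r | P i) c i / t * x i ^+ p.+1 = (\sum_(i <- r | P i) c i * x i ^+ p.+1) / t.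
  by rewrite mulr_suml; apply: eq_bigr => i _; rewrite mulrAC.
move=> /(_ _ x0 erefl) H.
have {}H := H (fun i Pi => divr_ge0 (c0 i Pi) t0).
rewrite expr_div_n ler_pdivrMr ?exprn_gt0 // in H.
apply: (le_trans H); rewrite exprS.
suff -> : (\sum_(i <- r | P i) c i * x i ^+ p.+1) / t * (t * t ^+ p)
   = t ^+ p * \sum_(i <- r | P i) c i * x i ^+ p.+1 by [].
by field.
Qed.

(** Minkowski's inequality in l_{p+1}, stated without roots: U + V = u (U / u) + v (V / v), and
    [exprn_sum_le] with the two weights u, v applies at each index. *)
Lemma minkowski_sum (I : finType) (w U V : I -> R) p u v :
  (forall i, 0 <= w i) -> (forall i, 0 <= U i) -> (forall i, 0 <= V i) ->
  0 <= u -> 0 <= v ->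
  \sum_i w i * U i ^+ p.+1 <= u ^+ p.+1 -> \sum_i w i * V i ^+ p.+1 <= v ^+ p.+1 ->
  \sum_i w i * (U i + V i) ^+ p.+1 <= (u + v) ^+ p.+1.
Proof.
move=> w0 U0 V0.
(* If u = 0, each index has weight zero or U i = 0, so U drops out; the main case divides by u and
   v. *)
have degenerate (U' V' : I -> R) (v' : R) : (forall i, 0 <= U' i) ->
    \sum_i w i * U' i ^+ p.+1 <= 0 -> \sum_i w i * V' i ^+ p.+1 <= v' ^+ p.+1 ->
    \sum_i w i * (U' i + V' i) ^+ p.+1 <= v' ^+ p.+1.
  move=> U'0 HU; apply: le_trans; apply: ler_sum => i _.
  have U'i j : 0 <= w j * U' j ^+ p.+1 by rewrite mulr_ge0 ?exprn_ge0.
  have : w i * U' i ^+ p.+1 = 0.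
    apply/eqP; rewrite eq_le U'i andbT; apply: le_trans HU.
    by rewrite (bigD1 i) //= lerDl sumr_ge0.
  move=> /eqP; rewrite mulf_eq0 expf_eq0 /= => /orP[/eqP ->|/eqP ->].
    by rewrite !mul0r.
  by rewrite add0r.
rewrite le_eqVlt => /predU1P[<-|u0]; first by rewrite expr0n add0r => _; exact: degenerate.
rewrite le_eqVlt => /predU1P[<-|v0].
  rewrite expr0n addr0 => HU HV.
  by under eq_bigr do rewrite addrC; exact: degenerate.
move=> HU HV.
have uv0 : 0 < u + v by rewrite addr_gt0.
have uvn : u + v != 0 by rewrite gt_eqF.
apply: (@le_trans _ _ (\sum_i (u + v) ^+ p * (u * (w i * U i ^+ p.+1) / u ^+ p.+1
   + v * (w i * V i ^+ p.+1) / v ^+ p.+1))).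
  apply: ler_sum => i _.
  have := @exprn_sum_le bool [:: true; false] xpredT
     (fun b => if b then u else v) (fun b => if b then U i / u else V i / v) p (u + v).
  rewrite !big_cons !big_nil !addr0 => /(_ _ _ (lexx _)) H.
  have {}H := H (fun b _ => if b as b0 return (0 <= if b0 then u else v) then ltW u0 else ltW v0).
  have {}H := H (fun b _ => if b as b0 return (0 <= if b0 then U i / u else V i / v)
     then divr_ge0 (U0 i) (ltW u0) else divr_ge0 (V0 i) (ltW v0)).
  rewrite ![_ * (_ / _)]mulrC !divfK ?gt_eqF // in H.
  apply: (le_trans (ler_wpM2l (w0 i) H)).
  rewrite mulrCA ler_wpM2l ?exprn_ge0 ?(ltW uv0) //.
  rewrite !expr_div_n mulrDr lerD // le_eqVlt; apply/predU1P; left; ring.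
rewrite -mulr_sumr [leRHS]exprSr ler_wpM2l ?exprn_ge0 ?(ltW uv0) //.
rewrite big_split /= -!mulr_suml -!mulr_sumr.
apply: lerD; rewrite ler_pdivrMr ?exprn_gt0 // ler_wpM2l // ltW //.
Qed.

(** With E k and O k the half-sum and half-difference of (X + Y)^(2k) and (X - Y)^(2k), a linear
    recursion links the pair, so E k <= T^k must be carried along with T O k <= 2k XY T^k. The cross
    term costs 4k Y^2, which the 4p Y^2 built into T absorbs while k <= p. *)
Lemma two_point p (X Y : R) :
  ((X + Y) ^+ (2 * p) + (X - Y) ^+ (2 * p)) / 2 <= (X ^+ 2 + (1 + 4 * p%:R) * Y ^+ 2) ^+ p.
Proof.
wlog : X Y / 0 <= X /\ 0 <= Y.
  have even (Z : R) : (- Z) ^+ (2 * p) = Z ^+ (2 * p) by rewrite !exprM sqrrN.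
  have e1 : - X + Y = - (X - Y) by rewrite opprB addrC.
  have e2 : - X - Y = - (X + Y) by rewrite opprD.
  move=> W; have [X0|/ltW X0] := leP 0 X; have [Y0|/ltW Y0] := leP 0 Y.
  - exact: W.
  - by have := W X (- Y); rewrite sqrrN opprK [_ + (X + Y) ^+ _]addrC; apply; lra.
  - have := W (- X) Y; rewrite sqrrN e1 e2.
    by rewrite !even addrC; apply; lra.
  - have := W (- X) (- Y); rewrite !sqrrN opprK e1 e2.
    by rewrite !even; apply; lra.
move=> [X0 Y0].
pose C := 1 + 4 * p%:R : R; rewrite -/C; pose T := X ^+ 2 + C * Y ^+ 2.
have C0 : 0 <= C by rewrite /C; ge0.
have T0 : 0 <= T by rewrite /T; ge0.
pose E k := ((X + Y) ^+ (2 * k) + (X - Y) ^+ (2 * k)) / 2.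
pose O k := ((X + Y) ^+ (2 * k) - (X - Y) ^+ (2 * k)) / 2.
rewrite -/(E p) -/T.
have ES k : E k.+1 = (X ^+ 2 + Y ^+ 2) * E k + 2 * (X * Y) * O k.
  by rewrite /E /O mulnS !exprD; field.
have OS k : O k.+1 = (X ^+ 2 + Y ^+ 2) * O k + 2 * (X * Y) * E k.
  by rewrite /E /O mulnS !exprD; field.
have XY0 : 0 <= X * Y by rewrite mulr_ge0.
suff K k : (k <= p)%N -> E k <= T ^+ k /\ T * O k <= 2 * k%:R * (X * Y) * T ^+ k.
  by case: (K p).
have sT : X ^+ 2 + Y ^+ 2 <= T.
  rewrite /T lerD2l ler_peMl ?sqr_ge0 // /C lerDl; ge0.
elim: k => [|k IH] kp.
  by rewrite /E /O muln0 !expr0 subrr mul0r !mulr0 !mul0r; split => //; lra.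
have [HE HO] := IH (ltnW kp).
have k0 : 0 <= k%:R :> R by rewrite ler0n.
have kp1 : k%:R + 1 <= p%:R :> R by rewrite natr1 ler_nat.
have Tk : 0 <= T ^+ k by rewrite exprn_ge0.
have [T_eq0|T_neq0] := eqVneq T 0.
  have : X ^+ 2 + Y ^+ 2 <= 0 by rewrite -T_eq0.
  move=> s0.
  have X2 : X ^+ 2 = 0 by have := sqr_ge0 X; have := sqr_ge0 Y; lra.
  have Y2 : Y ^+ 2 = 0 by have := sqr_ge0 X; have := sqr_ge0 Y; lra.
  move/eqP: X2; rewrite sqrf_eq0 => /eqP X_0.
  by rewrite ES T_eq0 X_0 Y2 !expr0n /= ?mulr0n add0r !(mul0r, mulr0) addr0.
have Tp : 0 < T by rewrite lt_neqAle eq_sym T_neq0.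
have X2T : X ^+ 2 <= T by rewrite /T lerDl; ge0.
split.
  rewrite -(ler_pM2l Tp) ES mulrDr [T ^+ k.+1]exprS.
  have h1 : T * ((X ^+ 2 + Y ^+ 2) * E k) <= T * ((X ^+ 2 + Y ^+ 2) * T ^+ k).
    by rewrite ler_pM2l // ler_wpM2l // addr_ge0 ?sqr_ge0.
  have h2 : 2 * (X * Y) * (T * O k) <= 2 * (X * Y) * (2 * k%:R * (X * Y) * T ^+ k).
    by rewrite ler_wpM2l // mulr_ge0.
  apply: (@le_trans _ _ (T * ((X ^+ 2 + Y ^+ 2) * T ^+ k) + 4 * k%:R * Y ^+ 2 * T * T ^+ k)).
    rewrite [T * (2 * (X * Y) * O k)]mulrCA lerD //; apply: le_trans h2 _.
    have -> : 2 * (X * Y) * (2 * k%:R * (X * Y) * T ^+ k) = 4 * k%:R * Y ^+ 2 * X ^+ 2 * T ^+ k by ring.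
    by rewrite ler_wpM2r // ler_wpM2l //; ge0.
  rewrite -subr_ge0.
  have -> : T * (T * T ^+ k) - (T * ((X ^+ 2 + Y ^+ 2) * T ^+ k) + 4 * k%:R * Y ^+ 2 * T * T ^+ k)
     = 4 * (p%:R - k%:R) * Y ^+ 2 * T * T ^+ k by rewrite {2}/T /C; ring.
  have pk : 0 <= p%:R - k%:R :> R by lra.
  by ge0.
rewrite OS mulrDr [T ^+ k.+1]exprS.
have h1 : (X ^+ 2 + Y ^+ 2) * (T * O k) <= (X ^+ 2 + Y ^+ 2) * (2 * k%:R * (X * Y) * T ^+ k).
  by rewrite ler_wpM2l // addr_ge0 ?sqr_ge0.
have h2 : (X ^+ 2 + Y ^+ 2) * (2 * k%:R * (X * Y) * T ^+ k) <= T * (2 * k%:R * (X * Y) * T ^+ k).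
  by rewrite ler_wpM2r // !mulr_ge0.
have h3 : T * (2 * (X * Y) * E k) <= T * (2 * (X * Y) * T ^+ k).
  by rewrite ler_pM2l // ler_wpM2l // mulr_ge0.
rewrite [T * ((X ^+ 2 + Y ^+ 2) * O k)]mulrCA; apply: (le_trans (lerD (le_trans h1 h2) h3)).
by rewrite le_eqVlt; apply/predU1P; left; rewrite -natr1; ring.
Qed.

Lemma sum_double (g : nat -> R) n :
  \sum_(j < n.*2) g j = \sum_(j < n) (g j.*2 + g j.*2.+1).
Proof.
elim: n => [|n IH]; first by rewrite !big_ord0.
by rewrite doubleS !big_ord_recr /= IH addrA.
Qed.

Lemma sum_pow2S (g : nat -> R) M :
  \sum_(j < 2 ^ M.+1) g j = \sum_(j < 2 ^ M) (g j.*2 + g j.*2.+1).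
Proof. by rewrite expnS mul2n sum_double. Qed.

(* [a] plays the role of the dyadic averages of a function, [D] of their half-cell
   differences and [del] of the increments of [D]; [eps k] bounds the square of the
   normalised l_{2p}-norm of [del k]. *)
Lemma dyadic_growth p (a D del : nat -> nat -> R) (eps : nat -> R) :
  (forall k j, a k.+1 j.*2 = a k j - D k j / 2) ->
  (forall k j, a k.+1 j.*2.+1 = a k j + D k j / 2) ->
  (forall k j, D k.+1 j = D k j./2 / 2 + del k.+1 j) ->
  (forall j, D 0%N j = del 0%N j) -> a 0%N 0%N = 0 ->
  (forall k, 0 <= eps k) ->
  (forall k, \sum_(j < 2 ^ k) (2 ^ k)%:R^-1 * (del k j ^+ 2) ^+ p.+1 <= eps k ^+ p.+1) ->
  forall M, \sum_(j < 2 ^ M) (2 ^ M)%:R^-1 * (a M j ^+ 2) ^+ p.+1 <=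
    ((1 + 4 * p.+1%:R) * \sum_(i < M.+1) eps i) ^+ p.+1.
Proof.
move=> aE aO DS D0 a0 eps0 Heps M.
pose C : R := 1 + 4 * p.+1%:R.
have C0 : 0 < C by rewrite /C ltr_pwDl //; ge0.
have w0 k : 0 <= (2 ^ k)%:R^-1 :> R by rewrite invr_ge0 ler0n.
have wS k : (2 ^ k.+1)%:R^-1 = (2 ^ k)%:R^-1 / 2 :> R.
  by rewrite expnS natrM invfM mulrC.
(* U and V bound the squared norms of a and D at level M. By [two_point] and (D / 2 + del)^2 <= D^2
   / 2 + 2 del^2, one level replaces (U, V) by (U + C V / 4, V / 2 + 2 eps), so the potential U + C
   V / 2 grows by exactly C eps. *)
suff [U [V [U0 V0 HU HV HUV]]] : exists U V : R, [/\ 0 <= U, 0 <= V,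
    \sum_(j < 2 ^ M) (2 ^ M)%:R^-1 * (a M j ^+ 2) ^+ p.+1 <= U ^+ p.+1,
    \sum_(j < 2 ^ M) (2 ^ M)%:R^-1 * (D M j ^+ 2) ^+ p.+1 <= V ^+ p.+1 &
    U + C / 2 * V <= C * \sum_(i < M.+1) eps i].
  apply: (le_trans HU); rewrite lerXn2r ?nnegrE //.
    by rewrite mulr_ge0 ?(ltW C0) ?sumr_ge0.
  by apply: le_trans HUV; rewrite lerDl mulr_ge0 // divr_ge0 // ltW.
elim: M => [|M [U [V [U0 V0 HU HV HUV]]]].
  exists 0, (eps 0%N); split => //.
  - by rewrite expn0 big_ord1 a0 expr0n /= !expr0n mulr0.
  - by have := Heps 0%N; rewrite expn0 !big_ord1 D0.
  - rewrite big_ord1 add0r; have := eps0 0%N => e0.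
    by rewrite ler_wpM2r // ler_pdivrMr // ler_peMr ?(ltW C0) //; lra.
exists (U + C / 4 * V), (V / 2 + 2 * eps M.+1); split.
- by rewrite addr_ge0 // mulr_ge0 // divr_ge0 // ltW.
- by rewrite addr_ge0 ?divr_ge0 // mulr_ge0.
- rewrite (sum_pow2S (fun j => (2 ^ M.+1)%:R^-1 * (a M.+1 j ^+ 2) ^+ p.+1)).
  apply: (@le_trans _ _ (\sum_(j < 2 ^ M) (2 ^ M)%:R^-1 *
      (a M j ^+ 2 + C / 4 * D M j ^+ 2) ^+ p.+1)).
    apply: ler_sum => j _; rewrite aE aO wS -mulrDr -[leLHS]mulrA ler_wpM2l //.
    have := two_point p.+1 (a M j) (D M j / 2).
    rewrite -/C !exprM addrC [X in X <= _]mulrC [(a M j + _) ^+ 2 ^+ _ + _]addrC.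
    by have -> : C / 4 * D M j ^+ 2 = C * (D M j / 2) ^+ 2 by field.
  apply: minkowski_sum => //.
  + by move=> i; exact: sqr_ge0.
  + by move=> i; rewrite mulr_ge0 ?sqr_ge0 // divr_ge0 // ltW.
  + by rewrite mulr_ge0 // divr_ge0 // ltW.
  + under eq_bigr do rewrite exprMn mulrCA.
    by rewrite -mulr_sumr [leRHS]exprMn ler_wpM2l //; ge0.
- apply: (@le_trans _ _ (\sum_(j < 2 ^ M.+1) (2 ^ M.+1)%:R^-1 *
      (D M j./2 ^+ 2 / 2 + 2 * del M.+1 j ^+ 2) ^+ p.+1)).
    apply: ler_sum => j _; rewrite ler_wpM2l // DS lerXn2r ?nnegrE ?sqr_ge0 //.
      by ge0.
    have := sqr_ge0 (D M j./2 / 2 - del M.+1 j); rewrite !expr2; lra.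
  apply: minkowski_sum => //.
  + by move=> i; rewrite divr_ge0 ?sqr_ge0.
  + by move=> i; rewrite mulr_ge0 ?sqr_ge0.
  + by rewrite divr_ge0.
  + by rewrite mulr_ge0.
  + rewrite (sum_pow2S (fun j => (2 ^ M.+1)%:R^-1 * (D M j./2 ^+ 2 / 2) ^+ p.+1)).
    apply: (@le_trans _ _ (2^-1 ^+ p.+1 * \sum_(j < 2 ^ M) (2 ^ M)%:R^-1 * (D M j ^+ 2) ^+ p.+1)).
      rewrite mulr_sumr; apply: ler_sum => j _.
      rewrite -[_.*2.+1]/(true + (nat_of_ord j).*2)%N half_bit_double doubleK wS.
      rewrite [(D M j ^+ 2 / 2) ^+ p.+1]exprMn; set x := 2^-1 ^+ p.+1; set y := _ ^+ p.+1; set z := _%:R^-1.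
      by rewrite le_eqVlt; apply/predU1P; left; field.
    by rewrite mulrC [leRHS]exprMn ler_wpM2r // exprn_ge0 // invr_ge0.
  + under eq_bigr do rewrite exprMn mulrCA.
    by rewrite -mulr_sumr [leRHS]exprMn ler_wpM2l // exprn_ge0.
- rewrite big_ord_recr /= [leRHS]mulrDr.
  have -> : U + C / 4 * V + C / 2 * (V / 2 + 2 * eps M.+1) =
    U + C / 2 * V + C * eps M.+1 by field.
  by rewrite lerD2r.
Qed.

End Powers.

(** * Walsh characters and low-rank approximation of the identity *)

Section Walsh.
Variables (R : realFieldType) (i : nat).
Local Notation B := {ffun 'I_i -> bool}.
Implicit Types (s x y z : B).

Definition walsh s x : R := \prod_(k < i) (-1) ^+ (s k && x k).
Definition xorf x y : B := [ffun k => x k (+) y k].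
Definition zerof : B := [ffun => false].

Lemma walsh_xor s x y : walsh s (xorf x y) = walsh s x * walsh s y.
Proof.
rewrite /walsh -big_split /=; apply: eq_bigr => k _; rewrite ffunE.
by case: (s k) (x k) (y k) => [] [] []; rewrite !(expr0, expr1, mulr1, mul1r, mulrNN).
Qed.

Lemma walsh0 s : walsh s zerof = 1.
Proof. by rewrite /walsh big1 // => k _; rewrite ffunE andbF expr0. Qed.

Lemma walsh_sqr s x : walsh s x ^+ 2 = 1.
Proof.
rewrite expr2 /walsh -big_split big1 //= => k _.
by case: (_ && _); rewrite ?mulr1 // expr1 mulrNN mulr1.
Qed.

Lemma xorfK y : cancel (xorf^~ y) (xorf^~ y).
Proof. by move=> x; apply/ffunP => k; rewrite !ffunE -addbA addbb addbF. Qed.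

Lemma exists_le_mean (I : finType) (f : I -> R) (m : R) (i0 : I) :
  \sum_j f j <= #|I|%:R * m -> exists j, f j <= m.
Proof.
move=> H; case: (pickP (fun j => f j <= m)) => [j Hj|H']; first by exists j.
have : \sum_(j : I) m < \sum_j f j.
  apply: ltr_sum => [|j _]; first by apply/hasP; exists i0; rewrite ?mem_index_enum.
  by rewrite ltNge H'.
by rewrite sumr_const -mulr_natl ltNge H.
Qed.

(** Off the origin the sign [walsh s z] is balanced over s: flipping a coordinate k of s where z k
    is true reverses it. Pairing s with its flip produces the two-point mean. *)
Lemma sum_even_walsh z (X : R) p : z != zerof ->
  \sum_s ((X + walsh s z) ^+ 2) ^+ p =
  #|{: B}|%:R * (((X + 1) ^+ (2 * p) + (X - 1) ^+ (2 * p)) / 2).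
Proof.
move=> zN0; have [k zk] : exists k, z k.
  case: (pickP z) => [k zk|H]; first by exists k.
  by move/eqP: zN0; case; apply/ffunP => k; rewrite ffunE; exact: H.
pose e : B := [ffun l => l == k].
have walshe s : walsh (xorf s e) z = - walsh s z.
  rewrite /walsh (bigD1 k) //= [in RHS](bigD1 k) //= !ffunE eqxx zk !andbT -mulNr.
  congr (_ * _); first by case: (s k); rewrite /= ?expr0 ?expr1 ?opprK.
  by apply: eq_bigr => l lk; rewrite !ffunE (negbTE lk) addbF.
pose F s := ((X + walsh s z) ^+ 2) ^+ p.
have : \sum_s F s = \sum_s F (xorf s e).
  by rewrite (reindex_inj (can_inj (xorfK e))).
set S := \sum_s F s => HS.
suff : S + S = #|{: B}|%:R * ((X + 1) ^+ (2 * p) + (X - 1) ^+ (2 * p)).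
  by rewrite -/F /=; rewrite -/S; lra.
rewrite {2}HS -big_split /=.
transitivity (\sum_(s : B) ((X + 1) ^+ (2 * p) + (X - 1) ^+ (2 * p))).
  apply: eq_bigr => s _; rewrite /F walshe !exprM.
  have /eqP := walsh_sqr s z; rewrite sqrf_eq1 => /orP[] /eqP -> //.
  by rewrite opprK addrC.
by rewrite sumr_const mulr_natl.
Qed.

(* Derandomised choice of characters: averaging over the next character and [two_point]
   keep the normalised 2p-norm of the partial sums, off the origin, of order sqrt n. *)
Lemma walsh_greedy p n : exists t : 'I_n -> B,
  \sum_(z | z != zerof) #|{: B}|%:R^-1 * ((\sum_k walsh (t k) z) ^+ 2) ^+ p.+1
    <= (n%:R * (1 + 4 * p.+1%:R)) ^+ p.+1.
Proof.
pose C : R := 1 + 4 * p.+1%:R; rewrite -/C.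
have C0 : 0 <= C by rewrite /C; ge0.
have cB : 0 < #|{: B}|%:R :> R by rewrite ltr0n; apply/card_gt0P; exists zerof.
pose w : R := #|{: B}|%:R^-1.
have w0 : 0 <= w by rewrite invr_ge0 ltW.
elim: n => [|n [t IH]].
  exists (fun _ => zerof); rewrite mul0r expr0n /=.
  by rewrite big1 // => z _; rewrite big_ord0 !expr0n mulr0.
pose X z := \sum_k walsh (t k) z.
pose f s := \sum_(z | z != zerof) w * ((X z + walsh s z) ^+ 2) ^+ p.+1.
have [s Hs] : exists s, f s <= ((n.+1)%:R * C) ^+ p.+1.
  apply: (exists_le_mean zerof); rewrite /f exchange_big /=.
  rewrite -natr1 mulrDl mul1r.
  (* A zero weight at the origin lets [minkowski_sum], which sums over the whole type, handle the
     restricted sum. *)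
  pose w' z : R := if z != zerof then w else 0.
  have w'0 z : 0 <= w' z by rewrite /w'; case: ifP.
  have M : \sum_z w' z * (X z ^+ 2 + C) ^+ p.+1 <= (n%:R * C + C) ^+ p.+1.
    apply: minkowski_sum => //.
    - by move=> z; exact: sqr_ge0.
    - by rewrite mulr_ge0.
    - apply: le_trans IH; rewrite [leRHS]big_mkcond le_eqVlt; apply/predU1P; left.
      by apply: eq_bigr => z _; rewrite /w'; case: ifP; rewrite ?mul0r.
    - rewrite -mulr_suml ler_piMl ?exprn_ge0 //.
      apply: (@le_trans _ _ (\sum_(z : B) w)).
        by apply: ler_sum => z _; rewrite /w'; case: ifP.
      by rewrite sumr_const -mulr_natl divff ?gt_eqF.
  apply: le_trans (ler_wpM2l (ltW cB) M).
  rewrite mulr_sumr [leLHS]big_mkcond; apply: ler_sum => z _.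
  rewrite /w'; case: ifPn => zN0; last by rewrite mul0r mulr0.
  rewrite -mulr_sumr [leRHS]mulrCA ler_wpM2l //.
  rewrite sum_even_walsh // ler_pM2l //.
  by have := two_point p.+1 (X z) 1; rewrite expr1n mulr1.
exists (fun k => if unlift ord0 k is Some k' then t k' else s).
apply: le_trans Hs; rewrite le_eqVlt; apply/predU1P; left.
apply: eq_bigr => z _; rewrite big_ord_recl unlift_none addrC; congr (_ * (_ ^+ 2) ^+ _).
by congr (_ + _); apply: eq_bigr => k _; rewrite liftK.
Qed.

End Walsh.

(* For n = 0 the junk value 0^-1 = 0 makes the second bound fail, whence the max. *)
Lemma low_rank_identity (R : realFieldType) (i p n : nat) :
  exists (g h : 'I_n -> 'I_(2 ^ i) -> R), forall y,
    \sum_(x < 2 ^ i) (2 ^ i)%:R^-1 * (((x == y)%:R - \sum_t g t x * h t y) ^+ 2) ^+ p.+1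
      <= ((1 + 4 * p.+1%:R) / (maxn 1 n)%:R) ^+ p.+1.
Proof.
case: n => [|n].
  exists (fun _ _ => 0), (fun _ _ => 0) => y.
  under eq_bigr do rewrite big_ord0 subr0.
  rewrite (bigD1 y) //= [X in _ + X]big1 => [|x xy]; last first.
    by rewrite (negbTE xy) !expr0n mulr0.
  rewrite eqxx !expr1n mulr1 addr0 divr1.
  apply: (@le_trans _ _ 1).
    by rewrite invf_le1 ?ltr0n ?expn_gt0 // ler1n expn_gt0.
  by rewrite exprn_ege1 // lerDl; ge0.
pose B := {ffun 'I_i -> bool}.
have cB : #|{: B}| = (2 ^ i)%N by rewrite card_ffun card_bool card_ord.
pose e (x : 'I_(2 ^ i)) : B := enum_val (cast_ord (esym cB) x).
pose e' (b : B) : 'I_(2 ^ i) := cast_ord cB (enum_rank b).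
have ee' : cancel e' e by move=> b; rewrite /e /e' cast_ordK enum_rankK.
have e'e : cancel e e' by move=> b; rewrite /e /e' enum_valK cast_ordKV.
have [t Ht] := walsh_greedy R i p n.+1.
have n0 : 0 < n.+1%:R :> R by rewrite ltr0n.
(* The kernel is the mean of n.+1 characters evaluated at x xor y. It equals 1 on the diagonal and
   cancels the identity there; off the diagonal it is the sum that [walsh_greedy] controls. *)
exists (fun k x => n.+1%:R^-1 * walsh R (t k) (e x)), (fun k y => walsh R (t k) (e y)) => y.
rewrite (maxn_idPr _) //.
rewrite (reindex e') /=; last by exists e => ? _.
rewrite (reindex_inj (can_inj (@xorfK i (e y)))) /=.
rewrite (bigD1 (zerof i)) //= [X in X + _](_ : _ = 0) ?add0r; last first.
  have -> : e' (xorf (zerof i) (e y)) == y.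
    rewrite (_ : xorf _ _ = e y) ?e'e //.
    by apply/ffunP => k; rewrite !ffunE.
  under eq_bigr do rewrite ee' walsh_xor walsh0 mul1r -mulrA -expr2 walsh_sqr mulr1.
  by rewrite sumr_const card_ord -[_^-1 *+ _]mulr_natl divff ?gt_eqF // subrr expr0n expr0n mulr0.
rewrite cB in Ht.
have nn0 : 0 <= n.+1%:R^-2 :> R by rewrite invr_ge0 exprn_ge0.
have -> : ((1 + 4 * p.+1%:R) / n.+1%:R) ^+ p.+1 =
    (n.+1%:R ^- 2) ^+ p.+1 * (n.+1%:R * (1 + 4 * p.+1%:R)) ^+ p.+1 :> R.
  rewrite -[RHS]exprMn; congr (_ ^+ _); move: n0.
  by move: (n.+1%:R) => N N0; field; rewrite gt_eqF.
apply: le_trans (ler_wpM2l (exprn_ge0 _ nn0) Ht).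
rewrite mulr_sumr; apply: ler_sum => z zN0; rewrite le_eqVlt; apply/predU1P; left.
have -> : (e' (xorf z (e y)) == y) = false.
  apply/negbTE; apply: contra zN0 => /eqP /(congr1 e); rewrite ee' => H.
  apply/eqP/ffunP => k; move/ffunP: H => /(_ k); rewrite !ffunE.
  by case: (z k) (e y k) => [] [].
under eq_bigr do rewrite ee' walsh_xor -!mulrA -expr2 walsh_sqr mulr1.
rewrite -mulr_sumr sub0r sqrrN [(_ * \sum_k _) ^+ 2]exprMn exprVn [(_ * _) ^+ p.+1]exprMn.
exact: mulrCA.
Qed.

(** * Trace, rank and Hilbert-Schmidt norm *)

Section Trace.
Variable R : realFieldType.

Lemma sum_cauchy_schwarz (I : finType) (f g : I -> R) :
  (\sum_i f i * g i) ^+ 2 <= (\sum_i f i ^+ 2) * (\sum_i g i ^+ 2).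
Proof.
set a := \sum_i f i ^+ 2; set b := \sum_i f i * g i; set c := \sum_i g i ^+ 2.
have quad t s : 0 <= t ^+ 2 * a + 2 * t * s * b + s ^+ 2 * c.
  rewrite /a /b /c !mulr_sumr -!big_split /=; apply: sumr_ge0 => i _.
  have -> : t ^+ 2 * f i ^+ 2 + 2 * t * s * (f i * g i) + s ^+ 2 * g i ^+ 2
    = (t * f i + s * g i) ^+ 2 by ring.
  exact: sqr_ge0.
have a0 : 0 <= a by apply: sumr_ge0 => i _; exact: sqr_ge0.
have c0 : 0 <= c by apply: sumr_ge0 => i _; exact: sqr_ge0.
have [a_eq0|a_neq0] := eqVneq a 0.
  have : b == 0.
    rewrite /b big1 // => i _.
    have : f i ^+ 2 == 0.
      by move/eqP: a_eq0; rewrite psumr_eq0 => [/allP/(_ i)|j _]; [apply; rewrite mem_index_enum|exact: sqr_ge0].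
    by rewrite sqrf_eq0 => /eqP ->; rewrite mul0r.
  by move/eqP ->; rewrite expr0n mulr_ge0.
have ap : 0 < a by rewrite lt_neqAle eq_sym a_neq0.
have := quad (- b) a.
have -> : (- b) ^+ 2 * a + 2 * - b * a * b + a ^+ 2 * c = a * (a * c - b ^+ 2) by ring.
by rewrite pmulr_rge0 // subr_ge0.
Qed.

Lemma mxtrace_mul_le m n (A : 'M[R]_(m, n)) (B : 'M[R]_(n, m)) :
  \tr (A *m B) ^+ 2 <= (\sum_i \sum_j A i j ^+ 2) * (\sum_i \sum_j B i j ^+ 2).
Proof.
rewrite /mxtrace; under eq_bigr do rewrite mxE.
rewrite [\sum_(i < n) _]exchange_big /= !pair_big /=.
exact: (sum_cauchy_schwarz (fun u : 'I_m * 'I_n => A u.1 u.2)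
   (fun u : 'I_m * 'I_n => B u.2 u.1)).
Qed.

Lemma row_sqr_eq0 m (v : 'rV[R]_m) : v *m v^T = 0 -> v = 0.
Proof.
move=> /matrixP/(_ 0 0); rewrite !mxE => /eqP.
rewrite psumr_eq0 => [/allP H|j _]; last by rewrite mxE -expr2 sqr_ge0.
apply/rowP => j; rewrite mxE; have := H j (mem_index_enum _).
by rewrite mxE mulf_eq0 orbb => /eqP.
Qed.

Lemma gram_unitmx r m (Q : 'M[R]_(r, m)) : row_free Q -> Q *m Q^T \in unitmx.
Proof.
move=> Qfree; rewrite -row_free_unit; apply/inj_row_free => v Hv.
have : v *m Q = 0.
  by apply: row_sqr_eq0; rewrite trmx_mul mulmxA -(mulmxA v) Hv mul0mx.
by move/eqP; rewrite -(mul0mx _ Q) => /eqP /(row_free_inj Qfree).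
Qed.

(* The trace is unchanged by composing with the orthogonal projection onto the row
   space, whose squared Hilbert-Schmidt norm is the rank. *)
Lemma mxtrace_sqr_le m (Y : 'M[R]_m) :
  \tr Y ^+ 2 <= (\rank Y)%:R * \sum_i \sum_j Y i j ^+ 2.
Proof.
have [Q [Qfree YQ]] : exists Q : 'M[R]_(\rank Y, m), row_free Q /\ (Y <= Q)%MS.
  by exists (row_base Y); split; [exact: row_base_free | rewrite eq_row_base].
pose G := Q *m Q^T; have GU : G \in unitmx by exact: gram_unitmx.
pose P := Q^T *m invmx G *m Q.
have GT : G^T = G by rewrite /G trmx_mul trmxK.
have PT : P^T = P by rewrite /P trmx_mul (trmx_mul Q^T) trmxK trmx_inv GT mulmxA.
have PP : P *m P = P.
  rewrite /P -!mulmxA; congr (_ *m _); rewrite !mulmxA; congr (_ *m _).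
  by rewrite -(mulmxA (invmx G)) -/G mulVmx // mul1mx.
have YP : Y *m P = Y.
  have /submxP[D YE] := YQ.
  rewrite {1}YE /P !mulmxA -(mulmxA D) -/G -(mulmxA D) mulmxV // mulmx1.
  by rewrite -YE.
have trP : \sum_i \sum_j P i j ^+ 2 = (\rank Y)%:R.
  transitivity (\tr (P *m P^T)).
    apply: eq_bigr => i _; rewrite [RHS]mxE; apply: eq_bigr => j _.
    by rewrite [P^T j i]mxE expr2.
  rewrite PT PP /P -mulmxA mxtrace_mulC -mulmxA -/G mulVmx // mxtrace1 //.
by rewrite -{1}YP mulrC -trP mxtrace_mul_le.
Qed.

(** The matrix factors through R^n, so its rank is at most n and [mxtrace_sqr_le] applies. Later x
    numbers the approximants and y the functionals. *)
Lemma low_rank_trace (I : finType) n (c : I -> 'I_n -> R) (g : 'I_n -> I -> R) :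
  (\sum_x \sum_i c x i * g i x) ^+ 2 <=
  n%:R * \sum_x \sum_y (\sum_i c x i * g i y) ^+ 2.
Proof.
pose Y : 'M[R]_#|I| := (\matrix_(x, i) c (enum_val x) i) *m (\matrix_(i, y) g i (enum_val y)).
have YE x y : Y x y = \sum_i c (enum_val x) i * g i (enum_val y).
  by rewrite mxE; apply: eq_bigr => i _; rewrite !mxE.
have tE : \sum_x \sum_i c x i * g i x = \tr Y.
  rewrite /mxtrace (reindex (@enum_val I I)) /=; last exact: onW_bij (enum_val_bij _).
  by apply: eq_bigr => x _; rewrite YE.
have sE : \sum_x \sum_y (\sum_i c x i * g i y) ^+ 2 = \sum_x \sum_y Y x y ^+ 2.
  rewrite (reindex (@enum_val I I)) /=; last exact: onW_bij (enum_val_bij _).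
  apply: eq_bigr => x _.
  rewrite (reindex (@enum_val I I)) /=; last exact: onW_bij (enum_val_bij _).
  by apply: eq_bigr => y _; rewrite YE.
rewrite tE sE; apply: le_trans (mxtrace_sqr_le Y) _.
rewrite ler_wpM2r ?ler_nat; last exact: leq_trans (mulmx_max_rank _ _) (leqnn _).
  by [].
by apply: sumr_ge0 => x _; apply: sumr_ge0 => y _; exact: sqr_ge0.
Qed.

End Trace.

(* Bessel's inequality for the Haar coefficients [D k j / 2] of the dyadic martingale [a]. *)
Lemma haar_bessel (R : realFieldType) (a D : nat -> nat -> R) :
  (forall k j, a k.+1 j.*2 = a k j - D k j / 2) ->
  (forall k j, a k.+1 j.*2.+1 = a k j + D k j / 2) ->
  forall M, \sum_(k < M) \sum_(j < 2 ^ k) (2 ^ k)%:R^-1 * (D k j / 2) ^+ 2 <=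
    \sum_(j < 2 ^ M) (2 ^ M)%:R^-1 * a M j ^+ 2.
Proof.
move=> aE aO M.
suff -> : \sum_(j < 2 ^ M) (2 ^ M)%:R^-1 * a M j ^+ 2 = a 0%N 0%N ^+ 2 +
   \sum_(k < M) \sum_(j < 2 ^ k) (2 ^ k)%:R^-1 * (D k j / 2) ^+ 2.
  by rewrite lerDr sqr_ge0.
elim: M => [|M IH]; first by rewrite expn0 big_ord1 big_ord0 invr1 mul1r addr0.
rewrite big_ord_recr /= addrA -IH -big_split /=.
rewrite (sum_pow2S (fun j => (2 ^ M.+1)%:R^-1 * a M.+1 j ^+ 2)).
apply: eq_bigr => j _; rewrite aE aO expnS natrM.
have : (2 ^ M)%:R != 0 :> R by rewrite pnatr_eq0 expn_eq0.
by move: (_%:R) => z z0; field.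
Qed.

(* No measurability is needed: the integral of a nonnegative function is a supremum over
   the simple functions below it. *)
Lemma ge0_integral_mono d (T : measurableType d) (R : realType)
    (mu : {measure set T -> \bar R}) (D : set T) (f g : T -> \bar R) :
  (forall x, D x -> (0 <= f x)%E) -> (forall x, D x -> (f x <= g x)%E) ->
  (\int[mu]_(x in D) f x <= \int[mu]_(x in D) g x)%E.
Proof.
move=> f0 fg; have g0 x : D x -> (0 <= g x)%E by move=> Dx; exact: le_trans (f0 x Dx) (fg x Dx).
rewrite !ge0_integralE //; apply: ereal_sup_le => _ [h hf <-].
exists h => // x; apply: le_trans (hf x) _.
rewrite !patchE; case: ifPn => // xD; exact: fg (set_mem xD).
Qed.

Lemma ge0_integral_subset d (T : measurableType d) (R : realType)
    (mu : {measure set T -> \bar R}) (D E : set T) (f : T -> \bar R) :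
  (forall x, E x -> (0 <= f x)%E) -> D `<=` E ->
  (\int[mu]_(x in D) f x <= \int[mu]_(x in E) f x)%E.
Proof.
move=> f0 DE; rewrite integral_mkcond [leRHS]integral_mkcond.
apply: ge0_integral_mono => x _; rewrite !patchE; case: ifPn => // xD.
  by apply: f0; apply: DE; exact: set_mem.
by rewrite (mem_set (DE _ (set_mem xD))).
case: ifPn => // xE; apply: f0; exact: set_mem.
Qed.

(** * Translation invariance of the integral *)

Section Translation.
Variable R : realType.
Notation mu := (@lebesgue_measure R).

Definition translate (h : R) (x : measurableTypeR R) : measurableTypeR R := x + h.

Lemma measurable_translate (h : R) : measurable_fun setT (translate h).
Proof. by apply: measurable_funD. Qed.

Lemma lebesgue_measure_translate (h : R) (A : set R) : measurable A ->
  pushforward mu (translate h) A = mu A.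
Proof.
move=> mA; apply/esym/lebesgue_measure_unique => //; first exact: measurable_translate.
move=> mt _ [[a b] _ <-].
rewrite /= /pushforward (_ : _ @^-1` _ = `]a - h, b - h]%classic); last first.
  by apply/seteqP; split => x /=; rewrite !in_itv /= ltrBlDr lerBrDr.
rewrite !lebesgue_measure_itv /= !lte_fin ltrD2r.
by case: ifP => // _; rewrite -!EFinD; congr EFin; ring.
Qed.

Lemma ge0_integral_translate (f : R -> \bar R) (h : R) (D : set R) :
  measurable D -> measurable_fun setT f -> (forall x, (0 <= f x)%E) ->
  (\int[mu]_(x in D) f x = \int[mu]_(x in translate h @^-1` D) f (x + h)%R)%E.
Proof.
move=> mD mf f0; rewrite -[RHS](ge0_integral_pushforward (measurable_translate h)) //.
  apply: eq_measure_integral; first exact: measurable_translate.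
  by move=> mt B mB _; apply/esym; exact: lebesgue_measure_translate.
exact: measurable_funS mf.
Qed.

Lemma integrable_translate (g : R -> R) (h : R) :
  mu.-integrable setT (EFin \o g) -> mu.-integrable setT (EFin \o (fun x => g (x + h))).
Proof.
move=> /integrableP[mg gfin]; apply/integrableP; split.
  move=> _ Y mY; have := mg measurableT Y mY; rewrite !setTI.
  by move=> /(measurable_translate h measurableT); rewrite setTI.
apply: le_lt_trans gfin; rewrite [leRHS](@ge0_integral_translate _ h) //.
exact: measurableT_comp.
Qed.

Lemma Rintegral_translate (g : R -> R) (h : R) (D : set R) : measurable D ->
  mu.-integrable setT (EFin \o g) ->
  \int[mu]_(x in D) g x = \int[mu]_(x in translate h @^-1` D) g (x + h).
Proof.
move=> mD gint; have [mg _] := integrableP _ _ _ gint.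
rewrite /Rintegral; congr fine.
rewrite -[RHS](@integral_pushforward _ _ _ _ _ _ (measurable_translate h) mu D (EFin \o g)) //.
  apply: eq_measure_integral; first exact: measurable_translate.
  by move=> mt B mB _; apply/esym; exact: lebesgue_measure_translate.
apply: integrableS (integrable_translate h gint) => //.
rewrite -[X in measurable X]setTI; exact: measurable_translate.
Qed.

End Translation.

(** * Dyadic cells, averages and the coefficients [del] *)

Section DyadicCells.
Variable R : realType.
Notation mu := (@lebesgue_measure R).
Notation L1 g := (mu.-integrable setT (EFin \o g)).
Implicit Types (f g : R -> R) (k j : nat).

Definition cell k j : set R := `[j%:R / 2 ^+ k, j.+1%:R / 2 ^+ k[.

Lemma pow2_gt0 k : 0 < 2 ^+ k :> R. Proof. by rewrite exprn_gt0. Qed.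
Hint Resolve pow2_gt0 : core.
Lemma pow2_neq0 k : 2 ^+ k != 0 :> R. Proof. by rewrite gt_eqF. Qed.
Hint Resolve pow2_neq0 : core.

Lemma in_cell k j x : cell k j x <-> j%:R <= 2 ^+ k * x < j.+1%:R.
Proof.
rewrite /cell /= in_itv /= ler_pdivrMr // ltr_pdivlMr // [x * _]mulrC; exact: iff_refl.
Qed.

Lemma measurable_cell k j : measurable (cell k j).
Proof. exact: measurable_itv. Qed.
Hint Extern 0 (@measurable _ _ (cell _ _)) => exact: measurable_cell : core.

Lemma mu_cell k j : mu (cell k j) = (2 ^- k)%:E.
Proof.
rewrite lebesgue_measure_itv /= lte_fin ltr_pM2r ?invr_gt0 // ltr_nat ltnSn.
by rewrite -EFinB -mulrBl -natr1 addrAC subrr add0r mul1r.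
Qed.

Lemma cell_uniq k i j x : cell k i x -> cell k j x -> i = j.
Proof.
move=> /in_cell/andP[ix xi] /in_cell/andP[jx xj]; apply/eqP; rewrite eqn_leq.
rewrite -!(ltnS i) -!(ltnS j) -!(ltr_nat R).
by rewrite (le_lt_trans ix xj) (le_lt_trans jx xi).
Qed.

Lemma cell_split k j : cell k j = cell k.+1 j.*2 `|` cell k.+1 j.*2.+1.
Proof.
have E (x : R) : 2 ^+ k.+1 * x = (2 ^+ k * x) + (2 ^+ k * x) by rewrite exprS; ring.
have D : j.*2%:R = j%:R + j%:R :> R by rewrite -addnn natrD.
apply/seteqP; split => x; rewrite /setU /= !in_cell E; move: (2 ^+ k * x) => y; rewrite -!natr1 D.
  move=> /andP[h1 h2]; have [h|h] := ltP y (j%:R + 2^-1).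
    by left; apply/andP; split; lra.
  by right; apply/andP; split; lra.
by move=> [] /andP[h1 h2]; apply/andP; split; lra.
Qed.

Lemma cell_disj k i j : i != j -> [disjoint cell k i & cell k j].
Proof.
move=> ij; rewrite disj_set2E; apply/eqP; apply/seteqP; split => // x [xi xj].
by rewrite (cell_uniq xi xj) eqxx in ij.
Qed.

Definition avg g k j : R := 2 ^+ k * \int[mu]_(x in cell k j) g x.
Definition hdiff g k j : R := avg g k.+1 j.*2.+1 - avg g k.+1 j.*2.
(* Subtracting half of the parent's [hdiff] annihilates affine functions. *)
Definition del g k j : R :=
  if k is k'.+1 then hdiff g k j - hdiff g k' j./2 / 2 else hdiff g 0 j.

Lemma integrable_cell g k j : L1 g -> mu.-integrable (cell k j) (EFin \o g).
Proof. move=> gi; apply: (integrableS measurableT _ _ gi); [exact: measurable_cell|exact: subsetT]. Qed.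

Lemma avg_mean g k j : L1 g -> avg g k j = (avg g k.+1 j.*2 + avg g k.+1 j.*2.+1) / 2.
Proof.
move=> gi; rewrite /avg {1}cell_split Rintegral_setU //.
- by rewrite exprS; field.
- by apply: (integrableS measurableT _ _ gi) => //; exact: measurableU.
- by apply: cell_disj; rewrite neq_ltn ltnSn.
Qed.

Lemma avg_even g k j : L1 g -> avg g k.+1 j.*2 = avg g k j - hdiff g k j / 2.
Proof. by move=> gi; rewrite (avg_mean k j gi) /hdiff; field. Qed.

Lemma avg_odd g k j : L1 g -> avg g k.+1 j.*2.+1 = avg g k j + hdiff g k j / 2.
Proof. by move=> gi; rewrite (avg_mean k j gi) /hdiff; field. Qed.

Lemma avgD f g k j : L1 f -> L1 g -> avg (fun x => f x + g x) k j = avg f k j + avg g k j.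
Proof.
move=> fi gi; rewrite /avg RintegralD //; try exact: integrable_cell.
exact: mulrDr.
Qed.

Lemma avgZ f c k j : L1 f -> avg (fun x => c * f x) k j = c * avg f k j.
Proof.
move=> fi; rewrite /avg RintegralZl //; last exact: integrable_cell.
exact: mulrCA.
Qed.

Lemma avg_cst c k j : avg (fun => c) k j = c.
Proof. by rewrite /avg Rintegral_cst // [X in c * fine X](mu_cell k j) /= mulrCA divff // mulr1. Qed.

Lemma L1D f g : L1 f -> L1 g -> L1 (fun x => f x + g x).
Proof. by move=> fi gi; exact: (integrableD measurableT fi gi). Qed.

Lemma L1Z f c : L1 f -> L1 (fun x => c * f x).
Proof. by move=> fi; exact: (integrableZl measurableT c fi). Qed.

Lemma L1_sum (I : Type) (r : seq I) (P : pred I) (F : I -> R -> R) :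
  (forall i, P i -> L1 (F i)) -> L1 (fun x => \sum_(i <- r | P i) F i x).
Proof.
move=> Fi; rewrite (_ : _ \o _ = fun x => (\sum_(i <- r | P i) (F i x)%:E)%E).
  exact: (integrable_sum measurableT).
by apply/funext => x /=; rewrite sumEFin.
Qed.

Lemma avg_sum (I : Type) (r : seq I) (P : pred I) (F : I -> R -> R) k j :
  (forall i, P i -> L1 (F i)) ->
  avg (fun x => \sum_(i <- r | P i) F i x) k j = \sum_(i <- r | P i) avg (F i) k j.
Proof.
move=> Fi; elim: r => [|i r IH].
  rewrite big_nil -[RHS](avg_cst 0 k j); congr (avg _ k j).
  by apply/funext => x; rewrite big_nil.
rewrite big_cons; case: ifP => Pi.
  rewrite -IH -avgD ?Fi //; last exact: L1_sum.
  by congr (avg _ k j); apply/funext => x; rewrite big_cons Pi.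
by rewrite -IH; congr (avg _ k j); apply/funext => x; rewrite big_cons Pi.
Qed.

Lemma delD f g k j : L1 f -> L1 g -> del (fun x => f x + g x) k j = del f k j + del g k j.
Proof. by move=> fi gi; case: k => [|k]; rewrite /del /hdiff !avgD //; field. Qed.

Lemma delZ f c k j : L1 f -> del (fun x => c * f x) k j = c * del f k j.
Proof. by move=> fi; case: k => [|k]; rewrite /del /hdiff !avgZ //; field. Qed.

Lemma del_sum (I : Type) (r : seq I) (P : pred I) (F : I -> R -> R) k j :
  (forall i, P i -> L1 (F i)) ->
  del (fun x => \sum_(i <- r | P i) F i x) k j = \sum_(i <- r | P i) del (F i) k j.
Proof.
move=> Fi; case: k => [|k]; rewrite /del /hdiff !avg_sum // -!sumrB //.
by rewrite mulr_suml -sumrB.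
Qed.

End DyadicCells.
#[export] Hint Resolve pow2_gt0 pow2_neq0 : core.
#[export] Hint Extern 0 (@measurable _ _ (cell _ _)) => exact: measurable_cell : core.

(** * Control of [del] by second differences *)

Section SecondDifferences.
Variable R : realType.
Notation mu := (@lebesgue_measure R).
Notation L1 g := (mu.-integrable setT (EFin \o g)).
Implicit Types (f g : R -> R) (k j m : nat).

Lemma LpNorm1 (D : set R) f : LpNorm D 1 f = (\int[mu]_(x in D) `|f x|%:E)%E.
Proof.
rewrite /LpNorm invr1 poweRe1; last first.
  by apply: integral_ge0 => x _; rewrite lee_fin powR_ge0.
by apply: eq_integral => x _; rewrite powRr1.
Qed.

Lemma fdiff2 (h : R) f x : fdiff 2 h f x = f x - 2 * f (x + h) + f (x + 2 * h).
Proof.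
rewrite /fdiff !big_ord_recl big_ord0 /= /bump /=.
rewrite !addn0 !addn1 subn0 subnn (_ : (2 - 1)%N = 1%N) // bin0 bin1 binn.
by rewrite expr0 expr1 !mul1r mul0r !addr0; ring.
Qed.

Lemma preimage_cell m j i : translate (i%:R / 2 ^+ m) @^-1` cell m (j + i) = cell m j :> set R.
Proof.
apply/seteqP; split => x; rewrite /preimage /= => /in_cell H; apply/in_cell; move: H.
  rewrite /translate mulrDr [_ * (_ / _)]mulrC divfK // -addSn !natrD.
  by rewrite lerD2r ltrD2r.
rewrite /translate mulrDr [_ * (_ / _)]mulrC divfK // -addSn !natrD.
by rewrite lerD2r ltrD2r.
Qed.

Definition d2avg g m j : R := avg g m j - 2 * avg g m j.+1 + avg g m j.+2.

Lemma L1_fdiff2 (h : R) g : L1 g -> L1 (fdiff 2 h g).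
Proof.
move=> gi; rewrite (_ : fdiff 2 h g = fun x => g x + - 2 * g (x + h) + g (x + 2 * h)).
  by apply: L1D; [apply: L1D => //; apply: L1Z|]; exact: integrable_translate.
by apply/funext => x; rewrite fdiff2 mulNr.
Qed.

(** Translation by 2^-m carries each cell of level m to the next one, so the second difference of
    the averages is the average of the second difference with that step. *)
Lemma d2avgE g m j : L1 g ->
  d2avg g m j = 2 ^+ m * \int[mu]_(x in cell m j) fdiff 2 (2 ^- m) g x.
Proof.
move=> gi.
have T i : L1 (fun x => g (x + i%:R / 2 ^+ m)) by exact: integrable_translate.
have avgT i : avg g m (j + i) = avg (fun x => g (x + i%:R / 2 ^+ m)) m j.
  by rewrite /avg (Rintegral_translate (i%:R / 2 ^+ m) _ gi) // preimage_cell.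
rewrite /d2avg -[j.+2](addn2 j) -[j.+1](addn1 j) !avgT -/(avg _ m j).
rewrite (_ : fdiff 2 (2 ^- m) g = fun x => (g x + - 2 * g (x + 1%:R / 2 ^+ m)) + g (x + 2%:R / 2 ^+ m)).
  by rewrite !avgD ?avgZ ?mulNr //; first exact: L1Z; apply: L1D => //; exact: L1Z.
by apply/funext => x; rewrite fdiff2 mulNr mul1r.
Qed.

Lemma sum_cell_integral_le k n (P : pred nat) (phi : R -> \bar R) (D : set R) :
  measurable_fun setT phi -> (forall x, (0 <= phi x)%E) ->
  (forall j, (j < n)%N -> P j -> cell k j `<=` D) ->
  (\sum_(j < n | P j) \int[mu]_(x in cell k j) phi x <= \int[mu]_(x in D) phi x)%E.
Proof.
move=> mphi phi0 PD.
rewrite -(big_mkord P (fun j => \int[mu]_(x in cell k j) phi x)%E) -big_filter.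
rewrite -ge0_integral_bigsetU //.
- apply: ge0_integral_subset => // x; rewrite -bigcup_seq => -[j /=].
  by rewrite mem_filter mem_index_iota => /andP[Pj /andP[_ jn]]; exact: PD.
- by rewrite filter_uniq // iota_uniq.
- by move=> i j _ _ [x [xi xj]]; exact: cell_uniq xi xj.
- exact: measurable_funTS.
Qed.

Lemma normr_Rintegral_cell g k j : L1 g ->
  (`|\int[mu]_(x in cell k j) g x|%:E <= \int[mu]_(x in cell k j) `|g x|%:E)%E.
Proof.
move=> gi; rewrite EFin_normr_Rintegral //; last exact: integrable_cell.
apply: le_abse_integral => //; exact: (measurable_int mu (integrable_cell _ _ gi)).
Qed.

Lemma L1_measurable_norm g : L1 g -> measurable_fun setT (fun x => `|g x|%:E).
Proof.
move=> /integrableP[mg _]; exact: (measurableT_comp (@abse_measurable R setT) mg).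
Qed.

(** The restriction j.+2 < 2 ^ m keeps the three consecutive cells inside [0, 1], so that cell j
    lies in the domain of the second difference. *)
Lemma sum_d2avg_le g m : L1 g ->
  ((\sum_(j < 2 ^ m | (j.+2 < 2 ^ m)%N) `|d2avg g m j|)%:E <=
   (2 ^+ m)%:E * LpNorm (diff_dom `[0%R, 1%R] 2 (2 ^- m)) 1 (fdiff 2 (2 ^- m) g))%E.
Proof.
move=> gi; rewrite LpNorm1; have Fi := L1_fdiff2 (2 ^- m) gi.
apply: (@le_trans _ _ ((2 ^+ m)%:E * \sum_(j < 2 ^ m | (j.+2 < 2 ^ m)%N)
   \int[mu]_(x in cell m j) `|fdiff 2 (2 ^- m) g x|%:E)%E).
  rewrite -sumEFin ge0_sume_distrr; last by move=> j _; exact: integral_ge0.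
  apply: lee_sum => j _; rewrite d2avgE // normrM gtr0_norm // EFinM.
  by apply: lee_pmul => //; exact: normr_Rintegral_cell.
apply: lee_pmul => //; first by apply: sume_ge0 => j _; exact: integral_ge0.
apply: (@sum_cell_integral_le _ _ (fun j => (j.+2 < 2 ^ m)%N)) => //; first exact: L1_measurable_norm.
move=> j _ jm x /in_cell/andP[h1 h2]; rewrite /diff_dom /= !in_itv /=.
have p0 := pow2_gt0 R m.
have jm' : j%:R + 3 <= 2 ^+ m :> R by rewrite -natrX -natrD ler_nat addn3.
rewrite -natr1 in h2.
have x0 : 0 <= x by rewrite -(pmulr_rge0 _ p0); apply: le_trans h1; exact: ler0n.
have x1 : x + 2 * 2 ^- m <= 1.
  rewrite -(ler_pM2l p0) mulr1 mulrDr mulrCA divff // mulr1; lra.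
have i0 : 0 <= 2 ^- m :> R by rewrite invr_ge0 ltW.
by split; apply/andP; split; lra.
Qed.

(** Both coefficients are linear forms in the averages b0, ..., b3 over the four grandchildren of a
    level-k cell. They vanish on affine sequences, hence are combinations of the two available
    second differences; the absolute weights 3/4 and 1/4 add up to 1 for each second difference. *)
Lemma del_d2avg g k i : L1 g ->
  (`|del g k.+1 i.*2| + `|del g k.+1 i.*2.+1| <=
   `|d2avg g k.+2 i.*2.*2| + `|d2avg g k.+2 i.*2.*2.+1|)%R.
Proof.
move=> gi; rewrite /del doubleK /= uphalf_double /hdiff !(avg_mean k.+1 _ gi) doubleS.
set b0 := avg g k.+2 i.*2.*2; set b1 := avg g k.+2 i.*2.*2.+1.
set b2 := avg g k.+2 i.*2.*2.+2; set b3 := avg g k.+2 i.*2.*2.+3.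
have -> : b1 - b0 - ((b2 + b3) / 2 - (b0 + b1) / 2) / 2 =
  (- 3 * d2avg g k.+2 i.*2.*2 - d2avg g k.+2 i.*2.*2.+1) / 4.
  by rewrite /d2avg -/b0 -/b1 -/b2 -/b3; field.
have -> : b3 - b2 - ((b2 + b3) / 2 - (b0 + b1) / 2) / 2 =
  (3 * d2avg g k.+2 i.*2.*2.+1 + d2avg g k.+2 i.*2.*2) / 4.
  by rewrite /d2avg -/b0 -/b1 -/b2 -/b3; field.
move: (d2avg _ _ _) (d2avg _ _ _) => s0 s1.
have := ler_norm s0; have := ler_norm s1; have := lerNnormlW (lexx `|s0|); have := lerNnormlW (lexx `|s1|).
move=> h1 h2 h3 h4.
have H1 : `|(- 3 * s1 - s0) / 4| <= (3 * `|s1| + `|s0|) / 4 by rewrite ler_norml; lra.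
have H2 : `|(3 * s0 + s1) / 4| <= (3 * `|s0| + `|s1|) / 4 by rewrite ler_norml; lra.
by lra.
Qed.

Lemma sum_del_le g k : L1 g ->
  ((\sum_(j < 2 ^ k.+1) `|del g k.+1 j|)%:E <=
   (2 ^+ k.+2)%:E * LpNorm (diff_dom `[0%R, 1%R] 2 (2 ^- k.+2)) 1 (fdiff 2 (2 ^- k.+2) g))%E.
Proof.
move=> gi; apply: le_trans (sum_d2avg_le k.+2 gi); rewrite lee_fin.
rewrite (sum_pow2S (fun j => `|del g k.+1 j|)).
apply: (@le_trans _ _ (\sum_(i < 2 ^ k) (`|d2avg g k.+2 i.*2.*2| + `|d2avg g k.+2 i.*2.*2.+1|))).
  by apply: ler_sum => i _; exact: del_d2avg.
rewrite [leRHS]big_mkcond.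
rewrite (sum_pow2S (fun j => if (j.+2 < 2 ^ k.+2)%N then `|d2avg g k.+2 j| else 0)).
rewrite (sum_pow2S (fun j => (if (j.*2.+2 < 2 ^ k.+2)%N then `|d2avg g k.+2 j.*2| else 0) +
   (if (j.*2.+3 < 2 ^ k.+2)%N then `|d2avg g k.+2 j.*2.+1| else 0))).
apply: ler_sum => i _.
have ik : (i.*2.*2.+3 < 2 ^ k.+2)%N.
  by rewrite !expnS; have := ltn_ord i; lia.
rewrite ik (ltn_trans _ ik) // lerDl addr_ge0 //; case: ifP => //.
Qed.

End SecondDifferences.

(** * Convergence of dyadic averages and passage to the limit *)

Section Differentiation.
Variable R : realType.
Notation mu := (@lebesgue_measure R).
Notation L1 g := (mu.-integrable setT (EFin \o g)).
Implicit Types (g : R -> R) (j m M : nat).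

Definition cell_index M (x : R) : nat := Num.truncn (2 ^+ M * x).

Lemma mem_cell_index M (x : R) : 0 <= x -> cell M (cell_index M x) x.
Proof. by move=> x0; apply/in_cell; apply: truncn_itv; rewrite mulr_ge0. Qed.

Lemma cell_index_lt M (x : R) : 0 <= x < 1 -> (cell_index M x < 2 ^ M)%N.
Proof.
move=> /andP[x0 x1]; have /in_cell/andP[h _] := mem_cell_index M x0.
by rewrite -(ltr_nat R) natrX; apply: le_lt_trans h _; rewrite gtr_pMr.
Qed.

(* For negative x any family shrinking nicely to x will do. *)
Definition cell_at (x : R) M : set R :=
  if 0 <= x then cell M (cell_index M x) else ball x (2 ^- M).

Lemma cell_at_shrinking x : nicely_shrinking x (cell_at x).
Proof.
have p0 n : 0 < 2 ^- n :> R by rewrite invr_gt0.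
split; first by move=> n; rewrite /cell_at; case: ifP => _ //; exact: measurable_ball.
(* A cell of length 2^-n lies in the ball of radius 2^-n about any of its points, and that ball has
   twice its measure. *)
exists (2, fun n => PosNum (p0 n)); split => //=.
- rewrite (_ : (fun n => 2 ^- n) = fun n => (2^-1) ^+ n :> R); last first.
    by apply/funext => n; rewrite exprVn.
  by apply: cvg_expr; rewrite ger0_norm // invf_lt1 // ltr1n.
- move=> n y; rewrite /cell_at; case: ifP => // x0 /in_cell/andP[h1 h2].
  have /in_cell/andP[h3 h4] := mem_cell_index n x0.
  rewrite /ball /= -(ltr_pM2l (pow2_gt0 R n)) divff // -[X in X * `|_|]gtr0_norm //.
  by rewrite -normrM mulrBr ltr_norml -natr1 in h2 h4 *; lra.
- move=> n; rewrite lebesgue_measure_ball ?(ltW (p0 n)) // /cell_at; case: ifP => _.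
    by rewrite [X in (_ * X)%E]mu_cell -EFinM lee_fin mulr_natl.
  rewrite lebesgue_measure_ball ?(ltW (p0 n)) // -EFinM lee_fin mulr_natl.
  by have := p0 n; rewrite !mulr2n; lra.
Qed.

Lemma cvg_avg g : L1 g ->
  {ae mu, forall x, 0 <= x -> (fun M => avg g M (cell_index M x)) @ \oo --> g x}.
Proof.
move=> gi.
have loc : locally_integrable setT g by apply: open_integrable_locally => //; exact: openT.
have [N [mN N0 HN]] := lebesgue_differentiation loc.
exists N; split => // x /= nx; apply: HN => /= gx; apply: nx => x0.
have := nice_lebesgue_differentiation cell_at_shrinking loc gx.
rewrite /cell_at x0 => H.
have /fine_cvgP[_] : (fun M => (avg g M (cell_index M x))%:E) @ \oo --> (g x)%:E.
  apply: cvg_trans H; apply: near_eq_cvg; apply: nearW => M.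
  rewrite [X in (X^-1 * _)%E]mu_cell inver gt_eqF ?invr_gt0 // invrK /avg EFinM /Rintegral.
  by rewrite fineK //; apply: integrable_fin_num => //; exact: integrable_cell.
by apply: cvg_trans.
Qed.

Lemma cvg_exprn (u : R^nat) (l : R) n : u @ \oo --> l -> (fun M => u M ^+ n) @ \oo --> l ^+ n.
Proof.
move=> ul; elim: n => [|n IH]; first exact: cvg_cst.
rewrite exprS (_ : (fun M => _) = u \* (fun M => u M ^+ n)); first exact: cvgM.
by apply/funext => M; rewrite exprS.
Qed.

(* Fatou's lemma along the dyadic averages. *)
Lemma integral_expr_le_avg g p (B : R) : L1 g ->
  (forall M, \sum_(j < 2 ^ M) (2 ^ M)%:R^-1 * (avg g M j ^+ 2) ^+ p <= B) ->
  (\int[mu]_(x in `[0%R, 1%R[) ((g x ^+ 2) ^+ p)%:E <= B%:E)%E.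
Proof.
move=> gi gB; pose D : set R := `[0, 1[%classic.
pose c M j := (avg g M j ^+ 2) ^+ p.
have c0 M j : 0 <= c M j by rewrite /c; ge0.
pose phi M (x : R) := (\sum_(j < 2 ^ M) c M j * \1_(cell M j) x)%:E.
have mphij M j : measurable_fun setT (fun x : R => (c M j * \1_(cell M j) x)%:E).
  by apply/measurable_EFinP; apply: measurable_funM => //; exact: measurable_indic.
have phi0 M x : (0 <= phi M x)%E.
  by rewrite lee_fin; apply: sumr_ge0 => j _; apply: mulr_ge0.
have mphi M : measurable_fun setT (phi M).
  rewrite (_ : phi M = fun x => (\sum_(j < 2 ^ M) (c M j * \1_(cell M j) x)%:E)%E).
    by apply: emeasurable_sum => j; exact: mphij.
  by apply/funext => x; rewrite /phi sumEFin.
have phiE M x : D x -> phi M x = (c M (cell_index M x))%:E.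
  rewrite /D /= in_itv /= => x01; have [x0 _] := andP x01.
  rewrite /phi (bigD1 (Ordinal (cell_index_lt M x01))) //= big1 => [|j jN].
    by rewrite addr0 indicE mem_set ?mulr1 //; exact: mem_cell_index.
  rewrite indicE memNset ?mulr0 // => xj; move: jN; rewrite -val_eqE /= => /eqP; apply.
  exact: cell_uniq xj (mem_cell_index M x0).
have phi_int M : (\int[mu]_(x in D) phi M x <= B%:E)%E.
  apply: (@le_trans _ _ (\int[mu]_x phi M x)%E); first exact: ge0_integral_subset.
  apply: le_trans (_ : (\sum_(j < 2 ^ M) (2 ^ M)%:R^-1 * c M j)%:E <= _)%E; last by rewrite lee_fin; exact: gB.
  rewrite /phi; under eq_integral do rewrite -sumEFin.
  rewrite ge0_integral_sum //; last 2 first.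
  - by move=> j; exact: mphij.
  - by move=> j x _; rewrite lee_fin; apply: mulr_ge0.
  rewrite -sumEFin; apply: lee_sum => j _.
  under eq_integral do rewrite EFinM.
  rewrite ge0_integralZl_EFin //; last by apply/measurable_EFinP; exact: measurable_indic.
  rewrite integral_indic // setIT [X in (_ * X)%E]mu_cell -EFinM lee_fin mulrC natrX //.
have [N [mN N0 HN]] := cvg_avg gi.
pose F x := ((g x ^+ 2) ^+ p)%:E.
have F0 x : (0 <= F x)%E by rewrite lee_fin; ge0.
have mF : measurable_fun D F.
  apply/measurable_EFinP/measurable_funX/measurable_funX.
  by move/integrableP: gi => [/measurable_EFinP mg _]; exact: measurable_funS mg.
rewrite (@ge0_negligible_integral _ _ _ mu D N F mN (measurable_itv _) mF (fun x _ => F0 x) N0).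
apply: (@le_trans _ _ (\int[mu]_(x in D `\` N) limn_einf (phi^~ x))%E).
  apply: ge0_integral_mono => // x [Dx Nx].
  have x0 : 0 <= x by move: Dx; rewrite /D /= in_itv /= => /andP[].
  have gx : (fun M => avg g M (cell_index M x)) @ \oo --> g x.
    by apply: contrapT => H; apply: Nx; apply: HN => /= /(_ x0).
  rewrite (cvg_limn_einf_sup (_ : phi^~ x @ \oo --> F x)).1 //.
  apply: cvg_EFin; first by apply: nearW => M; rewrite phiE.
  rewrite (_ : fine \o _ = fun M => c M (cell_index M x)); last first.
    by apply/funext => M; rewrite -[LHS]/(fine (phi M x)) phiE.
  by do 2 apply: cvg_exprn.
apply: (@le_trans _ _ (\int[mu]_(x in D) limn_einf (phi^~ x))%E).
  apply: ge0_integral_subset; last by move=> x [].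
  move=> x Dx; rewrite limn_einf_lim; apply: lime_ge; first exact: is_cvg_einfs.
  apply: nearW => M; apply: le_ereal_inf_tmp => _ [m _ <-]; exact: phi0.
apply: (@le_trans _ _ (limn_einf (fun M => \int[mu]_(x in D) phi M x)%E)).
  apply: fatou; [exact: measurable_itv| |by move=> M x _; exact: phi0].
  move=> M; exact: (measurable_funS measurableT (@subsetT _ D) (mphi M)).
rewrite limn_einf_lim; apply: lime_le; first exact: is_cvg_einfs.
apply: nearW => M; apply: le_trans (phi_int M); apply: ereal_inf_lbound.
by exists M => /=.
Qed.

End Differentiation.

(** * The system dual to [del] *)

Section Zeta.
Variable R : realType.
Notation mu := (@lebesgue_measure R).
Notation L1 g := (mu.-integrable setT (EFin \o g)).
Implicit Types (f : R -> R) (i j k m : nat).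

Lemma Rintegral_id (a b : R) : a < b ->
  \int[mu]_(x in `[a, b[) x = (b ^+ 2 - a ^+ 2) / 2.
Proof.
move=> ab; pose F (x : R) : R := x ^+ 2 / 2.
have dF (x : R) : is_derive x 1 F x.
  apply: is_derive_eq; rewrite /= ?scaler0 ?addr0 /GRing.scale /=.
  by field.
have cF : continuous F.
  by move=> x; apply: differentiable_continuous; apply/derivable1_diffP; case: (dF x).
rewrite /Rintegral integral_itv_bndo_bndc; last exact/measurable_EFinP.
rewrite (@continuous_FTC2 _ _ F) //=.
- by rewrite /F; field.
- by apply: continuous_subspaceT => x; exact: cvg_id.
- split; first by move=> x _; case: (dF x).
  + exact/cvg_at_right_filter/cF.
  + exact/cvg_at_left_filter/cF.
- by move=> x _; rewrite derive1E; case: (dF x).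
Qed.

Lemma L1_bounded f (a b B : R) : measurable_fun setT f ->
  (forall x, `|f x| <= B * \1_`[a, b] x) -> L1 f.
Proof.
move=> mf fB; apply: (@le_integrable _ _ _ mu setT measurableT _
    (fun x => (B * \1_`[a, b] x)%:E)) => //; first exact/measurable_EFinP.
  by move=> x _ /=; rewrite lee_fin (le_trans (fB x)) // ler_norm.
exact: (integrableZl measurableT B (integrable_indic_itv a b true false)).
Qed.

(** Affine from -1 to 1 on its cell and zero outside; [del_zeta] shows that these functions are dual
    to [del]. *)
Definition zeta i j (x : R) : R := (2 ^+ i.+1 * x - j.*2.+1%:R) * \1_(cell i j) x.

Lemma zetaE i j x : cell i j x -> zeta i j x = 2 ^+ i.+1 * x - j.*2.+1%:R.
Proof. by move=> xi; rewrite /zeta indicE mem_set // mulr1. Qed.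

Lemma natr_double1 j : j.*2.+1%:R = 2 * j%:R + 1 :> R.
Proof. by rewrite -natr1 -mul2n natrM. Qed.

Lemma zeta_bound i j x : `|zeta i j x| <= \1_(cell i j) x.
Proof.
rewrite /zeta indicE; case: (boolP (x \in cell i j)) => [/set_mem/in_cell/andP[h1 h2]|_].
  rewrite mulr1 exprS -mulrA natr_double1 ler_norml.
  have j1 : j.+1%:R = j%:R + 1 :> R by rewrite natr1.
  by move: h1 h2; rewrite j1; move: (2 ^+ i * x) => y h1 h2; apply/andP; split; rewrite ?mulr1n; lra.
by rewrite mulr0 normr0.
Qed.

Lemma measurable_zeta i j : measurable_fun setT (zeta i j).
Proof.
apply: measurable_funM; last exact: measurable_indic.
by apply: measurable_funB => //; apply: measurable_funM.
Qed.

Lemma cell_sub01 k j : (j < 2 ^ k)%N -> cell k j `<=` (`[0%R, 1%R] : set R).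
Proof.
move=> jk x /in_cell/andP[h1 h2]; rewrite /= in_itv /=; have p0 := pow2_gt0 R k.
rewrite -(pmulr_rge0 _ p0) (le_trans _ h1) //= -(ler_pM2l p0) mulr1 ltW //.
by apply: lt_le_trans h2 _; rewrite -natrX ler_nat.
Qed.

Lemma zeta_norm_le i j x : (j < 2 ^ i)%N -> `|zeta i j x| <= 1 * \1_`[0, 1] x.
Proof.
move=> ji; apply: le_trans (zeta_bound i j x) _; rewrite mul1r !indicE ler_nat.
case: (boolP (x \in cell i j)) => // /set_mem /(cell_sub01 ji) xi.
by rewrite mem_set.
Qed.

Lemma L1_zeta i j : (j < 2 ^ i)%N -> L1 (zeta i j).
Proof.
move=> ji; apply: (@L1_bounded _ 0 1 1); first exact: measurable_zeta.
by move=> x; exact: zeta_norm_le.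
Qed.

Lemma cell_parent d i m : cell (i + d) m `<=` (cell i (m %/ 2 ^ d) : set R).
Proof.
elim: d m => [|d IH] m; first by rewrite addn0 expn0 divn1.
rewrite addnS expnS divnMA divn2 => x xm; apply: IH.
rewrite cell_split; rewrite -{1}(odd_double_half m) in xm.
by case: (odd m) xm; rewrite ?add1n ?add0n; [right|left].
Qed.

Lemma continuous_integrable_cell f k m : continuous f ->
  mu.-integrable (cell k m) (EFin \o f).
Proof.
move=> cf; apply: (@integrableS _ _ _ mu `[m%:R / 2 ^+ k, m.+1%:R / 2 ^+ k]) => //.
  by move=> x; rewrite /cell /= !in_itv /= => /andP[-> /ltW ->].
apply: continuous_compact_integrable; first exact: segment_compact.
exact: continuous_subspaceT.
Qed.

(** An affine function has its midpoint value as average; m %/ 2 ^ d is the ancestor at level i of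
    the cell m. *)
Lemma avg_zeta i j d m : (j < 2 ^ i)%N ->
  avg (zeta i j) (i + d) m =
  ((m %/ 2 ^ d)%N == j)%:R * (2 ^+ i.+1 * ((m%:R + 2^-1) / 2 ^+ (i + d)) - j.*2.+1%:R).
Proof.
move=> ji; have [<-|ne] := eqVneq; last first.
  rewrite mul0r -(avg_cst 0 (i + d) m) /avg; congr (_ * _).
  apply: eq_Rintegral => x /set_mem xm.
  rewrite /zeta indicE memNset ?mulr0 // => xj.
  by move/eqP: ne; apply; apply: cell_uniq xj; exact: cell_parent xm.
set j' := (m %/ 2 ^ d)%N.
rewrite /avg (@eq_Rintegral _ _ _ mu _ (fun x => 2 ^+ i.+1 * x - j'.*2.+1%:R)); last first.
  by move=> x /set_mem /cell_parent xj; rewrite zetaE.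
rewrite RintegralB //; last 2 first.
- by apply: continuous_integrable_cell => x; apply: cvgM; [exact: cvg_cst|exact: cvg_id].
- by apply: continuous_integrable_cell => x; exact: cvg_cst.
rewrite RintegralZl //; last by apply: continuous_integrable_cell => x; exact: cvg_id.
rewrite Rintegral_cst // [X in _ - _ * fine X](mu_cell _ _ m) /= Rintegral_id; last first.
  by rewrite ltr_pM2r ?invr_gt0 // ltr_nat.
rewrite mul1r (_ : m.+1%:R = m%:R + 1) ?natr1 //; have := pow2_neq0 R (i + d); move: (2 ^+ (i + d)) => z z0.
by field.
Qed.

Lemma avg_zeta_coarse i j d m : (j < 2 ^ i)%N -> (d <= i)%N -> avg (zeta i j) (i - d) m = 0.
Proof.
move=> ji; elim: d m => [|d IH] m di.
  have := avg_zeta 0 m ji; rewrite subn0 addn0 expn0 divn1 => ->.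
  have [->|_] := eqVneq; last by rewrite mul0r.
  rewrite mul1r exprS natr_double1.
  have := pow2_neq0 R i; move: (2 ^+ i) => z z0; by field.
have E : (i - d)%N = (i - d.+1).+1 by lia.
by rewrite (avg_mean _ _ (L1_zeta ji)) -E !IH ?addr0 ?mul0r // ltnW.
Qed.

Lemma hdiff_zeta_fine i j d m : (j < 2 ^ i)%N ->
  hdiff (zeta i j) (i + d) m = ((m %/ 2 ^ d)%N == j)%:R / 2 ^+ d.
Proof.
move=> ji; rewrite /hdiff -addnS !avg_zeta // expnS !divnMA !divn2 doubleK /= uphalf_double.
rewrite -mulrBr; congr (_ * _); rewrite addnS !exprS exprD !natr_double1 -mul2n natrM.
have := pow2_neq0 R i; have := pow2_neq0 R d.
by move: (2 ^+ i) (2 ^+ d) => z y z0 y0; field; apply/andP.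
Qed.

Lemma hdiff_zeta_coarse i j k m : (j < 2 ^ i)%N -> (k < i)%N -> hdiff (zeta i j) k m = 0.
Proof.
move=> ji ki; have E : k.+1 = (i - (i - k.+1))%N by lia.
by rewrite /hdiff E !avg_zeta_coarse ?subrr //; lia.
Qed.

(** At levels above the cell the averages vanish, at its own level the slope gives 1, and below it
    the function is affine, so half of the parent's difference is exactly the child's and [del]
    vanishes. *)
Lemma del_zeta i j k m : (j < 2 ^ i)%N ->
  del (zeta i j) k m = ((k == i) && (m == j))%:R.
Proof.
move=> ji; have [ki|ik|->] := ltngtP k i.
- case: k ki => [|k] ki /=; first exact: hdiff_zeta_coarse.
  by rewrite !hdiff_zeta_coarse ?mul0r ?subr0 // ltnW.
- have [d ->] : exists d, k = (i + d).+1 by exists (k - i).-1; lia.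
  rewrite /= -addnS !hdiff_zeta_fine // expnS divnMA divn2 exprS invfM.
  by have := pow2_neq0 R d; move: (2 ^+ d) => y y0; field.
- case: i ji => [|i] ji /=.
    by have := hdiff_zeta_fine 0 m ji; rewrite addn0 expr0 divr1 expn0 divn1.
  rewrite [X in _ - X / 2]hdiff_zeta_coarse // mul0r subr0.
  by have := hdiff_zeta_fine 0 m ji; rewrite addn0 expr0 divr1 expn0 divn1.
Qed.

End Zeta.

(** * Discretisation of the Besov seminorm *)

Section BesovSequence.
Variable R : realType.
Notation mu := (@lebesgue_measure R).
Implicit Types (f : R -> R) (M N : nat).

Lemma besov_s1 : besov_s (1 : R) = 2%N.
Proof. by rewrite /besov_s floor1. Qed.

(* For th >= 2 split according to whether [nu M] exceeds N^(-1/th). *)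
Lemma sum_sqr_le_powR (nu : nat -> R) (th : R) N :
  (forall M, 0 <= nu M <= 1) -> 1 <= th -> \sum_(M < N) nu M `^ th <= 1 ->
  (th <= 2 -> \sum_(M < N) nu M ^+ 2 <= 1) /\
  (2 <= th -> (0 < N)%N -> \sum_(M < N) nu M ^+ 2 <= 2 * N%:R `^ (1 - 2 * th^-1)).
Proof.
move=> nu01 th1 S1; have th0 : 0 < th by apply: lt_le_trans th1.
split=> [th2|th2 N0].
  apply: le_trans S1; apply: ler_sum => M _; have /andP[n0 n1] := nu01 M.
  have [->|nz] := eqVneq (nu M) 0; first by rewrite expr0n /= powR_ge0.
  rewrite -powR_mulrn //; apply: ger_powR => //; rewrite n1 andbT lt_neqAle eq_sym nz //.
have NR : 0 < N%:R :> R by rewrite ltr0n.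
pose s : R := N%:R `^ (- th^-1).
have s0 : 0 < s by exact: powR_gt0.
have step M : nu M ^+ 2 <= s ^+ 2 + nu M `^ th * s `^ (2 - th).
  have /andP[n0 n1] := nu01 M.
  have [le_s|/ltW le_s] := lerP (nu M) s.
    rewrite ler_wpDr ?mulr_ge0 ?powR_ge0 // lerXn2r ?nnegrE //; exact: ltW.
  rewrite ler_wpDl ?sqr_ge0 //.
  have np : 0 < nu M by apply: lt_le_trans le_s.
  have -> : nu M ^+ 2 = nu M `^ th * nu M `^ (2 - th).
    rewrite -powRD ?(gt_eqF np) ?implybT // (_ : th + (2 - th) = 2%:R); last by ring.
    by rewrite powR_mulrn.
  rewrite ler_wpM2l ?powR_ge0 // -opprB !powRN lef_pV2 ?posrE ?powR_gt0 //.
  by apply: ge0_ler_powR; rewrite ?subr_ge0 ?nnegrE ?(ltW s0).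
apply: le_trans (ler_sum _ (fun (M : 'I_N) _ => step M)) _.
rewrite big_split /= sumr_const card_ord -mulr_suml -[s ^+ 2 *+ N]mulr_natl.
have e1 : s ^+ 2 = N%:R `^ (- 2 * th^-1).
  by rewrite -powR_mulrn ?(ltW s0) // -powRrM; congr (_ `^ _); rewrite mulrC mulrN mulNr.
have e2 : s `^ (2 - th) = N%:R `^ (1 - 2 * th^-1).
  by rewrite -powRrM; congr (_ `^ _); field; rewrite gt_eqF.
have e3 : N%:R * s ^+ 2 = N%:R `^ (1 - 2 * th^-1).
  by rewrite e1 -{1}(powRr1 (ltW NR)) -powRD ?mulNr // (gt_eqF NR) implybT.
rewrite e2 e3; have := ler_piMl (powR_ge0 N%:R (1 - 2 * th^-1)) S1; lra.
Qed.

Lemma poweR_le (x y : \bar R) (r : R) : 0 <= r -> (0 <= x)%E -> (x <= y)%E ->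
  (x `^ r <= y `^ r)%E.
Proof.
move=> r0 x0 xy; apply: gt0_ler_poweR => //; rewrite in_itv /= leey andbT //.
exact: le_trans xy.
Qed.

Lemma poweR_inv_le1 (X : \bar R) (th : R) : 0 < th -> (0 <= X)%E ->
  (X `^ th^-1 <= 1)%E -> (X <= 1)%E.
Proof.
move=> th0 X0 H; have thn : th != 0 by rewrite gt_eqF.
have -> : X = ((X `^ th^-1) `^ th)%E by rewrite -poweRrM mulVf // poweRe1.
by rewrite -(poweR1r th); apply: poweR_le; rewrite ?(ltW th0) ?poweR_ge0.
Qed.

Lemma LpNorm_ge0 (D : set R) (p : R) f : (0 <= LpNorm D p f)%E.
Proof. exact: poweR_ge0. Qed.

Lemma modsmooth_ge (D : set R) s p f (h t : R) : 0 < h -> h <= t ->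
  (LpNorm (diff_dom D s h) p (fdiff s h f) <= modsmooth D s p f t)%E.
Proof.
move=> h0 ht; apply: ereal_sup_ubound; exists h => //.
by rewrite /= in_itv /= h0.
Qed.

Lemma modsmooth_mono (D : set R) s p f (t u : R) : t <= u ->
  (modsmooth D s p f t <= modsmooth D s p f u)%E.
Proof.
move=> tu; apply: ereal_sup_le => _ [h /= ht <-]; exists h => //=.
by move: ht; rewrite !in_itv /= => /andP[-> /le_trans]; exact.
Qed.

Lemma modsmooth_ge0 (D : set R) s p f (t : R) : 0 < t -> (0 <= modsmooth D s p f t)%E.
Proof. by move=> t0; apply: le_trans (modsmooth_ge _ _ _ _ t0 (lexx t)); exact: LpNorm_ge0. Qed.

Definition octave M : set R := `]2 ^- M.+1, 2 ^- M].

Lemma mu_octave M : mu (octave M) = (2 ^- M.+1)%:E.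
Proof.
rewrite lebesgue_measure_itv /= lte_fin ltf_pV2 ?posrE // exprS.
rewrite ltr_pMl // ltr1n -EFinB; congr EFin.
by have := pow2_neq0 R M; move: (2 ^+ M) => z z0; field.
Qed.

Lemma octave_uniq M N t : octave M t -> octave N t -> M = N.
Proof.
wlog : M N / (M <= N)%N => [W|].
  by have [MN|/ltnW NM] := leqP M N; [exact: W|move=> a b; apply/esym; exact: W].
rewrite leq_eqVlt => /predU1P[//|MN]; rewrite /octave /= !in_itv /=.
move=> /andP[h1 _] /andP[_ h2]; have := lt_le_trans h1 h2.
rewrite ltf_pV2 ?posrE // ltr_eXn2l ?ltr1n // => H; lia.
Qed.

Lemma octave_gt0 M t : octave M t -> 0 < t.
Proof.
by rewrite /octave /= in_itv /= => /andP[h _]; apply: lt_trans h; rewrite invr_gt0.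
Qed.

Lemma octave_inv_ge M t : octave M t -> 2 ^+ M <= t^-1.
Proof.
move=> h; have t0 := octave_gt0 h; move: h; rewrite /octave /= in_itv /= => /andP[_ h].
by rewrite -(invrK (2 ^+ M)) lef_pV2 ?posrE ?invr_gt0.
Qed.

(** A lower Riemann sum of the Besov integral: on [octave M] the factor t^-1 is at least 2^M, and
    the modulus of smoothness, being monotone, is at least its value at the left end. *)
Lemma sum_octave_le (I : set R) f (th : R) N : 0 < th ->
  (\sum_(M < N) (((2 ^+ M)%:E * modsmooth I 2 1 f (2 ^- M.+1)) `^ th * (2 ^+ M)%:E)
      * (2 ^- M.+1)%:E <=
   \int[mu]_(t in `]0%R, +oo[)
     (((t `^ (- 1))%:E * modsmooth I 2 1 f t) `^ th * (t^-1)%:E))%E.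
Proof.
move=> th0.
pose c M := (((2 ^+ M)%:E * modsmooth I 2 1 f (2 ^- M.+1)) `^ th * (2 ^+ M)%:E)%E.
have c0 M : (0 <= c M)%E by apply: mule_ge0; rewrite ?poweR_ge0 // lee_fin.
have mo M : measurable (octave M) by exact: measurable_itv.
apply: (@le_trans _ _ (\int[mu]_x \sum_(M < N) (c M * (\1_(octave M) x)%:E))%E).
  rewrite ge0_integral_sum //; last 2 first.
  - move=> M; apply: emeasurable_funM; first exact: measurable_cst.
    apply/measurable_EFinP; apply: measurable_indic; exact: mo.
  - by move=> M x _; apply: mule_ge0 => //; rewrite lee_fin.
  apply: lee_sum => M _; rewrite ge0_integralZl //; last first.
    apply/measurable_EFinP; apply: measurable_indic; exact: mo.
  by rewrite integral_indic ?setIT ?[X in (_ <= _ * X)%E]mu_octave //; exact: mo.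
rewrite [leRHS]integral_mkcond; apply: ge0_integral_mono => [x _|x _].
  by apply: sume_ge0 => M _; apply: mule_ge0 => //; rewrite lee_fin.
have rhs0 : (0 <= ((fun t : R => ((t `^ (- 1))%:E * modsmooth I 2 1 f t) `^ th * (t^-1)%:E)%E
   \_ `]0%R, +oo[) x)%E.
  rewrite patchE; case: ifPn => // /set_mem; rewrite /= in_itv /= andbT => x0.
  by apply: mule_ge0; rewrite ?poweR_ge0 // lee_fin invr_ge0 ltW.
have [[M xM]|none] := pselect (exists M : 'I_N, octave M x); last first.
  rewrite big1 // => M _; rewrite indicE memNset ?mule0 // => xM; apply: none; by exists M.
rewrite (bigD1 M) //= big1 => [|M' M'M]; last first.
  rewrite indicE memNset ?mule0 // => xM'; move/eqP: M'M; apply; apply: val_inj.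
  exact: octave_uniq xM' xM.
have x0 := octave_gt0 xM.
rewrite adde0 indicE mem_set // mule1 patchE mem_set; last by rewrite /= in_itv /= x0.
have xi := octave_inv_ge xM.
have xh : 2 ^- M.+1 <= x by move: xM; rewrite /octave /= in_itv /= => /andP[/ltW].
apply: lee_pmul => //; rewrite ?poweR_ge0 ?lee_fin //.
have m0 : (0 <= modsmooth I 2 1 f (2 ^- M.+1))%E by apply: modsmooth_ge0; rewrite invr_gt0.
have m1 : (0 <= modsmooth I 2 1 f x)%E by exact: modsmooth_ge0.
apply: poweR_le; rewrite ?(ltW th0) //.
  by apply: mule_ge0 => //; rewrite lee_fin.
rewrite powR_inv1 ?(ltW x0) //; apply: lee_pmul; rewrite ?lee_fin //; exact: modsmooth_mono.
Qed.

Lemma besov_semi_sequence f (theta : \bar R) (I : set R) :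
  (1 <= theta)%E -> (besov_semi I 1 1 theta f <= 1)%E ->
  exists nu : nat -> R, [/\ forall M, 0 <= nu M <= 1,
    forall M, ((2 ^+ M.+1)%:E * modsmooth I 2 1 f (2 ^- M.+1) <= (4 * nu M)%:E)%E,
    forall N, (theta <= 2%:E)%E -> \sum_(M < N) nu M ^+ 2 <= 1 &
    forall N, (2%:E <= theta)%E -> (0 < N)%N ->
      \sum_(M < N) nu M ^+ 2 <= 2 * N%:R `^ (1 - 2 * inv_theta theta)].
Proof.
rewrite /besov_semi besov_s1; case: theta => [th| |] //; last first.
  (* For theta = +oo every term of the sequence may be of full size, and the sum of N squares is
     N. *)
  move=> _ H; exists (fun => 1); split => //.
  - by move=> M; rewrite ler01 lexx.
  - move=> M; have t0 : 0 < 2 ^- M.+1 :> R by rewrite invr_gt0.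
    apply: (@le_trans _ _ 1%E); last by rewrite lee_fin; lra.
    apply: le_trans H; apply: ereal_sup_ubound; exists (2 ^- M.+1).
      by rewrite /= in_itv /= t0.
    by rewrite powR_inv1 ?(ltW t0) // invrK.
  - move=> N _ N0; under eq_bigr do rewrite expr1n.
    rewrite sumr_const card_ord /inv_theta mulr0 subr0 powRr1 // ler_peMl //; lra.
rewrite !lee_fin => th1 H; have th0 : 0 < th by apply: lt_le_trans th1.
have {}H := poweR_inv_le1 th0 _ H.
have S1 N := le_trans (sum_octave_le I f N th0) (H (integral_ge0 _ _)).
have {H}S1 N : (\sum_(M < N) (((2 ^+ M)%:E * modsmooth I 2 1 f (2 ^- M.+1)) `^ th * (2 ^+ M)%:E)
      * (2 ^- M.+1)%:E <= 1)%E.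
  apply: S1 => t; rewrite /= in_itv /= andbT => t0.
  by apply: mule_ge0; rewrite ?poweR_ge0 // lee_fin invr_ge0 ltW.
pose X M := ((2 ^+ M)%:E * modsmooth I 2 1 f (2 ^- M.+1))%E.
have X0 M : (0 <= X M)%E.
  by apply: mule_ge0; rewrite ?lee_fin //; apply: modsmooth_ge0; rewrite invr_gt0.
have termE M : (X M `^ th * (2 ^+ M)%:E * (2 ^- M.+1)%:E = 2^-1%:E * X M `^ th)%E.
  rewrite -muleA -EFinM muleC; congr (_%:E * _)%E.
  by rewrite exprS invfM mulrCA divff // mulr1.
have {}S1 N : (\sum_(M < N) 2^-1%:E * X M `^ th <= 1)%E.
  by apply: le_trans (S1 N); apply: lee_sum => M _; rewrite -/(X M) termE.
have t0 M : (0 <= 2^-1%:E * X M `^ th)%E by apply: mule_ge0; rewrite ?poweR_ge0 // lee_fin.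
have Xfin M : X M \is a fin_num.
  rewrite ge0_fin_numE // (@lty_poweRy _ _ th) ?(gt_eqF th0) //.
  rewrite ltNge leye_eq; apply/negP => /eqP Xy.
  have := S1 M.+1; rewrite big_ord_recr /= Xy gt0_muley ?lte_fin //.
  rewrite addey ?leye_eq // gt_eqF // (@lt_le_trans _ _ 0%E) ?ltNy0 //.
  by apply: sume_ge0 => k _; exact: t0.
(* The measure of an octave leaves a factor 1/2 in front of X M ^ th. As th >= 1, the factor
   (1/2)^th produced by halving X M is no larger, so the powers of nu sum to at most 1. *)
pose nu M := fine (X M) / 2.
have nu0 M : 0 <= nu M by rewrite /nu divr_ge0 // fine_ge0.
have Snu N : \sum_(M < N) nu M `^ th <= 1.
  rewrite -lee_fin -sumEFin; apply: le_trans (S1 N); apply: lee_sum => M _.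
  rewrite -(fineK (Xfin M)) poweR_EFin -EFinM lee_fin /nu powRM ?fine_ge0 // mulrC.
  rewrite ler_wpM2r ?powR_ge0 //; by apply: ge1r_powR => //; lra.
have nu1 M : nu M <= 1.
  have : nu M `^ th <= 1.
    apply: le_trans (Snu M.+1); rewrite big_ord_recr /= lerDr sumr_ge0 // => k _.
    exact: powR_ge0.
  rewrite !leNgt; apply: contra => n1; have : 1 `^ th < nu M `^ th.
    by apply: gt0_ltr_powR; rewrite ?nnegrE.
  by rewrite powR1.
have nu01 M : 0 <= nu M <= 1 by rewrite nu0 nu1.
exists nu; split => //.
- move=> M; have -> : ((2 ^+ M.+1)%:E * modsmooth I 2 1 f (2 ^- M.+1) = 2%:E * X M)%E.
    by rewrite /X muleA -EFinM -exprS.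
  rewrite -(fineK (Xfin M)) -EFinM lee_fin /nu; lra.
- by move=> N; case: (sum_sqr_le_powR nu01 th1 (Snu N)).
- by move=> N; case: (sum_sqr_le_powR nu01 th1 (Snu N)).
Qed.

End BesovSequence.

(** * From coefficients to L_q-norms *)

Section UpperTools.
Variable R : realType.
Notation mu := (@lebesgue_measure R).
Notation L1 g := (mu.-integrable setT (EFin \o g)).
Implicit Types (f g : R -> R) (i j k M p : nat).

(** [dyadic_growth] at every level, then the limit over levels. The mean is required to vanish
    because [del] is zero on constants. *)
Lemma integral_expr_le_del g p (eps : nat -> R) (T : R) :
  L1 g -> avg g 0 0 = 0 -> (forall k, 0 <= eps k) ->
  (forall k, \sum_(j < 2 ^ k) (2 ^ k)%:R^-1 * (del g k j ^+ 2) ^+ p.+1 <= eps k ^+ p.+1) ->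
  (forall M, \sum_(k < M) eps k <= T) ->
  (\int[mu]_(x in `[0%R, 1%R[) ((g x ^+ 2) ^+ p.+1)%:E <=
     (((1 + 4 * p.+1%:R) * T) ^+ p.+1)%:E)%E.
Proof.
move=> gi g0 eps0 Heps ST; apply: integral_expr_le_avg => // M.
apply: le_trans (dyadic_growth (fun k j => avg_even k j gi) (fun k j => avg_odd k j gi) _ _ g0 eps0 Heps M) _.
- by move=> k j; rewrite /= addrC subrK.
- by [].
have C0 : 0 <= 1 + 4 * p.+1%:R :> R by ge0.
have S0 : 0 <= \sum_(i < M.+1) eps i by apply: sumr_ge0.
have T0 : 0 <= T by exact: le_trans S0 (ST _).
apply: lerXn2r; rewrite ?nnegrE ?mulr_ge0 //.
by rewrite ler_wpM2l.
Qed.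

(** In place of Hölder, split pointwise at |g| = B: below, |g|^q <= B^q; above, |g|^q <= B^(q - 2p)
    |g|^(2p). Each part integrates to at most B^q, whence the factor 2. The endpoint 1 is a null
    set. *)
Lemma LpNorm_le_even f g p (q B : R) : 0 < B -> 2 < q -> q <= 2 * p%:R -> measurable_fun setT g ->
  measurable_fun (`[0%R, 1%R] : set R) f -> (forall x : R, 0 <= x < 1 -> f x = g x) ->
  (\int[mu]_(x in `[0%R, 1%R[) ((g x ^+ 2) ^+ p)%:E <= ((B ^+ 2) ^+ p)%:E)%E ->
  (LpNorm `[0%R, 1%R] q f <= (2 * B)%:E)%E.
Proof.
move=> B0 q2 qp mg mf fg Hg; have q0 : 0 < q by lra.
have Bq : 0 < B `^ q by exact: powR_gt0.
have pt (x : R) : 0 <= x < 1 -> `|f x| `^ q <= B `^ q + B `^ (q - 2 * p%:R) * (g x ^+ 2) ^+ p.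
  move=> /fg ->; have e0 : 0 <= (g x ^+ 2) ^+ p by ge0.
  have [gB|/ltW Bg] := lerP `|g x| B.
    rewrite ler_wpDr ?mulr_ge0 ?powR_ge0 //.
    by apply: ge0_ler_powR; rewrite ?nnegrE ?(ltW q0) ?(ltW B0).
  rewrite ler_wpDl ?powR_ge0 //.
  have gp : 0 < `|g x| by apply: lt_le_trans Bg.
  have -> : (g x ^+ 2) ^+ p = `|g x| `^ (2 * p%:R).
    by rewrite -natrM powR_mulrn // exprM real_normK ?num_real.
  have -> : `|g x| `^ q = `|g x| `^ (q - 2 * p%:R) * `|g x| `^ (2 * p%:R).
    by rewrite -powRD ?subrK // (gt_eqF gp) implybT.
  rewrite ler_wpM2r ?powR_ge0 // -opprB !powRN lef_pV2 ?posrE ?powR_gt0 //.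
  by apply: ge0_ler_powR; rewrite ?subr_ge0 ?nnegrE ?(ltW B0).
have Hint : (\int[mu]_(x in `[0%R, 1%R]) (`|f x| `^ q)%:E <= (2 * B `^ q)%:E)%E.
  have mfq : measurable_fun (`[0%R, 1%R] : set R) (fun x => (`|f x| `^ q)%:E).
    apply/measurable_EFinP; apply: (measurableT_comp (measurable_powR q)).
    by apply: measurableT_comp.
  rewrite -integral_itv_bndo_bndc; last first.
    by apply: measurable_funS mfq => // x; rewrite /= !in_itv /= => /andP[-> /ltW ->].
  apply: (@le_trans _ _ (\int[mu]_(x in `[0%R, 1%R[)
     ((B `^ q)%:E + (B `^ (q - 2 * p%:R))%:E * ((g x ^+ 2) ^+ p)%:E))%E).
    apply: ge0_integral_mono => x; first by rewrite lee_fin powR_ge0.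
    by rewrite /= in_itv /= -EFinM -EFinD lee_fin => /pt.
  have mF : measurable_fun (`[0%R, 1%R[ : set R) (fun x => ((g x ^+ 2) ^+ p)%:E).
    by apply/measurable_EFinP/measurable_funX/measurable_funX; exact: measurable_funTS.
  rewrite ge0_integralD //=; last 3 first.
  - by move=> x _; rewrite lee_fin powR_ge0.
  - by move=> x _; apply: mule_ge0; rewrite lee_fin ?powR_ge0 //; ge0.
  - by apply: emeasurable_funM => //; exact: measurable_cst.
  rewrite integral_cst //= ge0_integralZl //; last 2 first.
  - by move=> x _; rewrite lee_fin; ge0.
  - by rewrite lee_fin powR_ge0.
  rewrite [X in (_ * X + _)%E]lebesgue_measure_itv /= lte_fin ltr01 sube0 mule1.
  rewrite [2 * B `^ q]mulr_natl mulr2n EFinD; apply: leeD => //.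
  apply: (@le_trans _ _ ((B `^ (q - 2 * p%:R))%:E * ((B ^+ 2) ^+ p)%:E)%E).
    by apply: lee_pmul; rewrite ?lee_fin ?powR_ge0 //; apply: integral_ge0 => x _; rewrite lee_fin; ge0.
  rewrite -EFinM lee_fin -exprM -(powR_mulrn (2 * p) (ltW B0)) natrM -powRD ?subrK //.
  by rewrite (gt_eqF B0) implybT.
rewrite /LpNorm; apply: (@le_trans _ _ ((2 * B `^ q)%:E `^ q^-1)%E).
  apply: poweR_le => //; first by rewrite invr_ge0 ltW.
  by apply: integral_ge0 => x _; rewrite lee_fin powR_ge0.
rewrite poweR_EFin lee_fin powRM ?(ltW Bq) // -powRrM mulfV ?gt_eqF // powRr1 ?(ltW B0) //.
rewrite ler_wpM2r ?(ltW B0) //; apply: ler1_powR; first lra.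
by rewrite invf_le1 //; lra.
Qed.

End UpperTools.

(** The l_1-ball is the convex hull of the signed unit vectors, so by convexity of the even power a
    common bound E on the columns w _ y passes to every combination of total mass S. *)
Lemma sum_even_power_combination (R : realFieldType) (I J : finType) p (a E S : R)
    (d : I -> R) (w : J -> I -> R) :
  0 <= a -> 0 <= E -> \sum_y `|d y| <= S ->
  (forall y, \sum_j a * (w j y ^+ 2) ^+ p.+1 <= E) ->
  \sum_j a * ((\sum_y d y * w j y) ^+ 2) ^+ p.+1 <= (S ^+ 2) ^+ p.+1 * E.
Proof.
move=> a0 E0 dS wE; have S0 : 0 <= S by apply: le_trans dS; apply: sumr_ge0.
have evenE (x : R) : (x ^+ 2) ^+ p.+1 = `|x| ^+ (2 * p).+2.
  by rewrite -[(2 * p).+2]/(2 + 2 * p)%N -mulnS exprM real_normK ?num_real.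
apply: (@le_trans _ _ (\sum_j a * (S ^+ (2 * p).+1 * \sum_y `|d y| * (w j y ^+ 2) ^+ p.+1))).
  apply: ler_sum => j _; rewrite ler_wpM2l // evenE.
  apply: (@le_trans _ _ ((\sum_y `|d y| * `|w j y|) ^+ (2 * p).+2)).
    rewrite lerXn2r ?nnegrE ?sumr_ge0 //.
    by apply: le_trans (ler_norm_sum _ _ _) _; apply: ler_sum => y _; rewrite normrM.
  have := @exprn_sum_le _ _ (index_enum I) xpredT (fun y => `|d y|) (fun y => `|w j y|)
    (2 * p).+1 S (fun _ _ => normr_ge0 _) (fun _ _ => normr_ge0 _) dS.
  by under [X in _ <= _ * X -> _]eq_bigr do rewrite -evenE.
have -> : \sum_j a * (S ^+ (2 * p).+1 * \sum_y `|d y| * (w j y ^+ 2) ^+ p.+1) =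
    S ^+ (2 * p).+1 * \sum_y `|d y| * \sum_j a * (w j y ^+ 2) ^+ p.+1.
  rewrite -!mulr_sumr mulrCA; congr (_ * _); rewrite mulr_sumr.
  under eq_bigr do rewrite mulr_sumr.
  rewrite exchange_big /=; apply: eq_bigr => y _; rewrite mulr_sumr.
  by apply: eq_bigr => j _; rewrite mulrCA.
apply: (@le_trans _ _ (S ^+ (2 * p).+1 * \sum_y `|d y| * E)).
  by rewrite ler_wpM2l ?exprn_ge0 //; apply: ler_sum => y _; rewrite ler_wpM2l.
rewrite evenE ger0_norm // [S ^+ (2 * p).+2]exprSr -mulrA ler_wpM2l ?exprn_ge0 //.
by rewrite -mulr_suml ler_wpM2r.
Qed.

(** * The approximating subspace and its error *)

Section Approximants.
Variable R : realType.
Notation mu := (@lebesgue_measure R).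
Notation L1 g := (mu.-integrable setT (EFin \o g)).
Implicit Types (g : R -> R) (i j k m M N p : nat).

Lemma avg_indic00 k m : (m < 2 ^ k)%N -> avg (\1_(cell 0 0) : R -> R) k m = 1.
Proof.
move=> mk; rewrite -[RHS](avg_cst 1 k m) /avg; congr (_ * _).
apply: eq_Rintegral => x /set_mem xm; rewrite indicE mem_set //.
by have := cell_parent (i := 0) (d := k) xm; rewrite divn_small.
Qed.

Lemma del_indic00 k m : (m < 2 ^ k)%N -> del (\1_(cell 0 0) : R -> R) k m = 0.
Proof.
have h k' m' : (m' < 2 ^ k')%N -> hdiff (\1_(cell 0 0) : R -> R) k' m' = 0.
  by move=> mk; rewrite /hdiff !avg_indic00 ?subrr // expnS; lia.
case: k => [|k] mk; rewrite /del ?h ?mul0r ?subrr //.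
by move: mk; rewrite expnS; lia.
Qed.

Lemma L1_indic00 : L1 (\1_(cell 0 0) : R -> R).
Proof.
apply: (@L1_bounded _ _ 0 1 1) => [|x]; first exact: measurable_indic.
rewrite mul1r !indicE ger0_norm ?ler0n // ler_nat.
case: (boolP (x \in cell 0 0)) => // /set_mem x0.
by rewrite mem_set //; apply: (@cell_sub01 R 0 0).
Qed.

Definition zeta_comb i (c : 'I_(2 ^ i) -> R) (x : R) : R := \sum_(j < 2 ^ i) c j * zeta i j x.

Lemma L1_zeta_comb i c : L1 (@zeta_comb i c).
Proof. by apply: L1_sum => j _; apply: L1Z; exact: L1_zeta. Qed.

Lemma measurable_zeta_comb i c : measurable_fun setT (@zeta_comb i c).
Proof.
by apply: measurable_sum => j; apply: measurable_funM => //; exact: measurable_zeta.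
Qed.

Lemma avg_zeta_comb0 i c : avg (@zeta_comb i c) 0 0 = 0.
Proof.
rewrite /zeta_comb avg_sum; last by move=> j _; apply: L1Z; exact: L1_zeta.
rewrite big1 // => j _; rewrite avgZ; last exact: L1_zeta.
by have := avg_zeta_coarse R 0 (ltn_ord j) (leqnn i); rewrite subnn => ->; rewrite mulr0.
Qed.

Lemma del_zeta_comb i c k m : k != i -> del (@zeta_comb i c) k m = 0.
Proof.
move=> ki; rewrite /zeta_comb del_sum; last by move=> j _; apply: L1Z; exact: L1_zeta.
rewrite big1 // => j _; rewrite delZ; last exact: L1_zeta.
by rewrite del_zeta // (negbTE ki) mulr0.
Qed.

Lemma del_zeta_comb_eq i c (m : 'I_(2 ^ i)) : del (@zeta_comb i c) i m = c m.
Proof.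
rewrite /zeta_comb del_sum; last by move=> j _; apply: L1Z; exact: L1_zeta.
rewrite (bigD1 m) //= big1 => [|j jm].
  by rewrite addr0 delZ ?del_zeta ?eqxx ?mulr1 //; exact: L1_zeta.
rewrite delZ; last exact: L1_zeta.
by rewrite del_zeta // eqxx /= (eq_sym (val m)) val_eqE (negbTE jm) mulr0.
Qed.

Lemma zeta_comb_bound i c (x : R) : `|@zeta_comb i c x| <= \sum_j `|c j|.
Proof.
apply: le_trans (ler_norm_sum _ _ _) _; apply: ler_sum => j _.
by rewrite normrM ler_piMr // (le_trans (zeta_bound _ _ _)) // indicE lern1; case: (_ \in _).
Qed.

(* The approximants at level i < K are the images of rank n1 of the level-i coefficients,
   so that at levels k >= K the coefficients of G are left unchanged. *)
Lemma exists_approximants p K n1 :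
  exists Phi : unit + 'I_K * 'I_n1 -> R -> R,
  (forall u, [/\ L1 (Phi u), measurable_fun setT (Phi u) & exists B, forall x, `|Phi u x| <= B]) /\
  forall (G : R -> R) (S : nat -> R) (r T : R), L1 G -> (forall k, 0 <= S k) ->
  (forall k, \sum_(j < 2 ^ k) `|del G k j| <= S k) -> 0 <= r -> r ^+ p.+1 = 2^-1 ->
  (forall M, \sum_(k < M) S k ^+ 2 *
     (if (k < K)%N then (1 + 4 * p.+1%:R) / (maxn 1 n1)%:R else r ^+ k) <= T) ->
  exists c, (\int[mu]_(x in `[0%R, 1%R[) (((G x - \sum_u c u * Phi u x) ^+ 2) ^+ p.+1)%:E <=
     (((1 + 4 * p.+1%:R) * T) ^+ p.+1)%:E)%E.
Proof.
pose L i := low_rank_identity R i p n1.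
have [g [h gh]] : exists (g h : forall i, 'I_n1 -> 'I_(2 ^ i) -> R), forall i y,
    \sum_(x < 2 ^ i) (2 ^ i)%:R^-1 * (((x == y)%:R - \sum_t g i t x * h i t y) ^+ 2) ^+ p.+1
      <= ((1 + 4 * p.+1%:R) / (maxn 1 n1)%:R) ^+ p.+1.
  exists (fun i => sval (cid (L i))), (fun i => sval (cid (svalP (cid (L i))))) => i.
  exact: svalP (cid (svalP (cid (L i)))).
(* The indicator of [0, 1[ carries the mean, which [del] does not see; the pair (i, t) carries the
   t-th rank-one piece at level i. *)
pose Phi (u : unit + 'I_K * 'I_n1) : R -> R :=
  match u with inl _ => \1_(cell 0 0) | inr v => zeta_comb (g v.1 v.2) end.
exists Phi; split.
  case=> [[]|v]; split.
  - exact: L1_indic00.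
  - exact: measurable_indic.
  - by exists 1 => x; rewrite /= indicE ger0_norm ?ler0n // lern1; case: (_ \in _).
  - exact: L1_zeta_comb.
  - exact: measurable_zeta_comb.
  - by exists (\sum_j `|g v.1 v.2 j|) => x; exact: zeta_comb_bound.
move=> G S r T GL S0 dS r0 rP ST.
pose c (u : unit + 'I_K * 'I_n1) : R :=
  match u with inl _ => avg G 0 0 | inr v => \sum_y h v.1 v.2 y * del G v.1 y end.
exists c.
pose Y (x : R) := avg G 0 0 * \1_(cell 0 0) x +
  \sum_(v : 'I_K * 'I_n1) c (inr v) * zeta_comb (g v.1 v.2) x.
pose Z (x : R) := G x + - 1 * Y x.
have ZE (x : R) : G x - \sum_u c u * Phi u x = Z x.
  rewrite /Z mulN1r; congr (_ - _); rewrite big_sumType /=; congr (_ + _).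
  by rewrite big_const /= card_unit /= addr0.
under eq_integral do rewrite ZE.
have zl v : L1 (fun x => c (inr v) * zeta_comb (g v.1 v.2) x).
  by apply: L1Z; exact: L1_zeta_comb.
have YL : L1 Y.
  by apply: L1D; [apply: L1Z; exact: L1_indic00|apply: L1_sum => v _; exact: zl].
have ZL : L1 Z by apply: L1D => //; exact: L1Z.
(* The squared normalised norm of a column of the residual matrix at level k: the low-rank error
   below K, and beyond K that of a unit vector, since (r^k)^(p+1) = 2^-k. *)
pose e k := if (k < K)%N then (1 + 4 * p.+1%:R) / (maxn 1 n1)%:R else r ^+ k.
have e0 k : 0 <= e k by rewrite /e; case: ifP => _; ge0.
(* By duality of [zeta] and [del], the coefficients of the residual are those of G multiplied by the
   identity minus its low-rank approximation. *)
have delZE k (j : 'I_(2 ^ k)) : del Z k j = \sum_(y < 2 ^ k) del G k y *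
   ((j == y)%:R - (if (k < K)%N then \sum_t g k t j * h k t y else 0)).
  rewrite /Z delD // ?delZ //; last exact: L1Z.
  rewrite /Y delD ?delZ; last 3 first.
  - exact: L1_indic00.
  - by apply: L1Z; exact: L1_indic00.
  - by apply: L1_sum => v _; exact: zl.
  rewrite del_indic00 // mulr0 add0r del_sum => [|v _]; last exact: zl.
  have dz v : del (fun x => c (inr v) * zeta_comb (g v.1 v.2) x) k j =
      c (inr v) * del (zeta_comb (g v.1 v.2)) k j.
    by rewrite delZ //; exact: L1_zeta_comb.
  rewrite (eq_bigr _ (fun v _ => dz v)).
  have -> : \sum_(y < 2 ^ k) del G k y * ((j == y)%:R - (if (k < K)%N then \sum_t g k t j * h k t y else 0))
     = del G k j - \sum_(y < 2 ^ k) del G k y * (if (k < K)%N then \sum_t g k t j * h k t y else 0).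
    under eq_bigr do rewrite mulrBr.
    rewrite sumrB; congr (_ - _); rewrite (bigD1 j) //= eqxx mulr1 big1 ?addr0 // => y yj.
    by rewrite eq_sym (negbTE yj) mulr0.
  rewrite mulN1r; congr (_ - _).
  rewrite -(pair_bigA _ (fun (i : 'I_K) (t : 'I_n1) => c (inr (i, t)) * del (zeta_comb (g i t)) k j)) /=.
  case: (ltnP k K) => [kK|kK]; last first.
    rewrite [RHS]big1; last by move=> y _; rewrite mulr0.
    rewrite big1 // => i _; rewrite big1 // => t _; rewrite del_zeta_comb ?mulr0 //.
    by rewrite gtn_eqF // (leq_trans (ltn_ord i)).
  rewrite (bigD1 (Ordinal kK)) //= [X in _ + X]big1 ?addr0 => [|i ik]; last first.
    rewrite big1 // => t _; rewrite del_zeta_comb ?mulr0 //.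
    by apply: contraNneq ik => ki; apply/eqP/val_inj.
  under eq_bigr do rewrite del_zeta_comb_eq mulr_suml.
  rewrite exchange_big /=; apply: eq_bigr => y _; rewrite mulr_sumr.
  by apply: eq_bigr => t _; ring.
apply: (integral_expr_le_del (eps := fun k => S k ^+ 2 * e k)) => //.
- rewrite /Z avgD // ?avgZ //; last exact: L1Z.
  rewrite /Y avgD ?avgZ; last 3 first.
  - exact: L1_indic00.
  - by apply: L1Z; exact: L1_indic00.
  - by apply: L1_sum => v _; exact: zl.
  rewrite avg_indic00 // mulr1 avg_sum => [|v _]; last exact: zl.
  rewrite big1 => [|v _]; first by rewrite addr0 mulN1r subrr.
  by rewrite avgZ ?avg_zeta_comb0 ?mulr0 //; exact: L1_zeta_comb.
- by move=> k; apply: mulr_ge0 => //; exact: sqr_ge0.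
- move=> k; under eq_bigr do rewrite delZE.
  rewrite [leRHS]exprMn; apply: sum_even_power_combination.
  + by rewrite invr_ge0.
  + exact: exprn_ge0.
  + exact: dS.
  move=> y.
  rewrite /e; case: ifPn => _; first exact: gh.
  rewrite (bigD1 y) //= big1 => [|j jy]; last first.
    by rewrite (negbTE jy) subr0 !expr0n /= mulr0.
  rewrite eqxx subr0 !expr1n mulr1 addr0 -exprM mulnC exprM rP exprVn natrX //.
Qed.

End Approximants.

(** * Width from finite families, and coefficients of Besov functions *)

Section UpperBound.
Variable R : realType.
Notation mu := (@lebesgue_measure R).
Notation I01 := (`[0%R, 1%R]%classic : set R).
Notation L1 g := (mu.-integrable setT (EFin \o g)).
Implicit Types (f g : R -> R) (i j k M N n : nat).

(** The width takes exactly n generators: J is enumerated and padded with zero functions, which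
    therefore must lie in L_q. *)
Lemma kolmogorov_width_le (D : set R) (q : R) (F : set (R -> R)) n (J : finType)
    (Phi : J -> R -> R) (B : \bar R) :
  (#|J| <= n)%N -> (forall u, inLp D q (Phi u)) -> inLp D q (fun => 0) ->
  (forall f, F f -> exists c, (LpNorm D q (fun x => f x - \sum_u c u * Phi u x)%R <= B)%E) ->
  (kolmogorov_width D q F n <= B)%E.
Proof.
move=> Jn PhiL zL H.
pose g (i : 'I_n) : R -> R :=
  if insub (val i) is Some v then Phi (enum_val (v : 'I_#|J|)) else fun => 0.
apply: le_trans (ereal_inf_lbound _) _.
  by exists g => //= i; rewrite /g; case: insub.
apply: ge_ereal_sup => _ [f /= Ff <-]; have [c Hc] := H f Ff.
apply: le_trans (ereal_inf_lbound _) Hc.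
exists (fun i : 'I_n => if insub (val i) is Some v then c (enum_val (v : 'I_#|J|)) else 0) => //=.
congr LpNorm; apply/funext => x; congr (_ - _).
pose G (i : nat) : R := if insub i is Some v then
  c (enum_val (v : 'I_#|J|)) * Phi (enum_val v) x else 0.
transitivity (\sum_(i < n) G i).
  by apply: eq_bigr => i _; rewrite /G /g; case: insub => // ; rewrite mul0r.
rewrite -(big_mkord xpredT G) (big_cat_nat _ Jn) //= [X in _ + X]big_nat_cond [X in _ + X]big1 => [|i].
  rewrite addr0 big_mkord (reindex (@enum_val J J)) /=; last exact: onW_bij (enum_val_bij _).
  apply: eq_bigr => i _; rewrite /G insubT //= => h.
  have -> : (Sub (val i) h : 'I_#|J|) = i by apply: val_inj.
  by [].
move=> /andP[/andP[h _] _]; rewrite /G insubF //; apply/negbTE; by rewrite -leqNgt.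
Qed.

Lemma besov_semi_ge0 (I : set R) theta f : (0 <= besov_semi I 1 1 theta f)%E.
Proof.
rewrite /besov_semi; case: theta => [th| |]; first exact: poweR_ge0.
all: apply: (@le_trans _ _ ((1 `^ (-1))%:E * modsmooth I (besov_s (1 : R)) 1 f 1)%E);
  [by apply: mule_ge0; rewrite ?lee_fin ?powR_ge0 //; exact: modsmooth_ge0 |
   by apply: ereal_sup_ubound; exists 1 => //=; rewrite in_itv /= ltr01].
Qed.

Lemma inLp_bounded (q : R) f (B : R) : 0 < q -> measurable_fun I01 f ->
  (forall x, `|f x| <= B) -> inLp I01 q f.
Proof.
move=> q0 mf fB; split => //; apply: poweR_lty.
have B0 : 0 <= B by apply: le_trans (fB 0).
apply: (@le_lt_trans _ _ (\int[mu]_(x in I01) (B `^ q)%:E)%E).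
  apply: ge0_integral_mono => x _; rewrite lee_fin ?powR_ge0 //.
  by apply: ge0_ler_powR; rewrite ?nnegrE ?(ltW q0).
rewrite integral_cst //= [X in (_ * X)%E]lebesgue_measure_itv /= lte_fin ltr01 sube0 mule1.
exact: ltry.
Qed.

Lemma geometric_sum_le (r : R) M : 0 <= r < 1 -> \sum_(k < M) r ^+ k <= (1 - r)^-1.
Proof.
move=> /andP[r0 r1]; have r1' : 0 < 1 - r by rewrite subr_gt0.
rewrite -[leRHS]mul1r ler_pdivlMr //.
have -> : (\sum_(k < M) r ^+ k) * (1 - r) = 1 - r ^+ M.
  elim: M => [|M IH]; first by rewrite big_ord0 mul0r expr0 subrr.
  by rewrite big_ord_recr /= mulrDl IH exprSr; ring.
by rewrite gerBl exprn_ge0.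
Qed.

(** On [diff_dom] the three evaluation points stay in [0, 1], so the jumps created by the extension
    by zero are never seen. *)
Lemma patch01_fdiff f (h : R) : 0 <= h ->
  LpNorm (diff_dom I01 2 h) 1 (fdiff 2 h (f \_ I01)) =
  LpNorm (diff_dom I01 2 h) 1 (fdiff 2 h f).
Proof.
move=> h0; rewrite !LpNorm1; apply: eq_integral => x /set_mem[].
rewrite /= !in_itv /= => /andP[x0 x1] /andP[y0 y1].
rewrite !fdiff2 !patchE !mem_set //= in_itv /=; apply/andP; split; lra.
Qed.

Lemma L1_patch01 f : measurable_fun I01 f -> (LpNorm I01 1 f < +oo)%E ->
  L1 (f \_ I01).
Proof.
move=> mf; rewrite LpNorm1 => fin.
have fi : mu.-integrable I01 (EFin \o f).
  apply/integrableP; split => //; exact/measurable_EFinP.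
have mI : measurable (I01 : set (measurableTypeR R)) by exact: measurable_itv.
have := (@integrable_mkcond _ _ _ mu I01 (EFin \o f) mI).1 fi.
by rewrite restrict_EFin.
Qed.

Lemma sum_del_patch01 theta f : (1 <= theta)%E -> besov_class I01 1 1 theta f ->
  let G := f \_ I01 in exists nu : nat -> R,
  [/\ L1 G, forall k, 0 <= nu k <= 1,
    forall k, \sum_(j < 2 ^ k) `|del G k j| <= 4 * (if k is k'.+1 then nu k'.+1 else 1),
    forall N, (theta <= 2%:E)%E -> \sum_(M < N) nu M ^+ 2 <= 1 &
    forall N, (2%:E <= theta)%E -> (0 < N)%N ->
      \sum_(M < N) nu M ^+ 2 <= 2 * N%:R `^ (1 - 2 * inv_theta theta)].
Proof.
move=> th1 [mf [fin f1]] G.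
have semi1 : (besov_semi I01 1 1 theta f <= 1)%E.
  by apply: le_trans f1; rewrite leeDr // LpNorm_ge0.
have norm1 : (LpNorm I01 1 f <= 1)%E.
  by apply: le_trans f1; rewrite leeDl // besov_semi_ge0.
have [nu [nu01 nuL nu2 nu2']] := besov_semi_sequence th1 semi1.
have GL : L1 G by exact: L1_patch01.
(* Level 0 is a first difference and is bounded by the L_1-norm; from level 1 on, [del] at level
   k.+1 uses the step 2^-(k.+2), which is the one measured by nu k.+1. *)
exists nu; split => // -[|k].
  have -> : \sum_(j < 2 ^ 0) `|del G 0 j| = `|avg G 1 1 - avg G 1 0|.
    by rewrite expn0 big_ord1.
  rewrite mulr1; apply: le_trans (ler_normB _ _) _.
  rewrite /avg !normrM (ger0_norm (_ : 0 <= 2 ^+ 1)) // -mulrDr expr1.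
  suff : `|\int[mu]_(x in cell 1 1) G x| + `|\int[mu]_(x in cell 1 0) G x| <= 1 by lra.
  rewrite -lee_fin EFinD; apply: le_trans (leeD (normr_Rintegral_cell _ _ GL) (normr_Rintegral_cell _ _ GL)) _.
  apply: le_trans norm1; rewrite LpNorm1.
  have := @sum_cell_integral_le R 1 2 xpredT (fun x => `|G x|%:E) I01 (L1_measurable_norm GL).
  rewrite !big_ord_recl big_ord0 /= adde0 addeC => H.
  apply: (le_trans (H _ _)) => //; first by move=> j j2 _; exact: cell_sub01.
  rewrite le_eqVlt; apply/predU1P; left; apply: eq_integral => x x01.
  by rewrite /G patchE x01.
rewrite -lee_fin; apply: le_trans (sum_del_le k GL) _; apply: le_trans (nuL k.+1).
rewrite patch01_fdiff ?invr_ge0 //.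
by apply: lee_pmul; rewrite ?lee_fin ?LpNorm_ge0 //; apply: modsmooth_ge; rewrite ?invr_gt0.
Qed.

End UpperBound.

(** * Upper bound in terms of the number of levels *)

Section UpperWidth.
Variable R : realType.
Notation mu := (@lebesgue_measure R).
Notation I01 := (`[0%R, 1%R]%classic : set R).
Notation L1 g := (mu.-integrable setT (EFin \o g)).
Implicit Types (f g : R -> R) (k m M N p n : nat).

(** Past level K the terms form a geometric series whose first term r^K is at most rho. *)
Lemma sum_split_levels (s : nat -> R) (r E W rho : R) K M :
  (forall k, 0 <= s k) -> 0 <= E -> 0 <= r < 1 -> r ^+ K <= rho ->
  (forall k, s k <= 1) -> \sum_(k < K) s k <= W ->
  \sum_(k < M) s k * (if (k < K)%N then E else r ^+ k) <= E * W + rho / (1 - r).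
Proof.
move=> s0 E0 /andP[r0 r1] rK s1 sW.
have t0 k : 0 <= s k * (if (k < K)%N then E else r ^+ k).
  by apply: mulr_ge0 => //; case: ifP => // _; exact: exprn_ge0.
apply: (@le_trans _ _ (\sum_(k < K + M) s k * (if (k < K)%N then E else r ^+ k))).
  pose F k := s k * (if (k < K)%N then E else r ^+ k).
  rewrite -(big_mkord xpredT F) -(big_mkord xpredT F) [leRHS](@big_cat_nat _ _ _ M) ?leq_addl //=.
  by rewrite lerDl sumr_ge0 // => k _; exact: t0.
rewrite big_split_ord /=; apply: lerD.
  apply: (@le_trans _ _ (\sum_(k < K) s k * E)).
    by apply: ler_sum => k _; rewrite ltn_ord.
  by rewrite -mulr_suml mulrC ler_wpM2l.
apply: (@le_trans _ _ (\sum_(k < M) r ^+ K * r ^+ k)).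
  apply: ler_sum => k _; rewrite ltnNge leq_addr /= exprD.
  by rewrite ler_piMl // mulr_ge0 ?exprn_ge0.
have rr : 0 <= r < 1 by rewrite r0.
rewrite -mulr_sumr; apply: ler_pM => //; first exact: exprn_ge0.
  by apply: sumr_ge0 => k _; exact: exprn_ge0.
exact: geometric_sum_le.
Qed.

(** One dimension goes to the mean and the other n - 1 are shared equally among K levels. If n <= K
    the share is zero, and the max keeps the second bound true. *)
Lemma rank_count n K : (1 < n)%N -> (0 < K)%N ->
  (1 + K * ((n - 1) %/ K) <= n)%N /\ (n <= 2 * K * maxn 1 ((n - 1) %/ K))%N.
Proof.
move=> n2 K0; have h1 := leq_trunc_div (n - 1) K; have h2 := ltn_ceil (n - 1) K0.
move: h1 h2; set m := ((n - 1) %/ K)%N => h1 h2; split; first by rewrite mulnC; lia.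
have h3 : (m.+1 <= 2 * maxn 1 m)%N by lia.
apply: leq_trans (_ : m.+1 * K <= _)%N; first lia.
by rewrite mulnAC mulnC [leqRHS]mulnC leq_mul2l h3 orbT.
Qed.

Lemma upper_width (q : R) : 2 < q -> exists p (D : R), 0 < D /\
  forall (theta : \bar R) n (W : R), let K := (p.+1 * (trunc_log 2 n).+1)%N in
  (1 <= theta)%E -> (2 <= n)%N -> 0 <= W ->
  (forall nu : nat -> R, (forall M, 0 <= nu M <= 1) ->
    (forall N, (theta <= 2%:E)%E -> \sum_(M < N) nu M ^+ 2 <= 1) ->
    (forall N, (2%:E <= theta)%E -> (0 < N)%N ->
      \sum_(M < N) nu M ^+ 2 <= 2 * N%:R `^ (1 - 2 * inv_theta theta)) ->
    \sum_(M < K) nu M ^+ 2 <= W) ->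
  (kolmogorov_width I01 q (besov_class I01 1 1 theta) n <=
    (D * Num.sqrt (K%:R * (1 + W) / n%:R))%:E)%E.
Proof.
move=> q2; have q0 : 0 < q by lra.
pose p := Num.truncn q; have qp : q <= 2 * p.+1%:R.
  have := truncnS_gt q; rewrite -/p => h; have : 0 <= p.+1%:R :> R by []. lra.
(* Chosen so that r^k is the squared normalised l_{2(p+1)}-norm of a unit vector of R^(2^k). *)
pose r : R := 2 `^ (- p.+1%:R^-1).
have P0 : 0 < p.+1%:R :> R by rewrite ltr0n.
have r0 : 0 < r by exact: powR_gt0.
have rP : r ^+ p.+1 = 2^-1.
  by rewrite -powR_mulrn ?(ltW r0) // -powRrM mulNr mulVf ?gt_eqF // powR_inv1.
have r1 : r < 1.
  rewrite ltNge; apply/negP => r1; have := exprn_ege1 p.+1 r1; rewrite rP; lra.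
have rr : 0 <= r < 1 by rewrite (ltW r0).
pose C : R := 1 + 4 * p.+1%:R; have C1 : 1 <= C by rewrite /C lerDl; ge0.
have C0 : 0 < C by lra.
(* The 16 is the square of the 4 in [sum_del_patch01]; 32 contains in addition the 2 of
   [rank_count], and 1 / (1 - r) sums the tail. *)
pose D1 : R := 32 * C + 16 / (1 - r).
have D10 : 0 < D1.
  by rewrite /D1 addr_gt0 ?divr_gt0 ?subr_gt0 // mulr_gt0 //; lra.
exists p, (2 * Num.sqrt (C * D1)); split.
  by rewrite mulr_gt0 // sqrtr_gt0 mulr_gt0 //; lra.
move=> theta n W K th1 n2 W0 HW.
have n0 : 0 < n%:R :> R by rewrite ltr0n (leq_trans _ n2).
have K0 : (0 < K)%N by rewrite /K muln_gt0.
pose n1 := ((n - 1) %/ K)%N.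
have [Kn1 nK] := rank_count n2 K0.
have [Phi [PhiP approx]] := exists_approximants R p K n1.
pose B : R := Num.sqrt (C * D1 * (K%:R * (1 + W) / n%:R)).
have KR : 1 <= K%:R :> R by rewrite ler1n.
have KR0 : 0 < K%:R :> R by rewrite ltr0n.
have W1p : 0 < 1 + W by lra.
have B2 : 0 < C * D1 * (K%:R * (1 + W) / n%:R).
  by rewrite mulr_gt0 ?(mulr_gt0 C0 D10) // divr_gt0 // mulr_gt0.
have B0 : 0 < B by rewrite sqrtr_gt0.
have -> : 2 * Num.sqrt (C * D1) * Num.sqrt (K%:R * (1 + W) / n%:R) = 2 * B.
  by rewrite -mulrA -sqrtrM // ltW // mulr_gt0.
apply: (kolmogorov_width_le (Phi := Phi)).
- by rewrite card_sum card_unit card_prod !card_ord.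
- move=> u; have [_ mu_ [b Hb]] := PhiP u.
  by apply: (inLp_bounded q0 _ Hb); exact: measurable_funTS.
- by apply: (@inLp_bounded _ _ _ 0) => // x; rewrite normr0.
move=> f fB; have [nu [GL nu01 dS nu2 nu2']] := sum_del_patch01 th1 fB.
pose nu' k := if k is k'.+1 then nu k'.+1 else 1.
have nu'01 k : 0 <= nu' k <= 1 by case: k => [|k] /=; rewrite ?ler01 ?lexx.
(* The factor p.+1 in K undoes the root in r, leaving 2^-(trunc_log 2 n).+1 < 1/n. *)
have rK : r ^+ K <= n%:R^-1.
  rewrite /K exprM rP exprVn lef_pV2 ?posrE ?exprn_gt0 //.
  by rewrite -natrX ler_nat ltnW // trunc_log_ltn.
pose T := 16 * (C / (maxn 1 n1)%:R * (1 + W) + n%:R^-1 / (1 - r)).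
have ST M : \sum_(k < M) (4 * nu' k) ^+ 2 *
     (if (k < K)%N then (1 + 4 * p.+1%:R) / (maxn 1 n1)%:R else r ^+ k) <= T.
  under eq_bigr do rewrite exprMn -mulrA.
  rewrite -mulr_sumr /T (_ : 4 ^+ 2 = 16); last by rewrite expr2; lra.
  rewrite ler_pM2l //; apply: (@sum_split_levels (fun k => nu' k ^+ 2)) => //.
  - by move=> k; exact: sqr_ge0.
  - by move=> k; have /andP[h1 h2] := nu'01 k; rewrite expr_le1.
  - apply: (@le_trans _ _ (\sum_(k < K) (nu k ^+ 2) + 1)); last first.
      by rewrite addrC lerD2l; exact: HW.
    rewrite -(prednK K0) !big_ord_recl /= expr1n addrC lerD2r ler_wpDl ?sqr_ge0 //.
have S0 k : 0 <= 4 * nu' k by rewrite mulr_ge0 //; case/andP: (nu'01 k).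
have [c Hc] := approx _ (fun k => 4 * nu' k) r T GL S0 dS (ltW r0) rP ST.
have yL u : L1 (fun x => c u * Phi u x) by case: (PhiP u) => h _ _; exact: L1Z.
pose g x := (f \_ I01) x - \sum_u c u * Phi u x.
have my : measurable_fun setT (fun x => \sum_u c u * Phi u x).
  by apply: measurable_sum => u; apply: measurable_funM => //; case: (PhiP u).
have mG : measurable_fun setT (f \_ I01).
  by move/integrableP: GL => [/measurable_EFinP].
have mf : measurable_fun I01 f by case: fB.
exists c; apply: (@LpNorm_le_even R (fun x => f x - \sum_u c u * Phi u x) g p.+1 q B B0 q2 qp).
- by apply: measurable_funB.
- by apply: measurable_funB => //; exact: measurable_funTS.
- by move=> x /andP[x0 x1]; rewrite /g patchE mem_set //= in_itv /= x0 ltW.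
apply: le_trans Hc _; rewrite lee_fin.
have W1 : 1 <= 1 + W by rewrite lerDl.
have n1R : 0 < (maxn 1 n1)%:R :> R by rewrite ltr0n leq_max.
have n1inv : (maxn 1 n1)%:R^-1 <= 2 * (K%:R / n%:R) :> R.
  rewrite mulrA ler_pdivlMr // mulrC ler_pdivrMr // -!natrM ler_nat //.
have r1' : 0 < (1 - r)^-1 by rewrite invr_gt0 subr_gt0.
have T0 : 0 <= T.
  have a1 : 0 <= n%:R^-1 :> R by rewrite invr_ge0 ltW.
  have a3 : 0 <= (maxn 1 n1)%:R^-1 :> R by rewrite invr_ge0 ltW.
  apply: mulr_ge0 => //; apply: addr_ge0; last exact: mulr_ge0 (ltW r1').
  exact: mulr_ge0 (mulr_ge0 (ltW C0) a3) (ltW W1p).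
rewrite sqr_sqrtr ?(ltW B2) //; apply: lerXn2r; rewrite ?nnegrE ?(ltW B2) //.
  by rewrite -/C mulr_ge0 //; lra.
rewrite -/C -mulrA ler_wpM2l //; first lra.
have X0 : 0 <= K%:R / n%:R :> R by rewrite divr_ge0 ?(ltW n0).
have h1 : C / (maxn 1 n1)%:R * (1 + W) <= C * (2 * (K%:R / n%:R)) * (1 + W).
  by rewrite ler_wpM2r ?ler_wpM2l //; lra.
have h2 : n%:R^-1 / (1 - r) <= K%:R * (1 + W) / n%:R * (1 - r)^-1.
  rewrite ler_wpM2r ?(ltW r1') // ler_peMl ?invr_ge0 ?(ltW n0) //.
  by rewrite -[leLHS]mulr1 ler_pM.
rewrite /T /D1; move: h1 h2; rewrite -[K%:R * (1 + W) / _]mulrAC.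
move: (K%:R / n%:R) ((1 - r)^-1) => X Y h1 h2.
have -> : (32 * C + 16 * Y) * (X * (1 + W)) = 16 * (C * (2 * X) * (1 + W) + X * (1 + W) * Y) by ring.
by rewrite ler_pM2l // lerD.
Qed.

End UpperWidth.

(** * Upper bound in terms of the logarithm of n *)

Section UpperLog.
Variable R : realType.
Notation I01 := (`[0%R, 1%R]%classic : set R).

Lemma ln2_gt0 : 0 < ln (2 : R).
Proof. by apply: ln_gt0; lra. Qed.

Lemma trunc_log_ln_le n : (2 <= n)%N -> (trunc_log 2 n)%:R * ln (2 : R) <= ln n%:R.
Proof.
move=> n2; have n0 : (0 < n)%N by exact: ltn_trans n2.
have := trunc_logP (isT : (1 < 2)%N) n0; rewrite -(ler_nat R) natrX => h.
rewrite -ln_powR powR_mulrn ?ler_ln ?posrE ?exprn_gt0 ?ltr0n //.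
Qed.

Lemma ln2_le_ln n : (2 <= n)%N -> ln (2 : R) <= ln n%:R.
Proof. by move=> n2; rewrite ler_ln ?posrE ?ltr0n ?ler_nat // (leq_trans _ n2). Qed.

Lemma inv_theta_half (theta : \bar R) : (2%:E <= theta)%E -> 0 <= inv_theta theta <= 2^-1.
Proof.
case: theta => [th| |] //=; last by rewrite lexx invr_ge0 ler0n.
rewrite lee_fin => th2; have th0 : 0 < th by lra.
by rewrite invr_ge0 (ltW th0) lef_pV2 ?posrE.
Qed.

Lemma upper_bound (q : R) : 2 < q -> exists C : R, 0 < C /\
  forall (theta : \bar R) n, (1 <= theta)%E -> (2 <= n)%N ->
  let d := kolmogorov_width I01 q (besov_class I01 1 1 theta) n in
  ((theta <= 2%:E)%E -> (d <= (C * n%:R `^ (- 2^-1) * ln n%:R `^ 2^-1)%:E)%E) /\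
  ((2%:E <= theta)%E ->
    (d <= (C * n%:R `^ (- 2^-1) * ln n%:R `^ (1 - inv_theta theta))%:E)%E).
Proof.
move=> q2; have [p [D [D0 H]]] := upper_width q2.
(* The second summand already gives K <= E ln n; the 1 ensures E >= 1, hence E^a <= E for a <= 1. *)
pose E : R := 1 + 2 * p.+1%:R / ln 2.
have l2 := ln2_gt0.
have E1 : 1 <= E by rewrite /E lerDl divr_ge0 ?(ltW l2) // mulr_ge0.
pose C := D * 2 * E; have C0 : 0 < C by rewrite /C !mulr_gt0 //; lra.
exists C; split => // theta n th1 n2 d; have {}H := H theta n.
have n0 : 0 < n%:R :> R by rewrite ltr0n (leq_trans _ n2).
have ln0 : 0 < ln n%:R :> R by apply: lt_le_trans l2 _; exact: ln2_le_ln.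
set K := (p.+1 * (trunc_log 2 n).+1)%N in H.
have KE : K%:R <= E * ln n%:R.
  rewrite /K natrM (_ : (trunc_log 2 n).+1%:R = (trunc_log 2 n)%:R + 1); last by rewrite natr1.
  have h1 := trunc_log_ln_le n2; have h2 := ln2_le_ln n2.
  have h3 : (trunc_log 2 n)%:R + 1 <= 2 * (ln n%:R / ln 2) :> R.
    rewrite mulrA ler_pdivlMr // mulrDl mul1r; lra.
  apply: (@le_trans _ _ (p.+1%:R * (2 * (ln n%:R / ln (2 : R))))); first by rewrite ler_pM2l.
  have -> : E * ln n%:R = p.+1%:R * (2 * (ln n%:R / ln (2 : R))) + ln n%:R.
    by rewrite /E; move: l2; move: (ln (2 : R)) => z z0; field; rewrite gt_eqF.
  by rewrite lerDl ltW.
have K1 : 1 <= K%:R :> R by rewrite ler1n muln_gt0.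
have K0 : 0 < K%:R :> R by lra.
have nE : n%:R `^ (- 2^-1) = Num.sqrt (n%:R^-1) :> R.
  by rewrite powRN powR12_sqrt ?(ltW n0) // sqrtrV ?(ltW n0).
(* Both regimes have X = K (1 + W) <= 4 K^(2a): a = 1/2 with W = 1, and a = 1 - 1/theta with W = 2
   K^(1 - 2/theta). *)
have fin (a X : R) : 0 <= a <= 1 -> 0 <= X -> X <= 4 * K%:R `^ (2 * a) ->
    D * Num.sqrt (X / n%:R) <= C * n%:R `^ (- 2^-1) * ln n%:R `^ a.
  move=> /andP[a0 a1] X0 XK; rewrite sqrtrM // nE.
  have -> : C * Num.sqrt n%:R^-1 * ln n%:R `^ a = D * (2 * E * ln n%:R `^ a * Num.sqrt n%:R^-1).
    by rewrite /C; ring.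
  rewrite ler_pM2l // ler_wpM2r ?sqrtr_ge0 //.
  have Ka : 0 <= K%:R `^ a by exact: powR_ge0.
  apply: (@le_trans _ _ (2 * K%:R `^ a)).
    rewrite -[leRHS]ger0_norm ?mulr_ge0 // -sqrtr_sqr; apply: ler_wsqrtr.
    rewrite exprMn -[_ `^ a ^+ 2]powR_mulrn // -powRrM [a * 2]mulrC.
    by apply: le_trans XK _; rewrite ler_wpM2r ?powR_ge0 // expr2; lra.
  rewrite -mulrA ler_pM2l //; apply: (@le_trans _ _ ((E * ln n%:R) `^ a)).
    by apply: ge0_ler_powR; rewrite ?nnegrE ?(ltW K0) ?mulr_ge0 ?(ltW ln0) //; lra.
  rewrite powRM ?(ltW ln0) //; last lra.
  by rewrite ler_wpM2r ?powR_ge0 //; exact: ler1_powR.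
split=> [th2|th2].
  have {}H := H 1 th1 n2 ler01 (fun nu nu01 h _ => h K th2).
  apply: le_trans H _; rewrite lee_fin; apply: fin; rewrite ?mulr_ge0 //; first lra.
  rewrite mulfV // powRr1 ?(ltW K0) //; lra.
have Kn0 : (0 < K)%N by rewrite muln_gt0.
have /andP[t0 t1] := inv_theta_half th2; set t := inv_theta theta in H t0 t1 *.
have W0 : 0 <= 2 * K%:R `^ (1 - 2 * t) by rewrite mulr_ge0 ?powR_ge0.
have {}H := H _ th1 n2 W0 (fun nu nu01 _ h => h K th2 Kn0).
apply: le_trans H _.
rewrite lee_fin; apply: fin.
- by apply/andP; split; lra.
- by rewrite mulr_ge0 ?(ltW K0) // addr_ge0.
- have -> : K%:R `^ (2 * (1 - t)) = K%:R * K%:R `^ (1 - 2 * t).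
    rewrite -[X in _ = X * _](powRr1 (ltW K0)) -powRD ?(gt_eqF K0) ?implybT //.
    by congr (_ `^ _); ring.
  have k1 : 1 <= K%:R `^ (1 - 2 * t).
    by rewrite -[leLHS](powRr0 K%:R); apply: ler_powR => //; lra.
  move: k1; move: (K%:R `^ _) => X k1; rewrite mulrCA ler_pM2l //; lra.
Qed.

End UpperLog.

(** * Hat functions and their second differences *)

Section Hats.
Variable R : realType.
Notation mu := (@lebesgue_measure R).
Implicit Types (s c h x : R) (k : nat).

Definition hat s c x : R := Num.max 0 (1 - s * `|x - c|).

Lemma hat_ge0 s c x : 0 <= hat s c x.
Proof. by rewrite /hat le_max lexx. Qed.

Lemma hat_le1 s c x : 0 < s -> hat s c x <= 1.
Proof. by move=> s0; rewrite /hat ge_max ler01 gerBl mulr_ge0 // ltW. Qed.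

Lemma hat_eq0 s c x : 1 <= s * `|x - c| -> hat s c x = 0.
Proof. by move=> h; apply/max_idPl; rewrite subr_le0. Qed.

Lemma hat_ge_half s c x : s * `|x - c| <= 2^-1 -> 2^-1 <= hat s c x.
Proof. by move=> h; rewrite /hat le_max; apply/orP; right; lra. Qed.

Lemma measurable_hat s c : measurable_fun setT (hat s c).
Proof.
apply: measurable_maxr => //; apply: measurable_funB => //; apply: measurable_funM => //.
by apply: measurableT_comp => //; exact: measurable_funB.
Qed.

Lemma hat_le_indic s c x : 0 < s -> hat s c x <= \1_(ball c s^-1) x.
Proof.
move=> s0; rewrite indicE; have [xc|xc] := pselect (ball c s^-1 x).
  by rewrite mem_set //; exact: hat_le1.
rewrite memNset // hat_eq0 //; rewrite leNgt; apply/negP => h; apply: xc.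
by rewrite /ball /= distrC -(ltr_pM2l s0) mulfV // gt_eqF.
Qed.

Lemma integral_hat_le s c : 0 < s -> (\int[mu]_x (hat s c x)%:E <= (2 / s)%:E)%E.
Proof.
move=> s0; apply: (@le_trans _ _ (\int[mu]_x (\1_(ball c s^-1) x)%:E)%E).
  by apply: ge0_integral_mono => x _; rewrite lee_fin ?hat_ge0 // hat_le_indic.
rewrite integral_indic //; last exact: measurable_ball.
rewrite setIT [X in (X <= _)%E]lebesgue_measure_ball ?invr_ge0 ?(ltW s0) //.
by rewrite lee_fin mulr_natl.
Qed.

Lemma hat_fdiff_identity s c x : 0 < s ->
  hat s c x = 2^-1 * (`|s * (x - c) + 1| - 2 * `|s * (x - c)| + `|s * (x - c) - 1|).
Proof.
move=> s0; rewrite /hat -{1}(gtr0_norm s0) -normrM; move: (s * (x - c)) => u.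
by case: (ger0P u) => u0; case: (ger0P (u + 1)) => u1; case: (ger0P (u - 1)) => u2;
  rewrite maxEle; case: lerP => u3; lra.
Qed.

Lemma abs_fdiff (h y : R) : 0 < h ->
  `|y - h| - 2 * `|y| + `|y + h| = 2 * h * hat h^-1 0 y.
Proof.
move=> h0; rewrite /hat subr0.
have -> : 2 * h * Num.max 0 (1 - h^-1 * `|y|) = 2 * Num.max 0 (h - `|y|).
  rewrite -mulrA maxr_pMr ?(ltW h0) // mulr0 mulrBr mulr1 mulrA mulfV ?gt_eqF // mul1r.
  by [].
by case: (ger0P y) => u0; case: (ger0P (y - h)) => u1; case: (ger0P (y + h)) => u2;
  rewrite maxEle; case: lerP => u3; lra.
Qed.

Lemma hatE s c x : 0 < s ->
  hat s c x = s / 2 * (`|x - (c - s^-1)| - 2 * `|x - c| + `|x - (c + s^-1)|).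
Proof.
move=> s0; have sn : s != 0 by rewrite gt_eqF.
have e1 : s * (x - c) + 1 = s * (x - (c - s^-1)) by field.
have e2 : s * (x - c) - 1 = s * (x - (c + s^-1)) by field.
by rewrite hat_fdiff_identity // e1 e2 !normrM gtr0_norm //; field.
Qed.

(** A hat is s / 2 times the second difference of the absolute value with step 1/s. Second
    differences commute, so differencing it with step h gives a second difference with step 1/s of
    hats of half-width h. *)
Lemma fdiff2_hat s h c x : 0 < s -> 0 < h ->
  fdiff 2 h (hat s c) x = s * h * (hat h^-1 (c - s^-1 - h) x
    - 2 * hat h^-1 (c - h) x + hat h^-1 (c + s^-1 - h) x).
Proof.
move=> s0 h0; have hatT (k : R) : hat h^-1 (k - h) x = hat h^-1 0 (x + h - k).
  by rewrite /hat subr0 opprB addrA.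
have key (k : R) : `|x - k| - 2 * `|x + h - k| + `|x + 2 * h - k| = 2 * h * hat h^-1 0 (x + h - k).
  have e1 : x + h - k - h = x - k by ring.
  have e2 : x + h - k + h = x + 2 * h - k by ring.
  by rewrite -abs_fdiff // e1 e2.
rewrite fdiff2 !hatT !(hatE _ _ s0).
have -> : s * h * (hat h^-1 0 (x + h - (c - s^-1)) - 2 * hat h^-1 0 (x + h - c)
    + hat h^-1 0 (x + h - (c + s^-1))) = s / 2 * (2 * h * hat h^-1 0 (x + h - (c - s^-1))
    - 2 * (2 * h * hat h^-1 0 (x + h - c)) + 2 * h * hat h^-1 0 (x + h - (c + s^-1))) by field.
rewrite -!key; field; rewrite ?gt_eqF //.
Qed.

Lemma integral_three_hats (a s c1 c2 c3 : R) : 0 <= a -> 0 < s ->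
  (\int[mu]_x (a * (hat s c1 x + 2 * hat s c2 x + hat s c3 x))%:E <= (a * (8 / s))%:E)%E.
Proof.
move=> a0 s0; have mh c : measurable_fun setT (fun x => (hat s c x)%:E).
  by apply/measurable_EFinP; exact: measurable_hat.
have h0 c x : (0 <= (hat s c x)%:E)%E by rewrite lee_fin hat_ge0.
under eq_integral do rewrite EFinM !EFinD EFinM.
have m2 : measurable_fun setT (fun x => (2%:E * (hat s c2 x)%:E)%E).
  by apply: emeasurable_funM => //; exact: measurable_cst.
have h2 x : (0 <= 2%:E * (hat s c2 x)%:E)%E by apply: mule_ge0; rewrite ?lee_fin ?hat_ge0.
rewrite ge0_integralZl_EFin //; last 2 first.
- by move=> x _; apply: adde_ge0 => //; exact: adde_ge0.
- exact: (emeasurable_funD (emeasurable_funD (mh c1) m2) (mh c3)).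
rewrite EFinM; apply: lee_pmul => //.
  by apply: integral_ge0 => x _; apply: adde_ge0 => //; exact: adde_ge0.
rewrite (@ge0_integralD _ _ _ mu setT measurableT
  (fun x => (hat s c1 x)%:E + 2%:E * (hat s c2 x)%:E)%E (fun x => (hat s c3 x)%:E)) //;
  first last.
- exact: mh.
- exact: (emeasurable_funD (mh c1) m2).
- by move=> x _; exact: adde_ge0.
rewrite (@ge0_integralD _ _ _ mu setT measurableT
  (fun x => (hat s c1 x)%:E)%E (fun x => 2%:E * (hat s c2 x)%:E)%E) //; last exact: mh.
rewrite ge0_integralZl_EFin //; last exact: mh.
have -> : (8 / s)%:E = ((2 / s)%:E + 2%:E * (2 / s)%:E + (2 / s)%:E)%E.
  by rewrite -EFinM -!EFinD; congr EFin; field; rewrite gt_eqF.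
have i0 c : (0 <= \int[mu]_x (hat s c x)%:E)%E by exact: integral_ge0.
by apply: leeD; [apply: leeD|]; rewrite ?integral_hat_le //; apply: lee_pmul => //; exact: integral_hat_le.
Qed.

(** The first bound is the triangle inequality over three translates, useful for large h; the second
    comes from [fdiff2_hat]. In both, weights 1, 2, 1 and integrals at most twice the half-width
    give the 8. *)
Lemma integral_fdiff2_hat s h c (D : set R) : 0 < s -> 0 < h ->
  (\int[mu]_(x in D) `|fdiff 2 h (hat s c) x|%:E <= (8 * Num.min s^-1 (s * h ^+ 2))%:E)%E.
Proof.
move=> s0 h0; apply: (@le_trans _ _ (\int[mu]_x `|fdiff 2 h (hat s c) x|%:E)%E).
  by apply: ge0_integral_subset.
rewrite minEle; case: ifP => _.
  apply: le_trans (_ : _ <= \int[mu]_x (1 * (hat s c x + 2 * hat s (c - h) x + hat s (c - 2 * h) x))%:E)%E _.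
    apply: ge0_integral_mono => x _; rewrite lee_fin // fdiff2 mul1r.
    have -> : hat s (c - h) x = hat s c (x + h) by rewrite /hat opprB addrA addrAC.
    have -> : hat s (c - 2 * h) x = hat s c (x + 2 * h) by rewrite /hat opprB addrA addrAC.
    have := hat_ge0 s c x; have := hat_ge0 s c (x + h); have := hat_ge0 s c (x + 2 * h).
    by move: (hat _ _ _) (hat _ _ _) (hat _ _ _) => u v w; rewrite ler_norml; lra.
  by apply: le_trans (integral_three_hats _ _ _ _ s0) _; rewrite ?mul1r.
have sh : 0 <= s * h by rewrite mulr_ge0 ?(ltW s0) ?(ltW h0).
apply: le_trans (_ : _ <= \int[mu]_x (s * h * (hat h^-1 (c - s^-1 - h) x + 2 * hat h^-1 (c - h) x
   + hat h^-1 (c + s^-1 - h) x))%:E)%E _.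
  apply: ge0_integral_mono => x _; rewrite lee_fin // fdiff2_hat // normrM (ger0_norm sh).
  rewrite ler_wpM2l //; move: (hat_ge0 h^-1 (c - s^-1 - h) x) (hat_ge0 h^-1 (c - h) x) (hat_ge0 h^-1 (c + s^-1 - h) x).
  by move: (hat _ _ _) (hat _ _ _) (hat _ _ _) => u v w; rewrite ler_norml; lra.
apply: le_trans (integral_three_hats _ _ _ sh _) _; first by rewrite invr_gt0.
by rewrite lee_fin invrK expr2 le_eqVlt; apply/predU1P; left; ring.
Qed.

End Hats.

(** * Moduli of smoothness of hats, integrated and summed over scales *)

Section Profile.
Variable R : realType.
Notation mu := (@lebesgue_measure R).
Implicit Types (f : R -> R) (s h t x : R) (k p L : nat).

Lemma integral_inv_sqr s : 0 < s ->
  (\int[mu]_(t in `[(s^-1)%R, +oo[) (s^-1 * t^-1 ^+ 2)%:E = 1%:E)%E.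
Proof.
move=> s0; have sn : s != 0 by rewrite gt_eqF.
have p t : s^-1 <= t -> 0 < t by apply: lt_le_trans; rewrite invr_gt0.
have dF t : 0 < t -> is_derive t (1:R) (fun x => - s^-1 * x^-1) (s^-1 * t^-1 ^+ 2).
  move=> t0; have tn : t != 0 by rewrite gt_eqF.
  have dV : is_derive t (1:R) (fun x : R => x^-1) (- t ^- 2).
    split; first exact: (derivableV (f := id)).
    by rewrite (deriveV (f := id)) // derive_id; exact: mulr1.
  have := @is_deriveZ _ _ _ (fun x : R => x^-1) (- s^-1) t (1:R) _ dV.
  by rewrite /GRing.scale /= exprVn mulrNN.
rewrite (@ge0_continuous_FTC2y _ _ (fun x => - s^-1 * x^-1) _ 0).
- by rewrite invrK mulNr mulVf // EFinN oppeK add0e.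
- by move=> x _; rewrite mulr_ge0 ?sqr_ge0 // invr_ge0 ltW.
- have cf t : 0 < t -> {for t, continuous (fun x : R => s^-1 * x^-1 ^+ 2)}.
    move=> t0; apply: cvgM; first exact: cvg_cst.
    by rewrite expr2; apply: cvgM; apply: cvgV; rewrite ?gt_eqF.
  apply/continuous_within_itvcyP; split.
    by move=> x; rewrite in_itv /= andbT => /ltW /p; exact: cf.
  by apply: cvg_at_right_filter; apply: cf; rewrite invr_gt0.
- apply/cvgrPdist_lt => e e0; near=> x.
  have x1 : (s * e)^-1 < x by near: x; apply: nbhs_pinfty_gt; exact: num_real.
  have x0 : 0 < x by apply: lt_trans x1; rewrite invr_gt0 mulr_gt0.
  rewrite sub0r mulNr opprK gtr0_norm ?divr_gt0 ?invr_gt0 // -invfM.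
  move: x1; rewrite -(ltr_pM2r e0) !invfM divfK ?gt_eqF // => x1.
  by rewrite ltr_pdivrMr // mulrC.
- by move=> x /ltW /p /dF h; exact: ex_derive.
- apply: cvg_at_right_filter; apply: cvgM; first exact: cvg_cst.
  by apply: cvgV => //; rewrite invr_neq0.
- by move=> x; rewrite in_itv /= andbT => /ltW /p /dF h; rewrite derive1E derive_val.
Unshelve. all: by end_near.
Qed.

(** Up to the factor 8, a bound for the L_1-modulus of smoothness at t of a hat of half-width
    1/s. *)
Definition profile s t : R := Num.min s^-1 (s * t ^+ 2).

Lemma profile_ge0 s t : 0 < s -> 0 <= profile s t.
Proof. by move=> /ltW s0; rewrite /profile le_min invr_ge0 s0; apply: mulr_ge0 => //; exact: sqr_ge0. Qed.

Lemma measurable_profile s : measurable_fun setT (fun t => profile s t * (t `^ (-1)) ^+ 2).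
Proof.
apply: measurable_funM; last by apply: measurable_funX; exact: measurable_powR.
apply: measurable_minr => //; apply: measurable_funM => //; exact: measurable_funX.
Qed.

(** Split at t = 1/s. Below, the integrand is at most s on an interval of length 1/s; above, it is
    at most s^-1 t^-2. Each part gives at most 1, whatever the scale. *)
Lemma integral_profile_le s : 0 < s ->
  (\int[mu]_(t in `]0%R, +oo[) (profile s t * (t `^ (-1)) ^+ 2)%:E <= 2%:E)%E.
Proof.
move=> s0; have i0 : 0 < s^-1 by rewrite invr_gt0.
have U : `]0%R, +oo[%classic = `]0%R, s^-1[ `|` `[s^-1, +oo[ :> set R.
  by apply: itv_bndbnd_setU => //; rewrite bnd_simp.
rewrite U ge0_integral_setU //; first last.
- apply/disj_set2P; apply/seteqP; split => // x [] /=; rewrite !in_itv /= andbT.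
  by move=> /andP[_ h] /(lt_le_trans h); rewrite ltxx.
- by move=> x _; rewrite lee_fin mulr_ge0 ?sqr_ge0 ?profile_ge0.
- by apply/measurable_EFinP; apply: measurable_funS (measurable_profile s).
rewrite (_ : 2%:E = 1%:E + 1%:E)%E; last by rewrite -EFinD; congr EFin; ring.
apply: leeD.
  apply: (@le_trans _ _ (\int[mu]_(t in `]0%R, (s^-1)%R[) (cst s%:E) t)%E).
    apply: ge0_integral_mono => t; rewrite /= in_itv /= => /andP[t0 _]; rewrite lee_fin.
      by rewrite mulr_ge0 ?sqr_ge0 ?profile_ge0.
    apply: (@le_trans _ _ (s * t ^+ 2 * (t `^ (-1)) ^+ 2)).
      by rewrite ler_wpM2r ?sqr_ge0 // ge_min lexx orbT.
    have tn : t != 0 by rewrite gt_eqF.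
    by rewrite powR_inv1 ?(ltW t0) // -mulrA -exprMn mulfV // expr1n mulr1.
  rewrite integral_cst // [X in (_ * X)%E]lebesgue_measure_itv /= lte_fin i0.
  by rewrite -EFinM subr0 mulfV // gt_eqF.
rewrite -(integral_inv_sqr s0).
apply: ge0_integral_mono => t; rewrite /= in_itv /= andbT => st; rewrite lee_fin.
  by rewrite mulr_ge0 ?sqr_ge0 ?profile_ge0.
rewrite powR_inv1; last exact: le_trans (ltW i0) st.
by rewrite ler_wpM2r ?sqr_ge0 // ge_min lexx.
Qed.

(* Telescoping with the potential [y] for [y <= 1] and [3 - 2 / y] beyond. *)
Lemma sum_profile_le k L t : 0 < t ->
  t^-1 * \sum_(l < L) profile (2 ^+ (k + l)) t <= 3.
Proof.
move=> t0; pose Phi (y : R) := if y <= 1 then y else 3 - 2 / y.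
have Phi3 y : Phi y <= 3.
  rewrite /Phi; case: (lerP y 1) => y1; first by lra.
  by rewrite gerBl divr_ge0 // ltW // (lt_trans ltr01).
suff H : t^-1 * \sum_(l < L) profile (2 ^+ (k + l)) t <= Phi (2 ^+ (k + L) * t) by exact: le_trans H _.
elim: L => [|L IH].
  rewrite big_ord0 mulr0 addn0 /Phi; move: (mulr_gt0 (pow2_gt0 R k) t0); move: (_ * t) => y y0.
  case: (lerP y 1) => y1; first exact: ltW.
  by rewrite subr_ge0 ler_pdivrMr ?(lt_trans ltr01) //; lra.
rewrite big_ord_recr /= mulrDr; apply: le_trans (lerD IH (lexx _)) _.
have [p0 pn] := (pow2_gt0 R (k + L), pow2_neq0 R (k + L)).
rewrite addnS exprS; move: (2 ^+ (k + L)) p0 pn => p p0 pn.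
have e1 : t^-1 * profile p t = Num.min (p * t)^-1 (p * t).
  rewrite /profile minr_pMr ?invr_ge0 ?(ltW t0) // -invfM mulrC; congr (Num.min _ _).
  by field; rewrite gt_eqF.
rewrite e1 -mulrA; have y0 : 0 < p * t by rewrite mulr_gt0.
move: (p * t) y0 => y y0 {e1}; have yn : y != 0 by rewrite gt_eqF.
rewrite /Phi; case: (lerP y 1) => y1; case: (lerP (2 * y) 1) => y2.
- by rewrite mulr_natl mulr2n lerD2l ge_min lexx orbT.
- apply: (@le_trans _ _ (y + y)); first by rewrite lerD2l ge_min lexx orbT.
  rewrite lerBrDr -(ler_pM2r y0) mulrDl (_ : 2 / (2 * y) * y = 1); last by field.
  by nra.
- by lra.
- apply: (@le_trans _ _ (3 - 2 / y + y^-1)); first by rewrite lerD2l ge_min lexx.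
  by rewrite le_eqVlt; apply/predU1P; left; field.
Qed.

End Profile.

(** * Towers of concentric hats in the Besov class *)

Section Tower.
Variable R : realType.
Notation mu := (@lebesgue_measure R).
Notation I01 := (`[0%R, 1%R]%classic : set R).
Implicit Types (c h t x lam : R) (k M N L : nat).

(** Test functions of the lower bound; L = 1 gives the single hats of the case theta <= 2. *)
Definition tower lam k L c x : R := lam * \sum_(l < L) hat (2 ^+ (k + l)) c x.

Lemma tower_ge0 lam k L c x : 0 <= lam -> 0 <= tower lam k L c x.
Proof. by move=> l0; apply: mulr_ge0 => //; apply: sumr_ge0 => l _; exact: hat_ge0. Qed.

Lemma measurable_tower lam k L c : measurable_fun setT (tower lam k L c).
Proof.
apply: measurable_funM => //; apply: measurable_sum => l; exact: measurable_hat.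
Qed.

Lemma sum_inv_pow2 k L : \sum_(l < L) 2 / 2 ^+ (k + l) <= 4 / 2 ^+ k :> R.
Proof.
suff -> : \sum_(l < L) 2 / 2 ^+ (k + l) = 4 / 2 ^+ k - 4 / 2 ^+ (k + L) :> R.
  by rewrite gerBl divr_ge0.
elim: L => [|L IH]; first by rewrite big_ord0 addn0 subrr.
rewrite big_ord_recr /= IH addnS exprS.
by have := pow2_neq0 R (k + L); have := pow2_neq0 R k; move: (2 ^+ _) (2 ^+ _) => u v un vn; field; rewrite un vn.
Qed.

Lemma integral_tower_le lam k L c : 0 <= lam ->
  (\int[mu]_x (tower lam k L c x)%:E <= (lam * (4 / 2 ^+ k))%:E)%E.
Proof.
move=> l0; have mh l : measurable_fun setT (fun x => (hat (2 ^+ (k + l)) c x)%:E).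
  by apply/measurable_EFinP; exact: measurable_hat.
rewrite (_ : (\int[mu]_x _ = lam%:E * \sum_(l < L) \int[mu]_x (hat (2 ^+ (k + l)) c x)%:E)%E).
  rewrite EFinM; apply: lee_pmul => //.
    by apply: sume_ge0 => l _; apply: integral_ge0 => x _; rewrite lee_fin hat_ge0.
  apply: (@le_trans _ _ (\sum_(l < L) (2 / 2 ^+ (k + l))%:E)%E).
    by apply: lee_sum => l _; exact: integral_hat_le.
  by rewrite sumEFin lee_fin sum_inv_pow2.
rewrite -ge0_integral_sum //; last 2 first.
- by move=> l; exact: mh.
- by move=> l x _; rewrite lee_fin hat_ge0.
rewrite -ge0_integralZl_EFin //.
- by apply: eq_integral => x _; rewrite /tower EFinM sumEFin.
- by move=> x _; apply: sume_ge0 => l _; rewrite lee_fin hat_ge0.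
- by apply: emeasurable_sum => l; exact: mh.
Qed.

Lemma LpNorm_tower_le lam k L c (D : set R) : 0 <= lam ->
  (LpNorm D 1 (tower lam k L c) <= (4 * lam)%:E)%E.
Proof.
move=> l0; rewrite LpNorm1; apply: (@le_trans _ _ (\int[mu]_x `|tower lam k L c x|%:E)%E).
  exact: ge0_integral_subset.
under eq_integral do rewrite ger0_norm ?tower_ge0 //.
apply: le_trans (integral_tower_le _ _ _ l0) _; rewrite lee_fin mulrC ler_wpM2r //.
by rewrite ler_pdivrMr // ler_peMr // -natrX ler1n expn_gt0.
Qed.

Lemma fdiff2_tower lam k L c h x :
  fdiff 2 h (tower lam k L c) x = lam * \sum_(l < L) fdiff 2 h (hat (2 ^+ (k + l)) c) x.
Proof.
under eq_bigr do rewrite fdiff2.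
rewrite fdiff2 /tower; rewrite big_split sumrB /= -mulr_sumr; ring.
Qed.

Lemma modsmooth_tower_le lam k L c t (D : set R) : 0 <= lam ->
  (modsmooth D 2 1 (tower lam k L c) t <= (8 * lam * \sum_(l < L) profile (2 ^+ (k + l)) t)%:E)%E.
Proof.
move=> l0; apply: ge_ereal_sup => y [h /= + <-]; rewrite in_itv /= => /andP[h0 ht].
rewrite LpNorm1; set E := diff_dom _ _ _.
have mf l : measurable_fun setT (fun x => `|fdiff 2 h (hat (2 ^+ (k + l)) c) x|%:E).
  apply/measurable_EFinP; apply: measurableT_comp => //.
  have mt u : measurable_fun setT (fun x => hat (2 ^+ (k + l)) c (x + u)).
    by apply: measurableT_comp; [exact: measurable_hat|exact: measurable_funD].
  rewrite (_ : fdiff 2 h _ = fun x => hat (2 ^+ (k + l)) c x - 2 * hat (2 ^+ (k + l)) c (x + h) +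
    hat (2 ^+ (k + l)) c (x + 2 * h)); last by apply/funext => x; rewrite fdiff2.
  apply: measurable_funD => //; apply: measurable_funB; first exact: measurable_hat.
  exact: measurable_funM.
apply: (@le_trans _ _ (\int[mu]_x (lam%:E * \sum_(l < L) `|fdiff 2 h (hat (2 ^+ (k + l)) c) x|%:E))%E).
  apply: (@le_trans _ _ (\int[mu]_x `|fdiff 2 h (tower lam k L c) x|%:E)%E).
    exact: ge0_integral_subset.
  apply: ge0_integral_mono => x _; first by rewrite lee_fin.
  rewrite sumEFin -EFinM lee_fin fdiff2_tower normrM ger0_norm // ler_wpM2l // ler_norm_sum //.
rewrite ge0_integralZl_EFin //; last 2 first.
- by move=> x _; apply: sume_ge0 => l _; rewrite lee_fin.
- by apply: emeasurable_sum => l; exact: mf.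
rewrite ge0_integral_sum //; last by move=> l; exact: mf.
rewrite (mulrC 8) -mulrA EFinM; apply: lee_pmul => //.
  by apply: sume_ge0 => l _; exact: integral_ge0.
rewrite mulr_sumr -sumEFin; apply: lee_sum => l _.
apply: le_trans (integral_fdiff2_hat c setT (pow2_gt0 R _) h0) _.
rewrite lee_fin ler_wpM2l // /profile le_min ge_min lexx /= ge_min; apply/orP; right.
by rewrite ler_wpM2l // lerXn2r // nnegrE ltW // (lt_le_trans h0).
Qed.

(** As X t / 3 <= 1 by [sum_profile_le], its power th is at most X t / 3 itself. This reduces to the
    integral for th = 1, where each of the L hats contributes at most 2; the root then leaves
    L^(1/theta) instead of L. The 24 is 8 * 3. *)
Lemma besov_semi_tower_le lam k L c theta : 0 <= lam -> (1 <= theta)%E ->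
  (besov_semi I01 1 1 theta (tower lam k L c) <= (24 * lam * L%:R `^ inv_theta theta)%:E)%E.
Proof.
move=> l0; rewrite /besov_semi besov_s1.
pose X t := t `^ (-1) * \sum_(l < L) profile (2 ^+ (k + l)) t.
have X0 t : 0 <= X t by apply: mulr_ge0; [exact: powR_ge0|apply: sumr_ge0 => l _; exact: profile_ge0].
have X3 t : 0 < t -> X t <= 3.
  by move=> t0; rewrite /X powR_inv1 ?(ltW t0) //; exact: sum_profile_le.
have M t : 0 < t ->
    ((t `^ (-1))%:E * modsmooth I01 2 1 (tower lam k L c) t <= (24 * lam * (X t / 3))%:E)%E.
  move=> t0; apply: (@le_trans _ _ ((t `^ (-1))%:E * (8 * lam * \sum_(l < L) profile (2 ^+ (k + l)) t)%:E)%E).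
    by apply: lee_pmul; rewrite ?modsmooth_ge0 ?lee_fin ?powR_ge0 // modsmooth_tower_le.
  by rewrite -EFinM lee_fin le_eqVlt; apply/predU1P; left; rewrite /X; field.
have l24 : 0 <= 24 * lam by rewrite mulr_ge0.
case: theta => [th| |] // th1; last first.
  apply: ge_ereal_sup => y [t /= + <-]; rewrite in_itv /= andbT => t0.
  apply: le_trans (M t t0) _; rewrite lee_fin /= powRr0 ler_wpM2l // ler_pdivrMr // mul1r.
  exact: X3.
rewrite lee_fin in th1; have th0 : 0 < th by exact: lt_le_trans th1.
apply: (@le_trans _ _ ((((24 * lam) `^ th * L%:R)%:E `^ th^-1)%E)); last first.
  rewrite poweR_EFin powRM ?powR_ge0 // -powRrM mulfV ?gt_eqF // powRr1 //.
apply: poweR_le; rewrite ?invr_ge0 ?(ltW th0) //.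
  apply: integral_ge0 => t; rewrite /= in_itv /= andbT => t0.
  by apply: mule_ge0; rewrite ?poweR_ge0 // lee_fin invr_ge0 ltW.
apply: (@le_trans _ _ (\int[mu]_(t in `]0%R, +oo[) (((24 * lam) `^ th / 3)%:E *
    \sum_(l < L) (profile (2 ^+ (k + l)) t * (t `^ (-1)) ^+ 2)%:E))%E).
  apply: ge0_integral_mono => t; rewrite /= in_itv /= andbT => t0.
    by apply: mule_ge0; rewrite ?poweR_ge0 // lee_fin invr_ge0 ltW.
  apply: (@le_trans _ _ (((24 * lam * (X t / 3))%:E `^ th * (t^-1)%:E)%E)).
    apply: lee_pmul; rewrite ?poweR_ge0 ?lee_fin ?invr_ge0 ?(ltW t0) //.
    apply: poweR_le; rewrite ?(ltW th0) ?M //.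
    by apply: mule_ge0; rewrite ?modsmooth_ge0 // lee_fin powR_ge0.
  rewrite poweR_EFin sumEFin -!EFinM lee_fin powRM // ?divr_ge0 //.
  have tt : t `^ (-1) = t^-1 by rewrite powR_inv1 // ltW.
  have -> : (24 * lam) `^ th / 3 * (\sum_(l < L) profile (2 ^+ (k + l)) t * (t `^ (-1)) ^+ 2)
    = (24 * lam) `^ th * (X t / 3) * t^-1.
    by rewrite /X tt -mulr_suml; ring.
  rewrite ler_wpM2r ?invr_ge0 ?(ltW t0) // ler_wpM2l ?powR_ge0 //.
  have [->|Xn] := eqVneq (X t) 0; first by rewrite mul0r powR0 // gt_eqF.
  rewrite -[leRHS]powRr1 ?divr_ge0 //; apply: ger_powR => //.
  by rewrite ler_pdivrMr // mul1r X3 // andbT divr_gt0 // lt_neqAle eq_sym Xn X0.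
have mW l : measurable_fun (`]0%R, +oo[%classic : set R)
    (fun t : R => (profile (2 ^+ (k + l)) t * (t `^ (-1)) ^+ 2)%:E).
  by apply/measurable_EFinP; apply: measurable_funS (measurable_profile _).
have W0 l (t : R) : (0 <= (profile (2 ^+ (k + l)) t * (t `^ (-1)) ^+ 2)%:E)%E.
  by rewrite lee_fin mulr_ge0 ?sqr_ge0 ?profile_ge0.
rewrite ge0_integralZl_EFin //; last 3 first.
- by move=> t _; apply: sume_ge0 => l _; exact: W0.
- by apply: emeasurable_sum => l; exact: mW.
- by rewrite divr_ge0 ?powR_ge0.
rewrite ge0_integral_sum //; last by move=> l; exact: mW.
apply: (@le_trans _ _ (((24 * lam) `^ th / 3)%:E * \sum_(l < L) 2%:E)%E).
  apply: lee_pmul => //; first by rewrite lee_fin divr_ge0 ?powR_ge0.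
    by apply: sume_ge0 => l _; apply: integral_ge0 => t _; exact: W0.
  by apply: lee_sum => l _; exact: integral_profile_le.
rewrite sumEFin -EFinM lee_fin sumr_const card_ord -mulrA ler_wpM2l ?powR_ge0 //.
by rewrite -[2 *+ L]mulr_natr mulrA ler_piMl // ler_pdivrMl // mulr1 ler_nat.
Qed.

(** The 28 adds 4 for the L_1-norm to 24 for the seminorm, the former absorbed through L^(1/theta)
    >= 1. *)
Lemma tower_in_class k L c theta : (0 < L)%N -> (1 <= theta)%E ->
  besov_class I01 1 1 theta (tower (28 * L%:R `^ inv_theta theta)^-1 k L c).
Proof.
move=> L0 th1; set y := L%:R `^ _; set lam := _^-1.
have it0 : 0 <= inv_theta theta.
  by case: theta th1 {y lam} => [th| |] //=; rewrite lee_fin invr_ge0 => h; exact: le_trans h.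
have y1 : 1 <= y.
  rewrite (_ : 1 = 1 `^ inv_theta theta); last by rewrite powR1.
  by apply: ge0_ler_powR; rewrite ?nnegrE // ler1n.
have y0 : 0 < y by exact: lt_le_trans y1.
have l0 : 0 <= lam by rewrite invr_ge0 mulr_ge0 // ltW.
have N := LpNorm_tower_le k L c I01 l0.
have B := besov_semi_tower_le k L c l0 th1.
split; first by apply: measurable_funS (measurable_tower _ _ _ _).
split; first by apply: le_lt_trans N _; rewrite ltry.
apply: le_trans (leeD N B) _; rewrite -EFinD lee_fin -/y.
apply: (@le_trans _ _ (28 * (lam * y))).
  have h : lam <= lam * y by rewrite ler_peMr.
  by rewrite (_ : 28 * (lam * y) = 4 * (lam * y) + 24 * lam * y); [lra|ring].
by rewrite /lam le_eqVlt; apply/predU1P; left; field; rewrite gt_eqF.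
Qed.

End Tower.

(** * Averages and L_2-norms of the test functions *)

Section TowerAverages.
Variable R : realType.
Notation mu := (@lebesgue_measure R).
Notation I01 := (`[0%R, 1%R]%classic : set R).
Notation L1 g := (mu.-integrable setT (EFin \o g)).
Implicit Types (f g : R -> R) (s c h x lam : R) (k j m N p L : nat).

(** The squared L_2[0, 1]-norm of the conditional expectation of g on the cells of level K. *)
Definition avg_sqr g K : R := \sum_(j < 2 ^ K) (2 ^ K)%:R^-1 * avg g K j ^+ 2.

Lemma cst_le_avg f k j (m : R) : L1 f -> (forall x, cell k j x -> m <= f x) -> m <= avg f k j.
Proof.
move=> fi fm; rewrite -(avg_cst m k j) /avg ler_wpM2l // le_Rintegral //; last exact: integrable_cell.
by apply: continuous_integrable_cell => x; exact: cvg_cst.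
Qed.

Lemma avg_patch01 f k j : (j < 2 ^ k)%N -> avg (f \_ I01) k j = avg f k j.
Proof.
move=> jk; rewrite /avg; congr (_ * _); apply: eq_Rintegral => x /set_mem xj.
by rewrite patchE mem_set //; exact: (cell_sub01 jk xj).
Qed.

Lemma hdiff_patch01 f k j : (j < 2 ^ k)%N -> hdiff (f \_ I01) k j = hdiff f k j.
Proof.
by move=> jk; rewrite /hdiff !avg_patch01 // expnS mul2n ?ltn_double // ltn_Sdouble.
Qed.

Lemma L1_hat s c : 0 < s -> L1 (hat s c).
Proof.
move=> s0; apply/integrableP; split; first by apply/measurable_EFinP; exact: measurable_hat.
under eq_integral do rewrite /= ger0_norm ?hat_ge0 //.
by apply: le_lt_trans (integral_hat_le c s0) _; rewrite ltry.
Qed.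

Lemma L1_tower lam k L c : L1 (tower lam k L c).
Proof. by apply: L1Z; apply: L1_sum => l _; exact: L1_hat. Qed.

Definition cell_center k j : R := (j.*2.+1)%:R / 2 ^+ k.+1.

Lemma cell_center_dist k j x : cell k j x -> 2 ^+ k * `|x - cell_center k j| <= 2^-1.
Proof.
move=> /in_cell/andP[h1 h2]; rewrite -(gtr0_norm (pow2_gt0 R k)) -normrM mulrBr.
have -> : 2 ^+ k * cell_center k j = j%:R + 2^-1.
  rewrite /cell_center exprS -[(j.*2.+1)%:R]natr1 -addnn natrD.
  by have := pow2_neq0 R k; move: (2 ^+ k) => p p0; field.
by move: h2; rewrite -[j.+1%:R]natr1 => h2; rewrite ler_norml; lra.
Qed.

(** The level-K cell about the common centre is finer than every scale of the tower, so all L hats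
    are at least 1/2 on it. *)
Lemma avg_tower_center lam k L K j : 0 <= lam -> (k + L <= K)%N ->
  lam * (L%:R / 2) <= avg (tower lam k L (cell_center K j)) K j.
Proof.
move=> l0 kLK; apply: cst_le_avg => [|x xK]; first exact: L1_tower.
rewrite /tower ler_wpM2l //.
apply: (@le_trans _ _ (\sum_(l < L) 2^-1)); first by rewrite sumr_const card_ord mulr_natl.
apply: ler_sum => l _; apply: hat_ge_half; apply: le_trans (cell_center_dist xK).
rewrite ler_wpM2r // ler_weXn2l ?ler1n //.
by apply: leq_trans kLK; rewrite leq_add2l ltnW.
Qed.

(** Expanding the square, the term b l meets twice the earlier partial sum, which is at most l, and
    itself once. *)
Lemma sum_sqr_le_weighted L (b : nat -> R) : (forall l, 0 <= b l <= 1) ->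
  (\sum_(l < L) b l) ^+ 2 <= \sum_(l < L) (2 * l%:R + 1) * b l.
Proof.
move=> b01; have S1 : \sum_(l < L) b l <= L%:R.
  apply: (@le_trans _ _ (\sum_(l < L) 1)); last by rewrite sumr_const card_ord.
  by apply: ler_sum => l _; have /andP[] := b01 l.
elim: L S1 => [|L IH] S1; first by rewrite !big_ord0 expr0n.
have S0 : \sum_(l < L) b l <= L%:R.
  apply: (@le_trans _ _ (\sum_(l < L) 1)); last by rewrite sumr_const card_ord.
  by apply: ler_sum => l _; have /andP[] := b01 l.
rewrite !big_ord_recr /=; have := IH S0; have /andP[b0 b1] := b01 L.
by move: (\sum_(l < L) b l) (\sum_(l < L) _) S0 => u v uL; nra.
Qed.

Lemma sum_odd_div_pow2 L : \sum_(l < L) (2 * l%:R + 1) * (2 / 2 ^+ l) <= 12 :> R.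
Proof.
suff -> : \sum_(l < L) (2 * l%:R + 1) * (2 / 2 ^+ l) = 12 - (8 * L%:R + 12) / 2 ^+ L :> R.
  by rewrite gerBl divr_ge0 // addr_ge0.
elim: L => [|L IH]; first by rewrite big_ord0 expr0; field.
rewrite big_ord_recr /= IH exprS -natr1.
by have := pow2_neq0 R L; move: (2 ^+ L) => p p0; field.
Qed.

Lemma avg_hat01 s c k j : 0 < s -> 0 <= avg (hat s c) k j <= 1.
Proof.
move=> s0; have hi := L1_hat c s0.
rewrite cst_le_avg //=; last by move=> x _; exact: hat_ge0.
rewrite -(avg_cst 1 k j) /avg ler_wpM2l // le_Rintegral //; first exact: integrable_cell.
  by apply: continuous_integrable_cell => x; exact: cvg_cst.
by move=> x _; exact: hat_le1.
Qed.

Lemma sum_avg_hat_le s c K : 0 < s ->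
  \sum_(j < 2 ^ K) (2 ^ K)%:R^-1 * avg (hat s c) K j <= 2 / s.
Proof.
move=> s0; have hi := L1_hat c s0; rewrite -lee_fin.
apply: le_trans (integral_hat_le c s0).
apply: (@le_trans _ _ (\sum_(j < 2 ^ K | predT j) \int[mu]_(x in cell K j) (hat s c x)%:E)%E); last first.
  apply: (@sum_cell_integral_le R K (2 ^ K) predT) => //; first by apply/measurable_EFinP; exact: measurable_hat.
  by move=> x; rewrite lee_fin hat_ge0.
rewrite -sumEFin; apply: lee_sum => j _.
rewrite /avg mulrA natrX mulVf // mul1r /Rintegral fineK //.
exact: (integrable_fin_num _ (integrable_cell _ _ hi)).
Qed.

(** The bound is free of L: the weights 2l + 1 of [sum_sqr_le_weighted] are beaten by the geometric
    decay of the integrals of the hats, so the L_2-norm is that of the widest hat up to a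
    constant. *)
Lemma avg_sqr_tower_le lam k L c K : 0 <= lam ->
  avg_sqr (tower lam k L c) K <= lam ^+ 2 * (12 / 2 ^+ k).
Proof.
move=> l0; pose b l j := avg (hat (2 ^+ (k + l)) c) K j.
have aE j : avg (tower lam k L c) K j = lam * \sum_(l < L) b l j.
  rewrite avgZ; last by apply: L1_sum => l _; exact: L1_hat.
  by rewrite avg_sum // => l _; exact: L1_hat.
apply: (@le_trans _ _ (lam ^+ 2 * \sum_(j < 2 ^ K) (2 ^ K)%:R^-1 *
    \sum_(l < L) (2 * l%:R + 1) * b l j)).
  rewrite /avg_sqr mulr_sumr; apply: ler_sum => j _; rewrite aE exprMn mulrCA.
  rewrite ler_wpM2l ?sqr_ge0 // ler_wpM2l ?invr_ge0 // (sum_sqr_le_weighted _ (b := b^~ j)) //.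
  by move=> l; exact: avg_hat01.
rewrite ler_wpM2l ?sqr_ge0 //.
under eq_bigr do rewrite mulr_sumr.
rewrite exchange_big /=.
apply: (@le_trans _ _ (\sum_(l < L) (2 * l%:R + 1) * (2 / 2 ^+ (k + l)))).
  apply: ler_sum => l _; under eq_bigr do rewrite mulrCA.
  rewrite -mulr_sumr ler_wpM2l ?addr_ge0 ?mulr_ge0 //; exact: sum_avg_hat_le.
have -> : \sum_(l < L) (2 * l%:R + 1) * (2 / 2 ^+ (k + l)) =
    (\sum_(l < L) (2 * l%:R + 1) * (2 / 2 ^+ l)) / 2 ^+ k :> R.
  by rewrite mulr_suml; apply: eq_bigr => l _; rewrite exprD invfM; ring.
by apply: ler_wpM2r; [rewrite invr_ge0 ltW|exact: sum_odd_div_pow2].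
Qed.

(* The bump occupies the odd child of the cell: its average is at least 1/4
   there and 0 over the even child. *)
Lemma hdiff_tower lam l j : 0 <= lam ->
  lam / 4 <= hdiff (tower lam l.+2 1 (cell_center l.+1 j.*2.+1)) l j.
Proof.
move=> l0; set i := j.*2.+1; set c := cell_center _ _; set h := hat (2 ^+ l.+2) c.
have hi : L1 h by exact: L1_hat.
have dn m : (m.*2)%:R = 2 * m%:R :> R by rewrite -mul2n natrM.
have pc : 2 ^+ l.+2 * c = 2 * i%:R + 1 by rewrite /c /cell_center mulrC divfK // -natr1 dn.
have tE : tower lam l.+2 1 c = fun x => lam * h x.
  by apply/funext => x; rewrite /tower big_ord1 addn0.
rewrite /hdiff tE !avgZ // -mulrBr ler_wpM2l //.
have -> : avg h l.+1 j.*2 = 0.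
  rewrite -(avg_cst 0 l.+1 j.*2) /avg; congr (_ * _); apply: eq_Rintegral => x.
  move=> /set_mem /in_cell/andP[_ h2]; apply: hat_eq0.
  rewrite -(gtr0_norm (pow2_gt0 R l.+2)) -normrM mulrBr pc exprS -mulrA distrC.
  by apply: le_trans (ler_norm _); move: h2; rewrite -/i; lra.
rewrite subr0; have h0 m : 0 <= avg h l.+3 m by apply: cst_le_avg => // x _; exact: hat_ge0.
(* Of the four quarters of the odd child, the hat is at least 1/2 on the two central ones, which
   gives the average 1/4. *)
have h1 m : (m == i.*2.*2.+1) || (m == i.*2.+1.*2) -> 2^-1 <= avg h l.+3 m.
  move=> mi; apply: cst_le_avg => // x /in_cell/andP[x1 x2]; apply: hat_ge_half.
  rewrite -(gtr0_norm (pow2_gt0 R l.+2)) -normrM mulrBr pc ler_norml.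
  have me : m%:R = 4 * i%:R + 1 :> R \/ m%:R = 4 * i%:R + 2 :> R.
    case/orP: mi => /eqP ->; [left|right].
      by rewrite -[(i.*2.*2.+1)%:R]natr1 !dn; ring.
    by rewrite dn -[(i.*2.+1)%:R]natr1 dn; ring.
  move: x1 x2; rewrite -[m.+1%:R]natr1 [2 ^+ l.+3]exprS -mulrA.
  by case: me => ->; lra.
rewrite (avg_mean _ _ hi) !(avg_mean l.+2 _ hi).
have := h0 i.*2.*2; have := h0 (i.*2.+1).*2.+1.
have := h1 i.*2.*2.+1; rewrite eqxx => /(_ isT).
have := h1 (i.*2.+1).*2; rewrite eqxx orbT => /(_ isT).
lra.
Qed.

End TowerAverages.

(** * Averages of the approximation error *)

Section Residual.
Variable R : realType.
Notation mu := (@lebesgue_measure R).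
Notation I01 := (`[0%R, 1%R]%classic : set R).
Notation L1 g := (mu.-integrable setT (EFin \o g)).
Implicit Types (g : R -> R) (s h x : R) (k j M N p : nat).

(** Replaces Hölder's inequality, up to a factor 2 once integrated with a suitable threshold s. *)
Lemma powR_split_le (a q s x : R) : 0 <= a -> a <= q -> 0 < s -> 0 <= x ->
  x `^ a <= s `^ a + s `^ (a - q) * x `^ q.
Proof.
move=> a0 aq s0 x0; case: (lerP x s) => xs.
  apply: (@le_trans _ _ (s `^ a)); first by apply: ge0_ler_powR; rewrite ?nnegrE // ltW.
  by rewrite lerDl mulr_ge0 ?powR_ge0.
have xp : 0 < x by exact: lt_trans xs.
apply: (@le_trans _ _ (s `^ (a - q) * x `^ q)); last by rewrite lerDr powR_ge0.
have -> : x `^ a = x `^ (a - q) * x `^ q.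
  by rewrite -powRD ?subrK //; apply/implyP => _; rewrite gt_eqF.
rewrite ler_wpM2r ?powR_ge0 // -opprB !powRN lef_pV2 ?posrE ?powR_gt0 //.
by apply: ge0_ler_powR; rewrite ?nnegrE ?subr_ge0 // ltW.
Qed.

Lemma integral_powR_le (D : set R) (q e : R) g : 0 < q -> (LpNorm D q g <= e%:E)%E ->
  (\int[mu]_(x in D) (`|g x| `^ q)%:E <= (e `^ q)%:E)%E.
Proof.
move=> q0; rewrite /LpNorm; set V := integral _ _ _ => h.
have V0 : (0 <= V)%E by apply: integral_ge0 => x _; rewrite lee_fin powR_ge0.
have -> : V = ((V `^ q^-1) `^ q)%E by rewrite -poweRrM mulVf ?gt_eqF // poweRe1.
by rewrite -poweR_EFin; apply: poweR_le; rewrite ?poweR_ge0 // ltW.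
Qed.

Lemma measurable_norm_powR g (q : R) : L1 g -> measurable_fun setT (fun x => (`|g x| `^ q)%:E).
Proof.
move=> /integrableP[mg _]; apply/measurable_EFinP.
apply: (measurableT_comp (measurable_powR q)); apply: measurableT_comp => //.
by apply/measurable_EFinP.
Qed.

Lemma avg_moment_le g (q al A B : R) k j : L1 g -> 0 <= al -> 0 <= A -> 0 <= B ->
  (forall y, 0 <= y -> al * y <= A + B * y `^ q) ->
  ((al * `|avg g k j| / 2 ^+ k)%:E <=
   (A / 2 ^+ k)%:E + B%:E * \int[mu]_(x in cell k j) (`|g x| `^ q)%:E)%E.
Proof.
move=> gi al0 A0 B0 H.
have mq : measurable_fun (cell k j) (fun x => (`|g x| `^ q)%:E).
  by apply: measurable_funS (measurable_norm_powR q gi).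
have q0 x : (0 <= (`|g x| `^ q)%:E)%E by rewrite lee_fin powR_ge0.
have -> : al * `|avg g k j| / 2 ^+ k = al * `|\int[mu]_(x in cell k j) g x|.
  by rewrite /avg normrM gtr0_norm // -mulrA [_ * `| _ |]mulrC mulfK.
rewrite EFinM; apply: (@le_trans _ _ (al%:E * \int[mu]_(x in cell k j) `|g x|%:E)%E).
  by apply: lee_pmul => //; exact: normr_Rintegral_cell.
rewrite -ge0_integralZl_EFin //; last first.
  by apply: measurable_funS (L1_measurable_norm gi).
apply: (@le_trans _ _ (\int[mu]_(x in cell k j) (A%:E + B%:E * (`|g x| `^ q)%:E))%E).
  apply: ge0_integral_mono => x _; first by rewrite -EFinM lee_fin mulr_ge0.
  by rewrite -!EFinM -EFinD lee_fin H.
rewrite ge0_integralD //; last 2 first.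
- by move=> x _; apply: mule_ge0.
- by apply: emeasurable_funM => //; exact: measurable_cst.
rewrite integral_cst // [X in (_ * X + _)%E](mu_cell _ k j) ge0_integralZl_EFin //.
Qed.

(** The threshold s = e 2^(K/q) balances the two terms of [powR_split_le] on a cell of measure 2^-K;
    larger cells only do better. *)
Lemma norm_avg_residual_le g (q e : R) k K j : L1 g -> 1 <= q -> 0 < e ->
  (LpNorm I01 q g <= e%:E)%E -> (k <= K)%N -> (j < 2 ^ k)%N ->
  `|avg g k j| <= 2 * (2 ^+ K) `^ q^-1 * e.
Proof.
move=> gi q1 e0 ge kK jk; have q0 : 0 < q by exact: lt_le_trans q1.
set Y := (2 ^+ K) `^ q^-1; have Y0 : 0 < Y by rewrite powR_gt0.
set s := e * Y; have s0 : 0 < s by rewrite mulr_gt0.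
have sq : s `^ q = e `^ q * 2 ^+ K.
  by rewrite powRM ?(ltW e0) ?(ltW Y0) // /Y -powRrM mulVf ?gt_eqF // powRr1 // ltW.
have := @avg_moment_le g q 1 s (s `^ (1 - q)) k j gi ler01 (ltW s0) (powR_ge0 _ _).
have H y : 0 <= y -> 1 * y <= s + s `^ (1 - q) * y `^ q.
  move=> y0; have := @powR_split_le 1 q s y ler01 q1 s0 y0.
  by rewrite mul1r !powRr1 // ltW.
move=> /(_ H) M; have I : (\int[mu]_(x in cell k j) (`|g x| `^ q)%:E <= (e `^ q)%:E)%E.
  apply: le_trans (integral_powR_le q0 ge); apply: ge0_integral_subset; last exact: cell_sub01.
  by move=> x _; rewrite lee_fin powR_ge0.
have {M} := le_trans M (leeD (lexx _) (lee_wpmul2l _ I)).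
rewrite lee_fin powR_ge0 => /(_ isT); rewrite -EFinM -EFinD lee_fin mul1r.
rewrite ler_pdivrMr // mulrDl divfK // => M; apply: le_trans M _.
have -> : 2 * Y * e = s + s by rewrite /s; ring.
rewrite lerD2l (_ : s `^ (1 - q) = s / s `^ q); last first.
  rewrite powRD ?powRr1 ?powRN // ?(ltW s0) //; by apply/implyP => _; rewrite gt_eqF.
have en : e `^ q != 0 by rewrite gt_eqF // powR_gt0.
have -> : s / s `^ q * e `^ q * 2 ^+ k = s * (2 ^+ k / 2 ^+ K).
  by rewrite sq; have := pow2_neq0 R K; move: (2 ^+ K) => p p0; field; rewrite p0 en.
by rewrite ler_piMr ?(ltW s0) // ler_pdivrMr // mul1r ler_weXn2l // ler1n.
Qed.

(** With a the absolute average on a cell, 2 a |g| <= a^2 + |g|^2 <= a^2 + e^2 + e^(2-q) |g|^q.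
    Integrated over the cell, the a^2 is absorbed on the left; the sum over cells is then at most
    e^2 + e^(2-q) e^q. *)
Lemma avg_sqr_residual_le g (q e : R) K : L1 g -> 2 <= q -> 0 < e ->
  (LpNorm I01 q g <= e%:E)%E -> avg_sqr g K <= 2 * e ^+ 2.
Proof.
move=> gi q2 e0 ge; have q0 : 0 < q by exact: lt_le_trans q2.
rewrite -lee_fin /avg_sqr -sumEFin.
pose V (j : nat) := (\int[mu]_(x in cell K j) (`|g x| `^ q)%:E)%E.
have H (a y : R) : (0 : R) <= y -> 2 * a * y <= a ^+ 2 + e ^+ 2 + e `^ (2 - q) * y `^ q.
  move=> y0; have := @powR_split_le 2 q e y (ltW (ltr0Sn _ _)) q2 e0 y0.
  rewrite !powR_mulrn // ?(ltW e0) // => h; have := sqr_ge0 (y - a); move: h; nra.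
apply: (@le_trans _ _ (\sum_(j < 2 ^ K) ((e ^+ 2 / 2 ^+ K)%:E + (e `^ (2 - q))%:E * V j))%E).
  apply: lee_sum => j _; pose a : R := `|avg g K j|.
  have := @avg_moment_le g q (2 * a) (a ^+ 2 + e ^+ 2) (e `^ (2 - q)) K j gi.
  have a0 : 0 <= 2 * a by rewrite /a mulr_ge0.
  have A0 : 0 <= a ^+ 2 + e ^+ 2 by apply: addr_ge0; exact: sqr_ge0.
  move=> /(_ a0 A0 (powR_ge0 _ _) (H a)); rewrite -/a -/(V j) natrX.
  have W0 : (0 <= (e `^ (2 - q))%:E * V j)%E.
    by apply: mule_ge0; [rewrite lee_fin powR_ge0|apply: integral_ge0 => x _; rewrite lee_fin powR_ge0].
  rewrite -(real_normK (num_real (avg g K j))) -/a.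
  move: (_ * V j)%E W0 => [w| |] // W0; last by move=> _; rewrite leey.
  by rewrite -!EFinD !lee_fin; move: (2 ^+ K)^-1 => p h; lra.
rewrite big_split /=.
have -> : (\sum_(j < 2 ^ K) (e ^+ 2 / 2 ^+ K)%:E = (e ^+ 2)%:E)%E.
  by rewrite sumEFin sumr_const card_ord -[_ *+ (2 ^ K)]mulr_natr natrX divfK.
rewrite -ge0_sume_distrr /=; last by move=> j _; apply: integral_ge0 => x _; rewrite lee_fin powR_ge0.
have I : (\sum_(j < 2 ^ K) V j <= (e `^ q)%:E)%E.
  apply: le_trans (integral_powR_le q0 ge).
  apply: (@sum_cell_integral_le R K (2 ^ K) predT) => //.
  - exact: measurable_norm_powR.
  - by move=> j jK _; exact: cell_sub01.
have c0 : (0 <= (e `^ (2 - q))%:E)%E by rewrite lee_fin powR_ge0.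
apply: le_trans (leeD (lexx _) (lee_wpmul2l c0 I)) _.
rewrite -EFinM -EFinD lee_fin -powRD ?subrK ?powR_mulrn ?(ltW e0) //; last by apply/implyP => _; rewrite gt_eqF.
by rewrite le_eqVlt; apply/predU1P; left; ring.
Qed.

End Residual.

(** * The rank argument for the lower bound *)

Section LowRankError.
Variable R : realType.
Notation mu := (@lebesgue_measure R).
Notation I01 := (`[0%R, 1%R]%classic : set R).
Notation L1 g := (mu.-integrable setT (EFin \o g)).
Implicit Types (f g : R -> R) (s : R) (k j N n : nat).

Lemma L1_patch_inLp (q : R) g : 1 <= q -> inLp I01 q g -> L1 (g \_ I01).
Proof.
move=> q1 [mg]; have q0 : 0 < q by exact: lt_le_trans q1.
case E : (LpNorm I01 q g) => [e| |] // _; last by have := LpNorm_ge0 I01 q g; rewrite E.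
apply: L1_patch01 => //; rewrite LpNorm1.
have mq : measurable_fun I01 (fun x => (`|g x| `^ q)%:E).
  apply/measurable_EFinP; apply: (measurableT_comp (measurable_powR q)).
  exact: measurableT_comp.
apply: (@le_lt_trans _ _ (\int[mu]_(x in I01) (1%:E + (`|g x| `^ q)%:E))%E).
  apply: ge0_integral_mono => x _; rewrite ?lee_fin //.
  have := @powR_split_le R 1 q 1 `|g x| ler01 q1 ltr01 (normr_ge0 _).
  by rewrite powR1 powRr1 // mul1r.
rewrite ge0_integralD // integral_cst //= [X in (_ * X + _)%E]lebesgue_measure_itv /= lte_fin ltr01.
rewrite sube0 mule1.
apply: lte_add_pinfty; first exact: ltry.
apply: le_lt_trans (ltry (e `^ q)); apply: integral_powR_le => //; by rewrite E.
Qed.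

Lemma LpNorm_patch01 (q : R) g : LpNorm I01 q (g \_ I01) = LpNorm I01 q g.
Proof.
by rewrite /LpNorm; congr (_ `^ _)%E; apply: eq_integral => x xI; rewrite patchE xI.
Qed.

Lemma avg_sqr_patch01 g K : avg_sqr (g \_ I01) K = avg_sqr g K.
Proof. by apply: eq_bigr => j _; rewrite avg_patch01. Qed.

Lemma avg_sqrB_le f g K : L1 f -> L1 g ->
  avg_sqr f K <= 2 * avg_sqr (fun x => f x + g x) K + 2 * avg_sqr g K.
Proof.
move=> fi gi; rewrite /avg_sqr !mulr_sumr -big_split /=; apply: ler_sum => j _.
rewrite avgD //; move: (avg f K j) (avg g K j) => a b.
rewrite ![2 * (_ * _)]mulrCA -mulrDr ler_wpM2l //.
by have := sqr_ge0 (a + 2 * b); lra.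
Qed.

(** Shared by both regimes. The residual changes T (F x) x by at most d, so the weighted trace of T
    (y x) z is at least (sum w) (b - d). The Bessel hypothesis bounds the weighted squared
    Hilbert-Schmidt norm by sum w times the L_2-bound for the approximants, and one factor sum w is
    divided out. *)
Lemma low_rank_error (I : finType) n K (w : I -> R) (T : (R -> R) -> I -> R)
    (F : I -> R -> R) (g : 'I_n -> R -> R) (q e b B : R) :
  2 <= q -> 0 < e -> 0 <= B -> (forall x, 0 <= w x) ->
  (forall f h a y, L1 f -> L1 h -> T (fun x => a * f x + h x) y = a * T f y + T h y) ->
  (forall f y, T (f \_ I01) y = T f y) ->
  (forall f d y, L1 f ->
     (forall k j, (k <= K)%N -> (j < 2 ^ k)%N -> `|avg f k j| <= d) -> `|T f y| <= d) ->
  (forall f, L1 f -> \sum_y w y * T f y ^+ 2 <= avg_sqr f K) ->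
  (forall x, inLp I01 q (F x)) -> (forall x, b <= T (F x) x) -> (forall x, avg_sqr (F x) K <= B) ->
  (forall i, inLp I01 q (g i)) ->
  (forall x, exists c : 'I_n -> R,
     (LpNorm I01 q (fun u => F x u - \sum_(i < n) c i * g i u)%R <= e%:E)%E) ->
  let d := 2 * (2 ^+ K) `^ q^-1 * e in d <= b ->
  (\sum_x w x) * (b - d) ^+ 2 <= n%:R * (2 * B + 4 * e ^+ 2).
Proof.
move=> q2 e0 B0 w0 Tlin Tpatch Tbound Tbessel Fq Fb FB gq /choice[c capx] d db.
have q1 : 1 <= q by apply: le_trans q2; rewrite ler1n.
pose G i := g i \_ I01; have Gi i : L1 (G i) by exact: (L1_patch_inLp q1 (gq i)).
pose y x u := \sum_(i < n) c x i * G i u.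
have yi x : L1 (y x) by apply: L1_sum => i _; exact: L1Z.
pose r x u := (F x \_ I01) u - y x u.
have Fi x : L1 (F x \_ I01) by exact: (L1_patch_inLp q1 (Fq x)).
have ri x : L1 (r x).
  rewrite (_ : r x = fun u => (F x \_ I01) u + (- 1) * y x u); last by apply/funext => u; rewrite mulN1r.
  by apply: L1D => //; exact: L1Z.
have rE x : r x = (fun u => F x u - \sum_(i < n) c x i * g i u) \_ I01.
  apply/funext => u; rewrite /r /y /G !patchE; case: ifPn => uI.
    by congr (_ - _); apply: eq_bigr => i _; rewrite patchE uI.
  by rewrite big1 ?subr0 // => i _; rewrite patchE (negbTE uI) mulr0.
have rN x : (LpNorm I01 q (r x) <= e%:E)%E by rewrite rE LpNorm_patch01.
have FE x : F x \_ I01 = fun u => 1 * r x u + y x u.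
  by apply/funext => u; rewrite /r mul1r subrK.
have T0 z : T (fun=> 0) z = 0.
  have i0 : L1 (fun=> 0 : R) by exact: integrable0.
  by apply/eqP; rewrite -normr_le0; apply: Tbound => // k j _ _; rewrite avg_cst normr0.
have Ty x z : T (y x) z = \sum_(i < n) c x i * T (G i) z.
  rewrite /y; elim: (index_enum _) => [|i s IH].
    by rewrite big_nil (_ : (fun u => _) = fun=> 0) //; apply/funext => u; rewrite big_nil.
  rewrite big_cons (_ : (fun u => _) = fun u => c x i * G i u + \sum_(i <- s) c x i * G i u).
    by rewrite Tlin ?IH //; apply: L1_sum => *; exact: L1Z.
  by apply/funext => u; rewrite big_cons.
have yb x : b - d <= T (y x) x.
  have : `|T (r x) x| <= d.
    by apply: Tbound => // k j kK jk; apply: (norm_avg_residual_le _ q1 e0 (rN x)).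
  have := Fb x; rewrite -Tpatch FE Tlin // mul1r ler_norml; lra.
have yB x : avg_sqr (y x) K <= 2 * B + 4 * e ^+ 2.
  have := avg_sqrB_le K (yi x) (ri x).
  rewrite (_ : (fun u => y x u + r x u) = F x \_ I01); last by apply/funext => u; rewrite FE mul1r addrC.
  have := avg_sqr_residual_le K (ri x) q2 e0 (rN x); have := FB x; rewrite avg_sqr_patch01; lra.
have W0 : 0 <= \sum_x w x by apply: sumr_ge0.
(* Splitting the weights as square roots between rows and columns gives weight w x on the diagonal
   and w x * w z in the squared norm, without raising the rank. *)
have := low_rank_trace (fun x i => Num.sqrt (w x) * c x i) (fun i z => Num.sqrt (w z) * T (G i) z).
have sE x z : \sum_i (Num.sqrt (w x) * c x i) * (Num.sqrt (w z) * T (G i) z) =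
    Num.sqrt (w x) * Num.sqrt (w z) * T (y x) z.
  by rewrite Ty mulr_sumr; apply: eq_bigr => i _; ring.
under eq_bigr do rewrite sE -expr2 sqr_sqrtr //.
under [X in _ <= _ * X]eq_bigr do under eq_bigr do rewrite sE !exprMn !sqr_sqrtr // -mulrA.
under [X in _ <= _ * X]eq_bigr do rewrite -mulr_sumr.
move=> H; have {}H : ((\sum_x w x) * (b - d)) ^+ 2 <= n%:R * ((\sum_x w x) * (2 * B + 4 * e ^+ 2)).
  apply: le_trans (le_trans H _).
    rewrite lerXn2r ?nnegrE ?mulr_ge0 ?subr_ge0 //.
      by apply: sumr_ge0 => x _; rewrite mulr_ge0 // (le_trans _ (yb x)) // subr_ge0.
    by rewrite mulr_suml; apply: ler_sum => x _; rewrite ler_wpM2l.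
  rewrite ler_wpM2l // mulr_suml; apply: ler_sum => x _; rewrite ler_wpM2l //.
  exact: le_trans (Tbessel _ (yi x)) (yB x).
have [W|Wn] := eqVneq (\sum_x w x) 0.
  by rewrite W mul0r mulr_ge0 // addr_ge0 // mulr_ge0 // sqr_ge0.
have Wp : 0 < \sum_x w x by rewrite lt_neqAle eq_sym Wn.
rewrite -(ler_pM2l Wp); apply: le_trans (le_trans H _).
  by rewrite le_eqVlt; apply/predU1P; left; ring.
by rewrite mulrCA.
Qed.

End LowRankError.

(** * The rank argument for towers and for single hats *)

Section Instances.
Variable R : realType.
Notation mu := (@lebesgue_measure R).
Notation I01 := (`[0%R, 1%R]%classic : set R).
Notation L1 g := (mu.-integrable setT (EFin \o g)).
Implicit Types (f g : R -> R) (c lam : R) (k j m N n L : nat).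

Lemma inLp_tower lam k L c (q : R) : 0 < q -> 0 <= lam -> inLp I01 q (tower lam k L c).
Proof.
move=> q0 l0; apply: (@inLp_bounded R q _ (lam * L%:R)) => //.
  by apply: measurable_funS (measurable_tower _ _ _ _).
move=> x; rewrite ger0_norm ?tower_ge0 // ler_wpM2l //.
apply: (@le_trans _ _ (\sum_(l < L) 1)); last by rewrite sumr_const card_ord.
by apply: ler_sum => l _; exact: hat_le1.
Qed.

(** The weights sum to 1 here; the gain over one level is in the height L / 2 of the averages. *)
Lemma tower_error k L n (lam q e : R) (g : 'I_n -> R -> R) : let K := (k + L)%N in
  2 <= q -> 0 < e -> 0 <= lam -> (forall i, inLp I01 q (g i)) ->
  (forall c, exists a : 'I_n -> R, (LpNorm I01 q
     (fun u => tower lam k L c u - \sum_(i < n) a i * g i u)%R <= e%:E)%E) ->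
  let d := 2 * (2 ^+ K) `^ q^-1 * e in d <= lam * (L%:R / 2) ->
  (lam * (L%:R / 2) - d) ^+ 2 <= n%:R * (2 * (lam ^+ 2 * (12 / 2 ^+ k)) + 4 * e ^+ 2).
Proof.
move=> K q2 e0 l0 gq cap d db; have q0 : 0 < q by apply: lt_le_trans q2.
have W : \sum_(i < 2 ^ K) (2 ^ K)%:R^-1 = 1 :> R.
  by rewrite sumr_const card_ord -[_ *+ (2 ^ K)]mulr_natr mulVf // pnatr_eq0 expn_eq0.
have := @low_rank_error R 'I_(2 ^ K) n K (fun=> (2 ^ K)%:R^-1) (fun f (i : 'I_(2 ^ K)) => avg f K i)
  (fun i => tower lam k L (cell_center R K i)) g q e (lam * (L%:R / 2)) (lam ^+ 2 * (12 / 2 ^+ k)) q2 e0.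
cbv zeta; rewrite W mul1r -/d; apply => //.
- by rewrite mulr_ge0 ?sqr_ge0 // divr_ge0 // ltW.
- by move=> f h a y fi hi; rewrite avgD ?avgZ //; exact: L1Z.
- by move=> f y; rewrite avg_patch01.
- by move=> f d' y _; apply.
- by move=> x; exact: inLp_tower.
- by move=> x; exact: avg_tower_center.
- by move=> x; exact: avg_sqr_tower_le.
Qed.

Lemma hdiff_bessel g k L : L1 g ->
  \sum_(l < L) \sum_(j < 2 ^ (k + l)) (2 ^ (k + l))%:R^-1 * (hdiff g (k + l) j / 2) ^+ 2 <=
  avg_sqr g (k + L).
Proof.
move=> gi; have H := @haar_bessel R (avg g) (hdiff g) (fun k j => avg_even k j gi) (fun k j => avg_odd k j gi) (k + L).
apply: le_trans H; rewrite big_split_ord /= lerDr.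
by apply: sumr_ge0 => l _; apply: sumr_ge0 => j _; rewrite mulr_ge0 ?sqr_ge0.
Qed.

(** One test function per cell of each of L levels: the weights 2^-level sum to L, which is the
    gain. Half of the difference lam / 4 from [hdiff_tower] is lam / 8, the halving being the one in
    Bessel's inequality. *)
Lemma bump_error k L n (lam q e : R) (g : 'I_n -> R -> R) : let K := (k + L)%N in
  2 <= q -> 0 < e -> 0 <= lam -> (forall i, inLp I01 q (g i)) ->
  (forall m c, exists a : 'I_n -> R, (LpNorm I01 q
     (fun u => tower lam m 1 c u - \sum_(i < n) a i * g i u)%R <= e%:E)%E) ->
  let d := 2 * (2 ^+ K) `^ q^-1 * e in d <= lam / 8 ->
  L%:R * (lam / 8 - d) ^+ 2 <= n%:R * (2 * (lam ^+ 2 * (12 / 2 ^+ k)) + 4 * e ^+ 2).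
Proof.
move=> K q2 e0 l0 gq cap d db; have q0 : 0 < q by apply: lt_le_trans q2.
pose I : finType := {l : 'I_L & 'I_(2 ^ (k + l))}.
pose lev (x : I) := (k + tag x)%N; pose pos (x : I) : nat := tagged x.
have pl x : (pos x < 2 ^ lev x)%N by exact: ltn_ord.
have lK x : ((lev x).+1 <= K)%N by rewrite /lev /K ltn_add2l.
have sumI (f : nat -> nat -> R) : \sum_(x : I) f (lev x) (pos x) =
    \sum_(l < L) \sum_(j < 2 ^ (k + l)) f (k + l)%N j.
  by rewrite sig_big_dep.
have W : \sum_(x : I) (2 ^ lev x)%:R^-1 = L%:R :> R.
  rewrite (sumI (fun m _ => (2 ^ m)%:R^-1)) (eq_bigr (fun=> 1)) => [|l _].
    by rewrite sumr_const card_ord.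
  by rewrite sumr_const card_ord -[_ *+ (2 ^ _)]mulr_natr mulVf // pnatr_eq0 expn_eq0.
have := @low_rank_error R I n K (fun x => (2 ^ lev x)%:R^-1) (fun f x => hdiff f (lev x) (pos x) / 2)
  (fun x => tower lam (lev x).+2 1 (cell_center R (lev x).+1 (pos x).*2.+1)) g q e (lam / 8)
  (lam ^+ 2 * (12 / 2 ^+ k)) q2 e0.
cbv zeta; rewrite W -/d; apply => //.
- by rewrite mulr_ge0 ?sqr_ge0 // divr_ge0 // ltW.
- move=> f h a y fi hi; rewrite /hdiff !avgD ?avgZ //; try exact: L1Z.
  by field.
- by move=> f y; rewrite hdiff_patch01.
- move=> f d' y _ H.
  have h1 := H (lev y).+1 (pos y).*2 (lK y); have h2 := H (lev y).+1 (pos y).*2.+1 (lK y).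
  move: h1 h2; rewrite expnS mul2n ltn_double ltn_Sdouble pl /hdiff => /(_ isT) + /(_ isT).
  by rewrite !ler_norml; lra.
- move=> f fi; rewrite (sumI (fun m j => (2 ^ m)%:R^-1 * (hdiff f m j / 2) ^+ 2)).
  exact: hdiff_bessel.
- by move=> x; exact: inLp_tower.
- by move=> x; have := hdiff_tower (lev x) (pos x) l0; lra.
- move=> x; apply: le_trans (avg_sqr_tower_le _ _ _ _ l0) _.
  rewrite ler_wpM2l ?sqr_ge0 // ler_wpM2l // lef_pV2 ?posrE //.
  by rewrite ler_weXn2l ?ler1n // /lev; lia.
Qed.

End Instances.

(** * Choice of levels and the lower bound *)

Section LowerBound.
Variable R : realType.
Notation I01 := (`[0%R, 1%R]%classic : set R).
Implicit Types (m n L k : nat).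

Lemma width_lt_approx (q e : R) (C : set (R -> R)) n :
  (kolmogorov_width I01 q C n < e%:E)%E ->
  exists g : 'I_n -> R -> R, (forall i, inLp I01 q (g i)) /\
    forall f, C f -> exists c : 'I_n -> R,
      (LpNorm I01 q (fun u => f u - \sum_(i < n) c i * g i u)%R <= e%:E)%E.
Proof.
move=> /ereal_inf_lt[_ [g gq <-]] H; exists g; split => // f Cf.
have /ereal_inf_lt[y [c _ <-] yl] : (ereal_inf
    [set LpNorm I01 q (fun x => f x - \sum_(i < n) c i * g i x)%R | c in @setT ('I_n -> R)] < e%:E)%E.
  by apply: le_lt_trans H; apply: ereal_sup_ubound; exists f.
by exists c; exact: ltW.
Qed.

(** For P >= 2^13 sn^2 the contribution of the test functions to the right side is at most (lam /
    16)^2, small enough to be absorbed by sW * b; only the term in sn * e survives. *)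
Lemma square_root_bound (sW sn b d lam e P : R) : 0 <= sW -> 0 <= sn -> 0 <= e -> 0 <= lam ->
  d <= b -> 0 < P -> 256 * (32 * sn ^+ 2) <= P ->
  sW ^+ 2 * (b - d) ^+ 2 <= sn ^+ 2 * (2 * (lam ^+ 2 * (12 / P)) + 4 * e ^+ 2) ->
  sW * (b - d) <= lam / 16 + 2 * sn * e.
Proof.
move=> W0 n0 e0 l0 db P0 nP H.
rewrite -(ler_pXn2r (n := 2)) ?nnegrE; first last.
- by rewrite addr_ge0 ?divr_ge0 ?mulr_ge0.
- by rewrite mulr_ge0 ?subr_ge0.
- by [].
rewrite exprMn; apply: le_trans H _.
have h : 256 * (32 * (sn ^+ 2 / P)) <= 1 by rewrite !mulrA ler_pdivrMr // mul1r -!mulrA.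
have -> : sn ^+ 2 * (2 * (lam ^+ 2 * (12 / P)) + 4 * e ^+ 2) =
  24 * (lam ^+ 2 * (sn ^+ 2 / P)) + 4 * sn ^+ 2 * e ^+ 2 by field; rewrite gt_eqF.
have h2 : 256 * (24 * (lam ^+ 2 * (sn ^+ 2 / P))) <= lam ^+ 2.
  have s0 : 0 <= sn ^+ 2 / P by rewrite divr_ge0 ?sqr_ge0 // ltW.
  have := ler_wpM2l (sqr_ge0 lam) h; have := mulr_ge0 (sqr_ge0 lam) s0.
  by move: (lam ^+ 2) (sn ^+ 2 / P) => u v; lra.
have := mulr_ge0 l0 (mulr_ge0 n0 e0).
rewrite (_ : (lam / 16 + 2 * sn * e) ^+ 2 = lam ^+ 2 / 256 + 4 * sn ^+ 2 * e ^+ 2 + lam * (sn * e) / 4).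
  by move: (lam * (sn * e)) (lam ^+ 2 * _) h2 (4 * _ * _) => v w h2 x; lra.
by field.
Qed.

Lemma powR_mul_le (a x y z : R) : 0 <= a -> a <= 1 -> 0 <= x -> 1 <= y -> 0 <= z -> x <= y * z ->
  x `^ a <= y * z `^ a.
Proof.
move=> a0 a1 x0 y1 z0 xyz; have y0 : 0 <= y by exact: le_trans y1.
apply: (@le_trans _ _ ((y * z) `^ a)); first by apply: ge0_ler_powR; rewrite ?nnegrE ?mulr_ge0.
rewrite powRM // ler_wpM2r ?powR_ge0 // -[leRHS]powRr1 //.
exact: ler_powR.
Qed.

(** The gap between 1/q and 1/2 pays for log_2 n / m extra levels and for a further factor n^(1/m),
    which dominates their number. *)
Lemma exists_level_ratio (q : R) : 2 < q ->
  exists m, (0 < m)%N /\ (1 + m%:R^-1) * q^-1 + m%:R^-1 <= 2^-1.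
Proof.
move=> q2; have q0 : 0 < q by apply: lt_trans q2.
have qi : q^-1 < 2^-1 by rewrite ltf_pV2 ?posrE.
have qp : 0 < q^-1 by rewrite invr_gt0.
pose x := (2^-1 - q^-1) / (1 + q^-1).
have x0 : 0 < x by apply: divr_gt0; lra.
have bx : x^-1 < (Num.bound x^-1)%:R by rewrite archi_boundP // invr_ge0 ltW.
have mp : (0 : R) < (Num.bound x^-1)%:R by apply: lt_trans bx; rewrite invr_gt0.
exists (Num.bound x^-1); split; first by rewrite -(ltr_nat R).
have mx : (Num.bound x^-1)%:R^-1 <= x by rewrite -[leRHS]invrK lef_pV2 ?posrE ?invr_gt0 // ltW.
have : (Num.bound x^-1)%:R^-1 * (1 + q^-1) <= 2^-1 - q^-1 by rewrite -ler_pdivlMr //; lra.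
by move: (_^-1) (q^-1) => u v; lra.
Qed.

Section Levels.
Variables (m n : nat) (q : R).
Hypotheses (m0 : (0 < m)%N) (n2 : (2 <= n)%N) (q2 : 2 < q).
Hypothesis mq : (1 + m%:R^-1) * q^-1 + m%:R^-1 <= 2^-1.
Let L := (trunc_log 2 n %/ m).+1.
Let k := (trunc_log 2 n + 14)%N.

(** 256 * 32 is 2^13, and rounding log_2 n up costs the fourteenth factor of 2. *)
Lemma level_ge : 256 * (32 * n%:R) <= 2 ^+ k :> R.
Proof.
have h : (n < 2 ^ (trunc_log 2 n).+1)%N by exact: trunc_log_ltn.
have -> : 2 ^+ k = 256 * (32 * (2 * 2 ^+ (trunc_log 2 n))) :> R.
  by rewrite /k exprD; ring.
rewrite ler_pM2l // ler_pM2l // -exprS -natrX ler_nat ltnW //.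
Qed.

Lemma ln_le_levels : ln n%:R <= m%:R * L%:R :> R.
Proof.
have n0 : (0 < n)%N by exact: leq_trans n2.
have h : (n < 2 ^ (trunc_log 2 n).+1)%N by exact: trunc_log_ltn.
apply: (@le_trans _ _ (ln (2 ^+ (trunc_log 2 n).+1))).
  rewrite ler_ln ?posrE ?ltr0n // ?exprn_gt0 // -natrX ler_nat ltnW //.
have l2 : ln (2 : R) <= 1 by rewrite (_ : 2 = 1 + 1) ?le_ln1Dx //; lra.
rewrite lnXn // -natrM -[_ *+ _]mulr_natr; apply: (@le_trans _ _ (1 * (trunc_log 2 n).+1%:R)).
  by rewrite ler_wpM2r.
by rewrite mul1r ler_nat /L mulnC ltn_ceil.
Qed.

(** Ensures that the perturbation d = 2 * 2^((k+L)/q) * e of [low_rank_error], even multiplied by L,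
    is at most a constant times n^(1/2) e. The crude bound L <= 2^(L - 1) <= n^(1/m) suffices. *)
Lemma levels_mul_le : L%:R * (2 ^+ (k + L)) `^ q^-1 <= 2 ^+ 15 * n%:R `^ 2^-1 :> R.
Proof.
have kLE a b : (a + 14 + b.+1 = 15 + (a + b))%N by lia.
have n0 : (0 < n)%N by exact: leq_trans n2.
have nr : 1 <= n%:R :> R by rewrite ler1n.
have nr0 : 0 <= n%:R :> R by exact: le_trans nr.
have q0 : 0 < q by apply: lt_trans q2.
pose t := trunc_log 2 n; pose y := 2 ^+ (t %/ m) : R.
have tn : 2 ^+ t <= n%:R :> R by rewrite -natrX ler_nat trunc_logP.
have y0 : 0 < y by exact: exprn_gt0.
have yn : y <= n%:R `^ m%:R^-1.
  have -> : y = (y ^+ m) `^ m%:R^-1.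
    by rewrite -powR_mulrn ?(ltW y0) // -powRrM mulfV ?pnatr_eq0 -?lt0n // powRr1 // ltW.
  apply: ge0_ler_powR; rewrite ?nnegrE ?exprn_ge0 ?(ltW y0) //.
  apply: le_trans tn; rewrite /y -exprM ler_weXn2l ?ler1n //; exact: leq_trunc_div.
have Ly : L%:R <= y by rewrite /y -natrX ler_nat /L; exact: ltn_expl.
have PE : 2 ^+ (k + L) <= 2 ^+ 15 * n%:R `^ (1 + m%:R^-1) :> R.
  have -> : 2 ^+ (k + L) = 2 ^+ 15 * (2 ^+ t * y) :> R.
    by rewrite /k /L /y -!exprD -/t kLE.
  rewrite ler_pM2l ?exprn_gt0 // powRD ?powRr1 //; last by apply/implyP; rewrite pnatr_eq0 -lt0n.
  by apply: ler_pM; rewrite ?exprn_ge0 ?(ltW y0).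
have b1 : 1 <= 2 ^+ 15 :> R by rewrite exprn_ege1 // ler1n.
have b0 : 0 <= 2 ^+ 15 :> R by exact: le_trans b1.
have PQ : (2 ^+ (k + L)) `^ q^-1 <= 2 ^+ 15 * n%:R `^ ((1 + m%:R^-1) * q^-1).
  apply: (@le_trans _ _ ((2 ^+ 15 * n%:R `^ (1 + m%:R^-1)) `^ q^-1)).
    by apply: ge0_ler_powR; rewrite ?nnegrE ?exprn_ge0 ?mulr_ge0 ?powR_ge0 ?invr_ge0 ?(ltW q0).
  rewrite powRM ?powR_ge0 // -powRrM ler_wpM2r ?powR_ge0 //.
  rewrite -[leRHS]powRr1 //; apply: ler_powR => //.
  by rewrite invf_le1 // (le_trans _ (ltW q2)) // ler1n.
apply: (@le_trans _ _ (n%:R `^ m%:R^-1 * (2 ^+ 15 * n%:R `^ ((1 + m%:R^-1) * q^-1)))).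
  by apply: ler_pM; rewrite ?powR_ge0 //; exact: le_trans yn.
rewrite mulrCA ler_wpM2l // -powRD; last by apply/implyP; rewrite pnatr_eq0 -lt0n.
by apply: ler_powR => //; rewrite addrC.
Qed.

End Levels.

Lemma lower_bound (q : R) : 2 < q -> exists c : R, 0 < c /\
  forall (theta : \bar R) n, (1 <= theta)%E -> (2 <= n)%N ->
  let d := kolmogorov_width I01 q (besov_class I01 1 1 theta) n in
  ((theta <= 2%:E)%E -> ((c * n%:R `^ (- 2^-1) * ln n%:R `^ 2^-1)%:E <= d)%E) /\
  ((2%:E <= theta)%E -> ((c * n%:R `^ (- 2^-1) * ln n%:R `^ (1 - inv_theta theta))%:E <= d)%E).
Proof.
move=> q2; have [m [m0 mq]] := exists_level_ratio q2.
pose A : R := 2 ^+ 15; have A0 : 0 < A by exact: exprn_gt0.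
have mr : 0 < m%:R :> R by rewrite ltr0n.
(* 28 is the normalisation of the test functions, 64 (1 + A) collects the errors in sn * e, and m
   converts L levels into ln n. *)
pose c := ((28 * 64 * (1 + A)) * m%:R)^-1 : R.
have A1 : 0 < 28 * 64 * (1 + A) :> R by rewrite !mulr_gt0 // addr_gt0.
have c0 : 0 < c by rewrite invr_gt0 mulr_gt0.
exists c; split => // theta n th1 n2 D.
have n0 : (0 < n)%N by exact: leq_trans n2.
have nr : 0 < n%:R :> R by rewrite ltr0n.
pose sn : R := n%:R `^ 2^-1; have sn0 : 0 < sn by rewrite powR_gt0.
have sn2 : sn ^+ 2 = n%:R by rewrite /sn powR12_sqrt ?sqr_sqrtr // ltW.
pose L := (trunc_log 2 n %/ m).+1; pose k := (trunc_log 2 n + 14)%N.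
have L1 : 1 <= L%:R :> R by rewrite ler1n.
have L0 : 0 <= L%:R :> R by exact: le_trans L1.
have lnn : 0 < ln n%:R :> R by apply: lt_le_trans (ln2_gt0 R) _; exact: ln2_le_ln.
have kn : 256 * (32 * sn ^+ 2) <= 2 ^+ k :> R by rewrite sn2; exact: level_ge.
have lnL : ln n%:R <= m%:R * L%:R :> R by exact: ln_le_levels.
have KL : L%:R * (2 ^+ (k + L)) `^ q^-1 <= A * sn by exact: levels_mul_le.
have m1 : 1 <= m%:R :> R by rewrite ler1n.
(* Contradiction scheme for both regimes, with X = L^(1/2), a = 1/2 for theta <= 2 and X = L, a = 1
   - 1/theta for theta >= 2: a width below e forces lam * X to be smaller than the size of the test
   functions permits. *)
have core (a lam X : R) : 0 <= a -> a <= 1 -> 0 < lam -> L%:R `^ a / 28 <= lam * X ->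
   (forall e, 0 < e -> (D < e%:E)%E -> lam * X < 64 * (1 + A) * (sn * e)) ->
   ((c * n%:R `^ (- 2^-1) * ln n%:R `^ a)%:E <= D)%E.
  move=> a0 a1 l0 LX H; rewrite leNgt; apply/negP => De.
  set e := c * _ * _ in De; have e0 : 0 < e by rewrite !mulr_gt0 ?powR_gt0.
  have := H e e0 De; apply/negP; rewrite -leNgt; apply: le_trans LX.
  have -> : 64 * (1 + A) * (sn * e) = ln n%:R `^ a / m%:R / 28.
    have nn : n%:R `^ (- 2^-1) = sn^-1 :> R by rewrite powRN.
    rewrite /e nn /c; field; rewrite !gt_eqF //= addr_gt0 //.
  by rewrite ler_wpM2r // ler_pdivrMr // mulrC; exact: powR_mul_le (ltW lnn) m1 L0 lnL.
split => th2.
  pose lam : R := 28^-1; have lam0 : 0 < lam by rewrite invr_gt0.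
  pose sW : R := L%:R `^ 2^-1; have sW0 : 0 <= sW by exact: powR_ge0.
  have sW2 : sW ^+ 2 = L%:R by rewrite /sW powR12_sqrt ?sqr_sqrtr.
  have sW1 : 1 <= sW by rewrite -(expr_ge1 (n := 2)) // sW2.
  have sWL : sW <= L%:R by rewrite -sW2 expr2 ler_peMl.
  apply: (core 2^-1 lam sW) => //; rewrite ?invr_ge0 //.
  - by rewrite invf_le1 // ler1n.
  - by rewrite mulrC.
  move=> e e0 /width_lt_approx[g [gq H]].
  pose d := 2 * (2 ^+ (k + L)) `^ q^-1 * e.
  have dW : sW * d <= 2 * A * (sn * e).
    have : sW * (2 ^+ (k + L)) `^ q^-1 <= A * sn by apply: le_trans KL; rewrite ler_wpM2r ?powR_ge0.
    by rewrite -(ler_pM2r e0) /d; lra.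
  have se : 0 < sn * e by rewrite mulr_gt0.
  have lW : lam <= lam * sW by rewrite ler_peMr // ltW.
  have Ase : 0 < A * (sn * e) by rewrite mulr_gt0.
  (* If d exceeds lam / 8, then [dW] alone bounds lam * sW by a multiple of sn * e, without the rank
     argument. *)
  have [db|bd] := lerP d (lam / 8); last first.
    have : sW * (lam / 8) <= sW * d by rewrite ler_wpM2l // ltW.
    by lra.
  have cap mm cc : exists a : 'I_n -> R, (LpNorm I01 q
     (fun u => tower lam mm 1 cc u - \sum_(i < n) a i * g i u)%R <= e%:E)%E.
    by apply: H; have := @tower_in_class R mm 1 cc theta isT th1; rewrite powR1 mulr1.
  have B := bump_error (k := k) (L := L) (ltW q2) e0 (ltW lam0) gq cap db.
  rewrite -/d -sn2 -sW2 in B.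
  have := square_root_bound sW0 (ltW sn0) (ltW e0) (ltW lam0) db (pow2_gt0 R k) kn B.
  by rewrite mulrBr; lra.
have /andP[t0 t1] := inv_theta_half th2; set t := inv_theta theta in t0 t1 *.
pose lam : R := (28 * L%:R `^ t)^-1.
have Lt0 : 0 < L%:R `^ t by rewrite powR_gt0 // (lt_le_trans _ L1).
have lam0 : 0 < lam by rewrite invr_gt0 mulr_gt0.
apply: (core (1 - t) lam L%:R) => //; try lra.
  rewrite powRD ?powRr1 ?powRN //; last by apply/implyP => _; rewrite gt_eqF // (lt_le_trans _ L1).
  by rewrite le_eqVlt; apply/predU1P; left; rewrite /lam; field; rewrite gt_eqF.
move=> e e0 /width_lt_approx[g [gq H]].
pose d := 2 * (2 ^+ (k + L)) `^ q^-1 * e.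
have dL : d <= 2 * A * (sn * e).
  have : (2 ^+ (k + L)) `^ q^-1 <= A * sn by apply: le_trans KL; rewrite ler_peMl ?powR_ge0.
  by rewrite -(ler_pM2r e0) /d; lra.
have se : 0 < sn * e by rewrite mulr_gt0.
have lL : lam <= lam * L%:R by rewrite ler_peMr // ltW.
have Ase : 0 < A * (sn * e) by rewrite mulr_gt0.
have [db|bd] := lerP d (lam * (L%:R / 2)); last by lra.
have cap cc : exists a : 'I_n -> R, (LpNorm I01 q
   (fun u => tower lam k L cc u - \sum_(i < n) a i * g i u)%R <= e%:E)%E.
  by apply: H; exact: tower_in_class.
have B := tower_error (ltW q2) e0 (ltW lam0) gq cap db.
rewrite -/d -sn2 in B.
have := square_root_bound ler01 (ltW sn0) (ltW e0) (ltW lam0) db (pow2_gt0 R k) kn.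
by rewrite expr1n !mul1r => /(_ B); lra.
Qed.

End LowerBound.

Unset Implicit Arguments.

Theorem theorem1 (R : realType) (q : R) (hq : 2 < q) :
  exists c C : R, 0 < c /\ 0 < C /\
  forall (theta : \bar R) (n : nat),
    (1 <= theta)%E -> (2 <= n)%N ->
    let d := kolmogorov_width `[0, 1] q (besov_class `[0, 1] 1 1 theta) n in
    ((theta <= 2%:E)%E ->
       ((c * n%:R `^ (- 2^-1) * ln n%:R `^ 2^-1)%:E <= d)%E /\
       (d <= (C * n%:R `^ (- 2^-1) * ln n%:R `^ 2^-1)%:E)%E) /\
    ((2%:E <= theta)%E ->
       ((c * n%:R `^ (- 2^-1) * ln n%:R `^ (1 - inv_theta theta))%:E <= d)%E /\
       (d <= (C * n%:R `^ (- 2^-1) * ln n%:R `^ (1 - inv_theta theta))%:E)%E).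
Proof.
have [c [c0 lower]] := lower_bound hq; have [C [C0 upper]] := upper_bound hq.
exists c, C; split => //; split => // theta n th1 n2 d.
have [l1 l2] := lower theta n th1 n2; have [u1 u2] := upper theta n th1 n2.
by split=> th2; split; [exact: l1|exact: u1|exact: l2|exact: u2].
Qed.
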